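(* For all integers $n\ge1$ and $m\ge n+1$, there exists a minimum proper holomorphic map from $\mathbb{B}^n$ to $D^{IV}_m$.
   Context: $\mathbb{B}^n=\{z\in\mathbb{C}^n:|z|^2<1\}$; $D^{IV}_m=\{Z\in\mathbb{C}^m: Z\overline{Z}^t<2,\ 1-Z\overline{Z}^t+\tfrac14|ZZ^t|^2>0\}$ (row vectors). A holomorphic map is proper if preimages of compact sets are compact. Maps $F_1,F_2:\mathbb{B}^n\to D^{IV}_m$ are equivalent if $F_1=\phi\circ F_2\circ\psi$ with $\psi$, $\phi$ biholomorphic automorphisms of $\mathbb{B}^n$, $D^{IV}_m$ respectively. A holomorphic map $F:\mathbb{B}^n\to D^{IV}_m$ is minimum if there is no holomorphic map $G:\mathbb{B}^n\to D^{IV}_{m-1}$ such that $F$ is equivalent to $(G,0)$. *)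

(* Defs.v *)
From Stdlib Require Import Reals List.
Open Scope R_scope.

Definition C : Type := (R * R)%type.
Definition C0 : C := (0, 0).
Definition Cadd (a b : C) : C := (fst a + fst b, snd a + snd b).
Definition Csub (a b : C) : C := (fst a - fst b, snd a - snd b).
Definition Cmul (a b : C) : C :=
  (fst a * fst b - snd a * snd b, fst a * snd b + snd a * fst b).
Definition Cnorm2 (a : C) : R := fst a * fst a + snd a * snd a.

(** Vectors: a point of C^n is a map nat -> C vanishing at indices >= n
    (so C^(m-1) sits inside C^m as {Z_m = 0}, i.e. (G,0) is G itself). *)
Definition Vec : Type := nat -> C.
Definition supported (n : nat) (z : Vec) : Prop := forall i, (n <= i)%nat -> z i = C0.

Fixpoint rsum (n : nat) (f : nat -> R) : R :=
  match n with O => 0 | S k => rsum k f + f k end.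
Fixpoint csum (n : nat) (f : nat -> C) : C :=
  match n with O => C0 | S k => Cadd (csum k f) (f k) end.

Definition vadd (z w : Vec) : Vec := fun i => Cadd (z i) (w i).
Definition vsub (z w : Vec) : Vec := fun i => Csub (z i) (w i).
Definition vnorm2 (n : nat) (z : Vec) : R := rsum n (fun i => Cnorm2 (z i)).
Definition vnorm (n : nat) (z : Vec) : R := sqrt (vnorm2 n z).

Definition Ball (n : nat) (z : Vec) : Prop := supported n z /\ vnorm2 n z < 1.

Definition DIV (m : nat) (Z : Vec) : Prop :=
  supported m Z /\ vnorm2 m Z < 2 /\
  1 - vnorm2 m Z + / 4 * Cnorm2 (csum m (fun i => Cmul (Z i) (Z i))) > 0.

Definition holomorphic (n m : nat) (U : Vec -> Prop) (F : Vec -> Vec) : Prop :=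
  forall z, U z ->
    exists A : nat -> nat -> C,
      forall eps, eps > 0 ->
        exists delta, delta > 0 /\
          forall h, supported n h -> vnorm n h < delta ->
            vnorm m (vsub (vsub (F (vadd z h)) (F z))
                          (fun j => csum n (fun i => Cmul (A j i) (h i))))
              <= eps * vnorm n h.

Definition holo_map (n : nat) (U : Vec -> Prop) (m : nat) (V : Vec -> Prop)
  (F : Vec -> Vec) : Prop :=
  holomorphic n m U F /\ forall z, U z -> V (F z).

Definition biholo_aut (n : nat) (U : Vec -> Prop) (F : Vec -> Vec) : Prop :=
  holo_map n U n U F /\
  exists G, holo_map n U n U G /\
    (forall z, U z -> G (F z) = z) /\ (forall z, U z -> F (G z) = z).

Definition openset (n : nat) (S : Vec -> Prop) : Prop :=
  forall x, S x -> exists r, r > 0 /\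
    forall y, supported n y -> vnorm n (vsub y x) < r -> S y.

Definition compact (n : nat) (K : Vec -> Prop) : Prop :=
  (forall x, K x -> supported n x) /\
  forall (I : Type) (O : I -> Vec -> Prop),
    (forall i, openset n (O i)) ->
    (forall x, K x -> exists i, O i x) ->
    exists l : list I, forall x, K x -> exists i, In i l /\ O i x.

Definition proper (n : nat) (U : Vec -> Prop) (m : nat) (V : Vec -> Prop)
  (F : Vec -> Vec) : Prop :=
  forall K, compact m K -> (forall w, K w -> V w) ->
    compact n (fun z => U z /\ K (F z)).

Definition equivalent (n m : nat) (F1 F2 : Vec -> Vec) : Prop :=
  exists psi phi,
    biholo_aut n (Ball n) psi /\ biholo_aut m (DIV m) phi /\
    forall z, Ball n z -> F1 z = phi (F2 (psi z)).

(** F : B^n -> D^IV_m is minimum: not equivalent to (G,0) for any holomorphic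
    G : B^n -> D^IV_{m-1}.  With our encoding (G,0) is G itself. *)
Definition minimum (n m : nat) (F : Vec -> Vec) : Prop :=
  ~ exists G, holo_map n (Ball n) (m - 1) (DIV (m - 1)) G /\ equivalent n m F G.

(* Main.v *)
(** With [h = hmap : B^n -> B^(m-1)] a proper polynomial map, [F = (h, 1 - sqrt (1 - h h^t))] satisfies
    [1 - |F|^2 + |F F^t|^2 / 4 = 1 - |h|^2], so [F] is proper into the type IV domain [D].

    If [F] were equivalent to some [(G,0)] through an automorphism [phi] of [D], conjugating the
    reflection in the last coordinate by [phi] would give a holomorphic involution [tau] of [D]
    fixing the image of [F], in particular 0, with [d tau_0 = L = I - 2 u c^t] and [c u = 1].
    [D] contains the real ball of radius [sqrt 2] and its multiples by the unit disc, and lies in the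
    complex ball of that radius, so Schwarz's lemma on the discs [w |-> tau (w x)], [x] real with
    [|x|^2 = 2], shows first that [L] is unitary and then, by the equality case, that [tau = L] on
    real points.  Hence [c] annihilates the real points of the image of [F], and the derivatives of
    [F] there.  The square root forces the last coordinate of [c] to vanish; since [L x] lies on the
    boundary of [D] for [x] real, [c] is then a complex multiple of a real vector, and comparing
    coefficients of monomials gives [c = 0]. *)
Require Import Defs.
From Stdlib Require Import Reals List Lra Lia Psatz Classical ClassicalEpsilon FunctionalExtensionality.
From Coquelicot Require Import Coquelicot.
Open Scope R_scope.

(** * Goursat's theorem for closed one-forms on rectangles *)

(** Holomorphy means here that a complex differential exists at each point, with no continuity of
    the derivative, so Cauchy's theorem comes from bisecting rectangles. The automorphism group of D
    is never described: all that is used is that discs spanned by real vectors of norm sqrt 2 lie in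
    D and reach the sphere bounding the enclosing ball.

    The map h is an average. With z' = (z_1, ..., z_(n-1)), each Whitney map (z', z_0 z', ...,
    z_0^(k-1) z', z_0^k) is proper between balls. Averaging the squared norms over k = 1, ..., d
    gives z_0^j z_i the weight (d-j)/d and each power of z_0 the weight 1/d: exactly n d components.
    With m - 1 = n d + r, the r < n missing ones arise by halving the weights of z_1, ..., z_r and
    repeating these. A repetition without the factor i would be undone by a real rotation of D,
    leaving a map into a smaller D. With it, a relation a + i b = 0 arises between two coordinates
    of c; these have a common phase, so both vanish. On the real z_0-axis the repeated components
    are 0 and F is real. *)

Lemma RInt_Rminus (f g : R -> R) (a b : R) :
  ex_RInt f a b -> ex_RInt g a b ->
  RInt (fun x => f x - g x) a b = RInt f a b - RInt g a b.
Proof. exact (RInt_minus (V := R_CompleteNormedModule) f g a b). Qed.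

Lemma RInt_const_R (a b k : R) : RInt (fun _ : R => k) a b = k * (b - a).
Proof. rewrite RInt_const. unfold scal; simpl; unfold mult; simpl; ring. Qed.

Lemma RInt_near_const (f : R -> R) (a b k M : R) :
  a <= b -> ex_RInt f a b ->
  (forall x, a <= x <= b -> Rabs (f x - k) <= M) ->
  Rabs (RInt f a b - k * (b - a)) <= M * (b - a).
Proof.
  intros hab hf H.
  assert (hc : ex_RInt (fun _ : R => k) a b) by apply ex_RInt_const.
  replace (RInt f a b - k * (b - a)) with (RInt (fun x => f x - k) a b).
  2:{ rewrite RInt_Rminus, RInt_const_R; trivial. }
  rewrite Rmult_comm. apply abs_RInt_le_const; trivial.
  now apply (ex_RInt_minus (V := R_NormedModule)).
Qed.

(* The shared coefficient K is the closedness condition dP/dt = dQ/ds of the form P ds + Q dt. *)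
Definition closed_form_at (P Q : R -> R -> R) (s0 t0 : R) : Prop :=
  exists P1 K Q2, forall eps, eps > 0 -> exists delta, delta > 0 /\
    forall s t, Rabs (s - s0) < delta -> Rabs (t - t0) < delta ->
      Rabs (P s t - P s0 t0 - P1 * (s - s0) - K * (t - t0))
        <= eps * (Rabs (s - s0) + Rabs (t - t0)) /\
      Rabs (Q s t - Q s0 t0 - K * (s - s0) - Q2 * (t - t0))
        <= eps * (Rabs (s - s0) + Rabs (t - t0)).

(** The integral of P ds + Q dt around the boundary of [a,b] x [c,d], counterclockwise. *)
Definition rect_integral (P Q : R -> R -> R) (a b c d : R) : R :=
  RInt (fun s => P s c) a b - RInt (fun s => P s d) a b
  + (RInt (fun t => Q b t) c d - RInt (fun t => Q a t) c d).

Lemma linear_approx_continuous (f : R -> R) (x0 k : R) :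
  (forall eps, eps > 0 -> exists delta, delta > 0 /\
    forall x, Rabs (x - x0) < delta -> Rabs (f x - f x0 - k * (x - x0)) <= eps * Rabs (x - x0)) ->
  continuous f x0.
Proof.
  intros H. apply continuity_pt_filterlim. intros eps he.
  destruct (H 1 Rlt_0_1) as [d [hd Hd]].
  assert (hp : 0 < 2 + Rabs k) by (pose proof (Rabs_pos k); lra).
  exists (Rmin d (eps / (2 + Rabs k))). split.
  - apply Rmin_pos; [lra|]. now apply Rdiv_lt_0_compat.
  - intros x [_ hx]. simpl in *. unfold R_dist in *.
    pose proof (Rlt_le_trans _ _ _ hx (Rmin_l _ _)) as h1.
    pose proof (Rlt_le_trans _ _ _ hx (Rmin_r _ _)) as h2.
    specialize (Hd x h1).
    replace (f x - f x0) with ((f x - f x0 - k * (x - x0)) + k * (x - x0)) by ring.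
    eapply Rle_lt_trans. apply Rabs_triang. rewrite Rabs_mult.
    apply (Rmult_lt_compat_r (2 + Rabs k)) in h2; [|lra].
    unfold Rdiv in h2. rewrite Rmult_assoc, Rinv_l in h2 by lra.
    pose proof (Rabs_pos (x - x0)). nra.
Qed.

Lemma closed_form_continuous (P Q : R -> R -> R) (s0 t0 : R) :
  closed_form_at P Q s0 t0 ->
  continuous (fun s => P s t0) s0 /\ continuous (fun t => Q s0 t) t0.
Proof.
  intros (P1 & K & Q2 & H). split.
  - apply (linear_approx_continuous _ _ P1). intros eps he. destruct (H eps he) as (d & hd & Hd).
    exists d. split; trivial. intros x hx. destruct (Hd x t0 hx) as [h _].
    { rewrite Rminus_diag, Rabs_R0; lra. }
    rewrite Rminus_diag, Rabs_R0 in h.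
    replace (P x t0 - P s0 t0 - P1 * (x - s0)) with (P x t0 - P s0 t0 - P1 * (x - s0) - K * 0) by ring.
    lra.
  - apply (linear_approx_continuous _ _ Q2). intros eps he. destruct (H eps he) as (d & hd & Hd).
    exists d. split; trivial. intros x hx. destruct (Hd s0 x) as [_ h]; trivial.
    { rewrite Rminus_diag, Rabs_R0; lra. }
    rewrite Rminus_diag, Rabs_R0 in h.
    replace (Q s0 x - Q s0 t0 - Q2 * (x - t0)) with (Q s0 x - Q s0 t0 - K * 0 - Q2 * (x - t0)) by ring.
    lra.
Qed.

Definition closed_form_on (P Q : R -> R -> R) (a b c d : R) : Prop :=
  forall s t, a <= s <= b -> c <= t <= d -> closed_form_at P Q s t.

Lemma closed_form_ex_RInt (P Q : R -> R -> R) (a b c d : R) :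
  closed_form_on P Q a b c d ->
  (forall a' b' t, a <= a' -> a' <= b' -> b' <= b -> c <= t <= d -> ex_RInt (fun s => P s t) a' b') /\
  (forall c' d' s, c <= c' -> c' <= d' -> d' <= d -> a <= s <= b -> ex_RInt (fun t => Q s t) c' d').
Proof.
  intros H. split; intros; apply (ex_RInt_continuous (V := R_CompleteNormedModule));
  intros z; rewrite Rmin_left, Rmax_right by lra; intros hz.
  - apply (closed_form_continuous P Q). apply H; lra.
  - apply (closed_form_continuous P Q). apply H; lra.
Qed.

Lemma rect_integral_split (P Q : R -> R -> R) (a e b c f d : R) :
  closed_form_on P Q a b c d -> a <= e <= b -> c <= f <= d ->
  rect_integral P Q a b c d =
    rect_integral P Q a e c f + rect_integral P Q e b c f
    + rect_integral P Q a e f d + rect_integral P Q e b f d.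
Proof.
  intros H he hf. destruct (closed_form_ex_RInt _ _ _ _ _ _ H) as [HP HQ].
  assert (CP : forall t, c <= t <= d ->
    RInt (fun s => P s t) a b = RInt (fun s => P s t) a e + RInt (fun s => P s t) e b).
  { intros t ht. symmetry. apply (RInt_Chasles (V := R_CompleteNormedModule)); apply HP; lra. }
  assert (CQ : forall s, a <= s <= b ->
    RInt (fun t => Q s t) c d = RInt (fun t => Q s t) c f + RInt (fun t => Q s t) f d).
  { intros s hs. symmetry. apply (RInt_Chasles (V := R_CompleteNormedModule)); apply HQ; lra. }
  unfold rect_integral.
  rewrite !CP, !CQ by lra. ring.
Qed.

(** The affine parts of [P] and [Q] contribute K (c - d) (b - a) and K (b - a) (d - c), which cancel
    because both cross derivatives are the same [K]. Only the remainders are left: each is at most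
    eps times the half-perimeter, integrated over a total length equal to the half-perimeter. *)
Lemma rect_integral_local (P Q : R -> R -> R) (s0 t0 eps : R) :
  eps > 0 -> closed_form_at P Q s0 t0 ->
  exists delta, delta > 0 /\ forall a b c d,
    a <= s0 <= b -> c <= t0 <= d -> b - a < delta -> d - c < delta ->
    closed_form_on P Q a b c d ->
    Rabs (rect_integral P Q a b c d) <= eps * (b - a + (d - c)) ^ 2.
Proof.
  intros he (P1 & K & Q2 & H). destruct (H (eps / 2)) as (delta & hd & Hd); [lra|].
  exists delta. split; trivial. intros a b c d hs ht hb hc Hon.
  destruct (closed_form_ex_RInt _ _ _ _ _ _ Hon) as [HP HQ].
  set (z := b - a + (d - c)).
  assert (E1 : Rabs (RInt (fun s => P s c - P s d) a b - (K * (c - d)) * (b - a)) <= eps * z * (b - a)).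
  { apply RInt_near_const; [lra| |].
    - apply (ex_RInt_minus (V := R_NormedModule)); apply HP; lra.
    - intros x hx.
      destruct (Hd x c) as [h1 _]; try (apply Rabs_lt_between; lra).
      destruct (Hd x d) as [h2 _]; try (apply Rabs_lt_between; lra).
      assert (eps / 2 * (Rabs (x - s0) + Rabs (c - t0)) <= eps / 2 * z)
        by (apply Rmult_le_compat_l; [lra|]; unfold z, Rabs; repeat destruct Rcase_abs; lra).
      assert (eps / 2 * (Rabs (x - s0) + Rabs (d - t0)) <= eps / 2 * z)
        by (apply Rmult_le_compat_l; [lra|]; unfold z, Rabs; repeat destruct Rcase_abs; lra).
      apply Rabs_le_between in h1. apply Rabs_le_between in h2. apply Rabs_le_between.
      lra. }
  assert (E2 : Rabs (RInt (fun t => Q b t - Q a t) c d - (K * (b - a)) * (d - c)) <= eps * z * (d - c)).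
  { apply RInt_near_const; [lra| |].
    - apply (ex_RInt_minus (V := R_NormedModule)); apply HQ; lra.
    - intros x hx.
      destruct (Hd b x) as [_ h1]; try (apply Rabs_lt_between; lra).
      destruct (Hd a x) as [_ h2]; try (apply Rabs_lt_between; lra).
      assert (eps / 2 * (Rabs (b - s0) + Rabs (x - t0)) <= eps / 2 * z)
        by (apply Rmult_le_compat_l; [lra|]; unfold z, Rabs; repeat destruct Rcase_abs; lra).
      assert (eps / 2 * (Rabs (a - s0) + Rabs (x - t0)) <= eps / 2 * z)
        by (apply Rmult_le_compat_l; [lra|]; unfold z, Rabs; repeat destruct Rcase_abs; lra).
      apply Rabs_le_between in h1. apply Rabs_le_between in h2. apply Rabs_le_between.
      lra. }
  rewrite RInt_Rminus in E1 by (apply HP; lra).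
  rewrite (RInt_Rminus (fun t => Q b t) (fun t => Q a t)) in E2 by (apply HQ; lra).
  unfold rect_integral.
  apply Rabs_le_between in E1. apply Rabs_le_between in E2. apply Rabs_le_between.
  replace (eps * z ^ 2) with (eps * z * (b - a) + eps * z * (d - c)) by (unfold z; ring).
  lra.
Qed.

Lemma nested_intervals (a b : nat -> R) :
  (forall k, a k <= a (S k)) -> (forall k, b (S k) <= b k) -> (forall k, a k <= b k) ->
  exists x, forall k, a k <= x <= b k.
Proof.
  intros Ha Hb Hab.
  assert (Ha' : forall k l, (k <= l)%nat -> a k <= a l)
    by (intros k l h; induction h; [lra | specialize (Ha m); lra]).
  assert (Hb' : forall k l, (k <= l)%nat -> b l <= b k)
    by (intros k l h; induction h; [lra | specialize (Hb m); lra]).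
  assert (Hu : forall k l, a k <= b l).
  { intros k l. specialize (Ha' k (k + l)%nat ltac:(lia)). specialize (Hb' l (k + l)%nat ltac:(lia)).
    specialize (Hab (k + l)%nat). lra. }
  destruct (completeness (fun x => exists k, x = a k)) as [x [h1 h2]].
  - exists (b O). intros y [k ->]. apply Hu.
  - exists (a O). now exists O.
  - exists x. intros k. split.
    + apply h1. now exists k.
    + apply h2. intros y [l ->]. apply Hu.
Qed.

Record rect : Type := Rect { xl : R; xr : R; yl : R; yr : R }.

Definition quarters (r q : rect) : Prop :=
  let e := (xl r + xr r) / 2 in let f := (yl r + yr r) / 2 in
  (xl q = xl r /\ xr q = e \/ xl q = e /\ xr q = xr r) /\
  (yl q = yl r /\ yr q = f \/ yl q = f /\ yr q = yr r).

(** A property that always passes to some quarter survives on arbitrarily small rectangles around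
    one point, the limit of a nested sequence of quarters. *)
Lemma bisection (Bad : rect -> Prop) (r : rect) :
  xl r <= xr r -> yl r <= yr r -> Bad r ->
  (forall r', xl r' <= xr r' -> yl r' <= yr r' -> xl r <= xl r' -> xr r' <= xr r ->
     yl r <= yl r' -> yr r' <= yr r -> Bad r' -> exists q, quarters r' q /\ Bad q) ->
  exists s t, (xl r <= s <= xr r) /\ (yl r <= t <= yr r) /\
    forall eta, eta > 0 -> exists q, Bad q /\
      xl q <= s <= xr q /\ yl q <= t <= yr q /\ xr q - xl q < eta /\ yr q - yl q < eta /\
      xl r <= xl q /\ xr q <= xr r /\ yl r <= yl q /\ yr q <= yr r.
Proof.
  intros hx hy HB Hstep.
  pose (ok := fun q => xl q <= xr q /\ yl q <= yr q /\ xl r <= xl q /\ xr q <= xr r /\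
     yl r <= yl q /\ yr q <= yr r /\ Bad q).
  (* The premise [ok q] sits inside the existential, so that choice yields a total function [next]
     that can be iterated. *)
  assert (Hs : forall q, exists q', ok q -> quarters q q' /\ ok q').
  { intros q. destruct (classic (ok q)) as [h|h]; [|exists q; tauto].
    destruct h as (h1 & h2 & h3 & h4 & h5 & h6 & h7).
    destruct (Hstep q h1 h2 h3 h4 h5 h6 h7) as [q' [Hq Hb]]. exists q'. intros _. split; trivial.
    destruct Hq as [Hq1 Hq2]. unfold ok. repeat split; trivial; destruct Hq1, Hq2; lra. }
  pose (next := fun q => proj1_sig (constructive_indefinite_description _ (Hs q))).
  assert (Hnext : forall q, ok q -> quarters q (next q) /\ ok (next q)).
  { intros q. unfold next. destruct constructive_indefinite_description as [q' h]. exact h. }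
  pose (seq := fun k => Nat.iter k next r).
  assert (Hok : forall k, ok (seq k)).
  { induction k; [|now apply Hnext]. unfold ok, seq; simpl; repeat split; trivial; lra. }
  assert (Hq : forall k, quarters (seq k) (seq (S k))) by (intros k; apply (Hnext (seq k)), Hok).
  destruct (nested_intervals (fun k => xl (seq k)) (fun k => xr (seq k))) as [s hs].
  { intros k. destruct (Hq k) as [[?|?] _]; destruct (Hok k) as (? & _); lra. }
  { intros k. destruct (Hq k) as [[?|?] _]; destruct (Hok k) as (? & _); lra. }
  { intros k. apply Hok. }
  destruct (nested_intervals (fun k => yl (seq k)) (fun k => yr (seq k))) as [t ht].
  { intros k. destruct (Hq k) as [_ [?|?]]; destruct (Hok k) as (? & ? & _); lra. }
  { intros k. destruct (Hq k) as [_ [?|?]]; destruct (Hok k) as (? & ? & _); lra. }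
  { intros k. apply Hok. }
  assert (Hlen : forall k, xr (seq k) - xl (seq k) = (xr r - xl r) * (/ 2) ^ k /\
                           yr (seq k) - yl (seq k) = (yr r - yl r) * (/ 2) ^ k).
  { induction k; [simpl; lra|]. destruct (Hq k) as [[?|?] [?|?]]; simpl pow; lra. }
  exists s, t. split; [apply (hs O)|]. split; [apply (ht O)|].
  intros eta he.
  destruct (pow_lt_1_zero (/ 2)) with (y := eta / (xr r - xl r + (yr r - yl r) + 1)) as [k Hk].
  { rewrite Rabs_right; lra. }
  { apply Rdiv_lt_0_compat; lra. }
  specialize (Hk k (le_n k)). exists (seq k).
  destruct (Hok k) as (? & ? & ? & ? & ? & ? & ?). destruct (Hlen k) as [l1 l2].
  assert (hp : 0 < (/ 2) ^ k) by (apply pow_lt; lra).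
  rewrite Rabs_right in Hk by lra.
  apply (Rmult_lt_compat_r (xr r - xl r + (yr r - yl r) + 1)) in Hk; [|lra].
  unfold Rdiv in Hk. rewrite Rmult_assoc, Rinv_l in Hk by lra.
  specialize (hs k). specialize (ht k).
  repeat split; trivial; try lra; nra.
Qed.

Theorem goursat (P Q : R -> R -> R) (a b c d : R) :
  a <= b -> c <= d -> closed_form_on P Q a b c d -> rect_integral P Q a b c d = 0.
Proof.
  intros hab hcd H. apply NNPP. intros hne.
  set (I := fun q => rect_integral P Q (xl q) (xr q) (yl q) (yr q)).
  set (sz := fun q => xr q - xl q + (yr q - yl q)).
  assert (hI : 0 < Rabs (rect_integral P Q a b c d)) by now apply Rabs_pos_lt.
  set (r := Rect a b c d).
  assert (hz : 0 <= sz r) by (unfold sz; simpl; lra).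
  (* The + 1 makes [r] itself bad with a strict inequality, even when its size is 0. *)
  set (e := Rabs (I r) / (sz r ^ 2 + 1)).
  assert (he : 0 < e) by (apply Rdiv_lt_0_compat; [exact hI | nra]).
  destruct (bisection (fun q => Rabs (I q) > e * sz q ^ 2) r) as (s & t & hs & ht & Hst); trivial.
  - assert (Rabs (I r) = e * (sz r ^ 2 + 1)) by (unfold e; field; nra). nra.
  - intros q h1 h2 h3 h4 h5 h6 hb. simpl in h3, h4, h5, h6.
    set (m := (xl q + xr q) / 2). set (f := (yl q + yr q) / 2).
    assert (HS : I q = I (Rect (xl q) m (yl q) f) + I (Rect m (xr q) (yl q) f)
                 + I (Rect (xl q) m f (yr q)) + I (Rect m (xr q) f (yr q))).
    { unfold I; simpl. apply rect_integral_split; try (unfold m, f; lra).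
      intros s t hs ht. apply H; lra. }
    assert (Hz : forall q', quarters q q' -> sz q' = sz q / 2)
      by (intros q' [[?|?] [?|?]]; unfold sz; lra).
    (* Four good quarters would give |I q| <= 4 e (sz q / 2)^2 = e (sz q)^2, so [q] would be
       good. *)
    apply NNPP. intros hn.
    assert (Hall : forall q', quarters q q' -> Rabs (I q') <= e * (sz q / 2) ^ 2).
    { intros q' hq. apply Rnot_gt_le. intros hgt. apply hn. exists q'. split; trivial.
      now rewrite Hz. }
    assert (Q1 := Hall (Rect (xl q) m (yl q) f) ltac:(unfold quarters; simpl; tauto)).
    assert (Q2 := Hall (Rect m (xr q) (yl q) f) ltac:(unfold quarters; simpl; tauto)).
    assert (Q3 := Hall (Rect (xl q) m f (yr q)) ltac:(unfold quarters; simpl; tauto)).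
    assert (Q4 := Hall (Rect m (xr q) f (yr q)) ltac:(unfold quarters; simpl; tauto)).
    revert hb. rewrite HS. apply Rle_not_gt.
    apply Rabs_le_between in Q1. apply Rabs_le_between in Q2. apply Rabs_le_between in Q3.
    apply Rabs_le_between in Q4. apply Rabs_le_between. lra.
  - destruct (rect_integral_local P Q s t e he) as (delta & hd & Hd).
    { now apply H. }
    destruct (Hst delta hd) as (q & hb & h1 & h2 & h3 & h4 & h5 & h6 & h7 & h8).
    revert hb. apply Rle_not_gt. unfold I, sz. simpl in h5, h6, h7, h8. apply Hd; try lra.
    intros s' t' hs' ht'. apply H; lra.
Qed.

(** * First order expansions *)

Lemma Cmod_sqr (a : C) : Cmod a * Cmod a = Re a * Re a + Im a * Im a.
Proof. pose proof (Cmod2_alt a). simpl in H. lra. Qed.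

Lemma im_le_Cmod (c : C) : Rabs (Im c) <= Cmod c.
Proof.
  destruct c as [x y]. eapply Rle_trans; [|apply Rmax_Cmod]. apply Rmax_r.
Qed.

Lemma Cmod_le_Re_Im (c : C) : Cmod c <= Rabs (Re c) + Rabs (Im c).
Proof.
  apply Rsqr_incr_0_var.
  - unfold Rsqr. rewrite Cmod_sqr.
    pose proof (Rabs_pos (Re c)). pose proof (Rabs_pos (Im c)).
    pose proof (Rsqr_abs (Re c)) as e1. pose proof (Rsqr_abs (Im c)) as e2. unfold Rsqr in e1, e2.
    nra.
  - pose proof (Rabs_pos (Re c)). pose proof (Rabs_pos (Im c)). lra.
Qed.

(* First order expansion F h = f0 + L h + o(nu h), as h ranges over D; the increments h live in
   an arbitrary type so that one and several complex variables share the calculus rules. *)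
Definition expands {H : Type} (D : H -> Prop) (nu : H -> R) (F : H -> C) (f0 : C) (L : H -> C) : Prop :=
  (exists K, 0 <= K /\ forall h, D h -> Cmod (L h) <= K * nu h) /\
  forall eps, eps > 0 -> exists delta, delta > 0 /\
    forall h, D h -> nu h < delta -> Cmod (F h - f0 - L h) <= eps * nu h.

Definition cderiv (f : C -> C) (z l : C) : Prop :=
  expands (fun _ => True) Cmod (fun h => f (z + h)%C) (f z) (fun h => (l * h)%C).

Lemma cderiv_intro (f : C -> C) (z l : C) :
  (forall eps, eps > 0 -> exists delta, delta > 0 /\
    forall h, Cmod h < delta -> Cmod (f (z + h) - f z - l * h)%C <= eps * Cmod h) ->
  cderiv f z l.
Proof.
  intros H. split.
  - exists (Cmod l). split; [apply Cmod_ge_0|]. intros h _. rewrite Cmod_mult. lra.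
  - intros eps he. destruct (H eps he) as (d & hd & Hd). exists d. split; trivial. intros; now apply Hd.
Qed.

Section Expands.
Context {H : Type} (D : H -> Prop) (nu : H -> R) (nu_ge0 : forall h, 0 <= nu h).

Lemma expands_lipschitz F f0 L :
  expands D nu F f0 L ->
  exists K delta, 0 < K /\ 0 < delta /\ forall h, D h -> nu h < delta -> Cmod (F h - f0) <= K * nu h.
Proof.
  intros [(K & hK & HK) HE]. destruct (HE 1 Rlt_0_1) as (d & hd & Hd).
  exists (K + 1), d. repeat split; try lra. intros h hD hh.
  replace (F h - f0)%C with ((F h - f0 - L h) + L h)%C by ring.
  eapply Rle_trans. apply Cmod_triangle. specialize (HK h hD). specialize (Hd h hD hh). lra.
Qed.

Lemma expands_small F f0 L eps :
  expands D nu F f0 L -> eps > 0 ->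
  exists delta, delta > 0 /\ forall h, D h -> nu h < delta -> Cmod (F h - f0) < eps.
Proof.
  intros HE he. destruct (expands_lipschitz _ _ _ HE) as (K & d & hK & hd & Hd).
  exists (Rmin d (eps / K)). split.
  - apply Rmin_pos; trivial. now apply Rdiv_lt_0_compat.
  - intros h hD hh.
    pose proof (Rlt_le_trans _ _ _ hh (Rmin_l _ _)) as h1.
    pose proof (Rlt_le_trans _ _ _ hh (Rmin_r _ _)) as h2.
    eapply Rle_lt_trans; [now apply Hd|].
    apply (Rmult_lt_compat_l K) in h2; trivial.
    replace (K * (eps / K)) with eps in h2 by (field; lra). exact h2.
Qed.

Lemma expands_const c : expands D nu (fun _ => c) c (fun _ => RtoC 0).
Proof.
  split.
  - exists 0. split; [lra|]. intros h _. rewrite Cmod_0. lra.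
  - intros eps he. exists 1. split; [lra|]. intros h _ _.
    replace (c - c - 0)%C with (RtoC 0) by ring. rewrite Cmod_0.
    pose proof (nu_ge0 h). nra.
Qed.

Lemma expands_plus F f0 L G g0 M :
  expands D nu F f0 L -> expands D nu G g0 M ->
  expands D nu (fun h => F h + G h)%C (f0 + g0)%C (fun h => L h + M h)%C.
Proof.
  intros [(K & hK & HK) HF] [(K' & hK' & HK') HG]. split.
  - exists (K + K'). split; [lra|]. intros h hD. eapply Rle_trans; [apply Cmod_triangle|].
    specialize (HK h hD). specialize (HK' h hD). lra.
  - intros eps he. destruct (HF (eps / 2)) as (d & hd & Hd); [lra|].
    destruct (HG (eps / 2)) as (d' & hd' & Hd'); [lra|].
    exists (Rmin d d'). split; [now apply Rmin_pos|]. intros h hD hh.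
    pose proof (Rlt_le_trans _ _ _ hh (Rmin_l _ _)) as h1.
    pose proof (Rlt_le_trans _ _ _ hh (Rmin_r _ _)) as h2.
    replace (F h + G h - (f0 + g0) - (L h + M h))%C with ((F h - f0 - L h) + (G h - g0 - M h))%C by ring.
    eapply Rle_trans; [apply Cmod_triangle|].
    specialize (Hd h hD h1). specialize (Hd' h hD h2). lra.
Qed.

Lemma expands_comp (g : C -> C) F f0 L l :
  cderiv g f0 l -> expands D nu F f0 L ->
  expands D nu (fun h => g (F h)) (g f0) (fun h => l * L h)%C.
Proof.
  intros [_ Hg] HF. destruct (expands_lipschitz _ _ _ HF) as (K & d & hK & hd & Hd).
  destruct HF as [(K' & hK' & HK') HF].
  pose proof (Cmod_ge_0 l) as hl.
  split.
  - exists (Cmod l * K'). split; [now apply Rmult_le_pos|]. intros h hD.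
    rewrite Cmod_mult, Rmult_assoc. apply Rmult_le_compat_l; auto.
  - intros eps he. destruct (Hg (eps / (2 * K))) as (d1 & hd1 & Hd1).
    { apply Rdiv_lt_0_compat; lra. }
    destruct (HF (eps / (2 * (Cmod l + 1)))) as (d2 & hd2 & Hd2).
    { apply Rdiv_lt_0_compat; lra. }
    exists (Rmin (Rmin d d2) (d1 / K)). split.
    { repeat apply Rmin_pos; trivial. now apply Rdiv_lt_0_compat. }
    intros h hD hh.
    pose proof (Rlt_le_trans _ _ _ hh (Rmin_l _ _)) as h1.
    pose proof (Rlt_le_trans _ _ _ hh (Rmin_r _ _)) as h2.
    pose proof (Rlt_le_trans _ _ _ h1 (Rmin_r _ _)) as h3.
    pose proof (Rlt_le_trans _ _ _ h1 (Rmin_l _ _)) as h4.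
    specialize (Hd h hD h4). specialize (Hd2 h hD h3).
    assert (hs : Cmod (F h - f0) < d1).
    { eapply Rle_lt_trans; [exact Hd|]. apply (Rmult_lt_compat_l K) in h2; trivial.
      replace (K * (d1 / K)) with d1 in h2 by (field; lra). exact h2. }
    specialize (Hd1 (F h - f0)%C I hs).
    replace (f0 + (F h - f0))%C with (F h) in Hd1 by ring.
    replace (g (F h) - g f0 - l * L h)%C with
      ((g (F h) - g f0 - l * (F h - f0)) + l * (F h - f0 - L h))%C by ring.
    eapply Rle_trans; [apply Cmod_triangle|]. rewrite (Cmod_mult l).
    assert (Cmod (g (F h) - g f0 - l * (F h - f0))%C <= eps / 2 * nu h).
    { eapply Rle_trans; [exact Hd1|]. apply Rle_trans with (eps / (2 * K) * (K * nu h)).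
      - apply Rmult_le_compat_l; trivial. apply Rlt_le, Rdiv_lt_0_compat; lra.
      - apply Req_le. field. lra. }
    assert (Cmod l * Cmod (F h - f0 - L h)%C <= eps / 2 * nu h).
    { apply Rle_trans with ((Cmod l + 1) * (eps / (2 * (Cmod l + 1)) * nu h)).
      - apply Rmult_le_compat; trivial; try lra. apply Cmod_ge_0.
      - apply Req_le. field. lra. }
    lra.
Qed.

Lemma expands_mult F f0 L G g0 M :
  expands D nu F f0 L -> expands D nu G g0 M ->
  expands D nu (fun h => F h * G h)%C (f0 * g0)%C (fun h => f0 * M h + g0 * L h)%C.
Proof.
  intros HF HG.
  destruct (expands_lipschitz _ _ _ HF) as (K1 & d1 & hK1 & hd1 & Hd1).
  destruct (expands_lipschitz _ _ _ HG) as (K2 & d2 & hK2 & hd2 & Hd2).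
  destruct HF as [(K & hK & HK) HF]. destruct HG as [(K' & hK' & HK') HG].
  pose proof (Cmod_ge_0 f0) as hf. pose proof (Cmod_ge_0 g0) as hg.
  split.
  - exists (Cmod f0 * K' + Cmod g0 * K). split; [nra|]. intros h hD.
    eapply Rle_trans; [apply Cmod_triangle|]. rewrite !Cmod_mult.
    specialize (HK h hD). specialize (HK' h hD).
    apply (Rmult_le_compat_l _ _ _ hg) in HK. apply (Rmult_le_compat_l _ _ _ hf) in HK'. lra.
  - intros eps he.
    destruct (HF (eps / (3 * (Cmod g0 + 1)))) as (d3 & hd3 & Hd3).
    { apply Rdiv_lt_0_compat; lra. }
    destruct (HG (eps / (3 * (Cmod f0 + 1)))) as (d4 & hd4 & Hd4).
    { apply Rdiv_lt_0_compat; lra. }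
    set (d5 := eps / (3 * (K1 * K2))).
    assert (hK12 : 0 < K1 * K2) by now apply Rmult_lt_0_compat.
    assert (hd5 : d5 > 0) by (apply Rdiv_lt_0_compat; lra).
    exists (Rmin (Rmin d1 d2) (Rmin (Rmin d3 d4) d5)). split.
    { repeat apply Rmin_pos; trivial. }
    intros h hD hh.
    pose proof (Rlt_le_trans _ _ _ hh (Rmin_l _ _)) as h1.
    pose proof (Rlt_le_trans _ _ _ hh (Rmin_r _ _)) as h2.
    pose proof (Rlt_le_trans _ _ _ h1 (Rmin_l _ _)) as h3.
    pose proof (Rlt_le_trans _ _ _ h1 (Rmin_r _ _)) as h4.
    pose proof (Rlt_le_trans _ _ _ h2 (Rmin_l _ _)) as h5.
    pose proof (Rlt_le_trans _ _ _ h2 (Rmin_r _ _)) as h6.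
    pose proof (Rlt_le_trans _ _ _ h5 (Rmin_l _ _)) as h7.
    pose proof (Rlt_le_trans _ _ _ h5 (Rmin_r _ _)) as h8.
    specialize (Hd1 h hD h3). specialize (Hd2 h hD h4). specialize (Hd3 h hD h7). specialize (Hd4 h hD h8).
    replace (F h * G h - f0 * g0 - (f0 * M h + g0 * L h))%C with
      ((F h - f0) * (G h - g0) + (f0 * (G h - g0 - M h) + g0 * (F h - f0 - L h)))%C by ring.
    eapply Rle_trans; [apply Cmod_triangle|].
    pose proof (Cmod_triangle (f0 * (G h - g0 - M h)) (g0 * (F h - f0 - L h))) as ht.
    rewrite !Cmod_mult in *. pose proof (nu_ge0 h) as hn.
    assert (Cmod (F h - f0) * Cmod (G h - g0) <= eps / 3 * nu h).
    { apply Rle_trans with ((K1 * nu h) * (K2 * nu h)).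
      - apply Rmult_le_compat; trivial; apply Cmod_ge_0.
      - replace (K1 * nu h * (K2 * nu h)) with ((K1 * K2 * nu h) * nu h) by ring.
        apply Rmult_le_compat_r; trivial.
        apply Rlt_le in h6. apply (Rmult_le_compat_l (K1 * K2)) in h6; [|lra].
        replace (K1 * K2 * d5) with (eps / 3) in h6; trivial. unfold d5. field. lra. }
    assert (Cmod f0 * Cmod (G h - g0 - M h) <= eps / 3 * nu h).
    { apply Rle_trans with ((Cmod f0 + 1) * (eps / (3 * (Cmod f0 + 1)) * nu h)).
      - apply Rmult_le_compat; trivial; try lra. apply Cmod_ge_0.
      - apply Req_le. field. lra. }
    assert (Cmod g0 * Cmod (F h - f0 - L h) <= eps / 3 * nu h).
    { apply Rle_trans with ((Cmod g0 + 1) * (eps / (3 * (Cmod g0 + 1)) * nu h)).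
      - apply Rmult_le_compat; trivial; try lra. apply Cmod_ge_0.
      - apply Req_le. field. lra. }
    lra.
Qed.

Lemma expands_ext F G f0 g0 L M :
  expands D nu F f0 L ->
  (exists delta, delta > 0 /\ forall h, D h -> nu h < delta -> G h = F h) -> f0 = g0 ->
  (forall h, D h -> M h = L h) -> expands D nu G g0 M.
Proof.
  intros [(K & hK & HK) HF] (d & hd & Hd) <- HM. split.
  - exists K. split; trivial. intros h hD. rewrite HM; auto.
  - intros eps he. destruct (HF eps he) as (d' & hd' & Hd').
    exists (Rmin d d'). split; [now apply Rmin_pos|]. intros h hD hh.
    pose proof (Rlt_le_trans _ _ _ hh (Rmin_l _ _)) as h1.
    pose proof (Rlt_le_trans _ _ _ hh (Rmin_r _ _)) as h2.
    rewrite HM, Hd by auto. auto.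
Qed.

Lemma expands_sum (n : nat) (F : nat -> H -> C) (f0 : nat -> C) (L : nat -> H -> C) :
  (forall i, (i < n)%nat -> expands D nu (F i) (f0 i) (L i)) ->
  expands D nu (fun h => csum n (fun i => F i h)) (csum n f0) (fun h => csum n (fun i => L i h)).
Proof.
  induction n; intros HF.
  - exact (expands_const (RtoC 0)).
  - apply (expands_plus (fun h => csum n (fun i => F i h)) (csum n f0)
             (fun h => csum n (fun i => L i h)) (F n) (f0 n) (L n)); auto.
Qed.
End Expands.

Lemma cderiv_const (c z : C) : cderiv (fun _ => c) z 0.
Proof.
  eapply expands_ext; [apply expands_const; apply Cmod_ge_0| |reflexivity|].
  - exists 1. split; [lra|]. reflexivity.
  - intros h _. simpl. ring.
Qed.

Lemma cderiv_id (z : C) : cderiv (fun w => w) z 1.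
Proof.
  apply cderiv_intro. intros eps he. exists 1. split; [lra|]. intros h _.
  replace (z + h - z - 1 * h)%C with (RtoC 0) by ring. rewrite Cmod_0.
  pose proof (Cmod_ge_0 h). nra.
Qed.

Lemma cderiv_plus (f g : C -> C) (z l k : C) :
  cderiv f z l -> cderiv g z k -> cderiv (fun w => f w + g w)%C z (l + k).
Proof.
  intros Hf Hg. eapply expands_ext; [exact (expands_plus _ _ _ _ _ _ _ _ Hf Hg)| |reflexivity|].
  - exists 1. split; [lra|]. reflexivity.
  - intros h _. simpl. ring.
Qed.

Lemma cderiv_mult (f g : C -> C) (z l k : C) :
  cderiv f z l -> cderiv g z k -> cderiv (fun w => f w * g w)%C z (f z * k + g z * l).
Proof.
  intros Hf Hg. eapply expands_ext; [exact (expands_mult _ _ Cmod_ge_0 _ _ _ _ _ _ Hf Hg)| |reflexivity|].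
  - exists 1. split; [lra|]. reflexivity.
  - intros h _. simpl. ring.
Qed.

Lemma cderiv_comp (f g : C -> C) (z l k : C) :
  cderiv f z l -> cderiv g (f z) k -> cderiv (fun w => g (f w)) z (k * l).
Proof.
  intros Hf Hg. eapply expands_ext; [exact (expands_comp _ _ _ _ _ _ _ Hg Hf)| |reflexivity|].
  - exists 1. split; [lra|]. reflexivity.
  - intros h _. simpl. ring.
Qed.

Lemma cderiv_inv (z : C) : z <> 0 -> cderiv Cinv z (- (/ z * / z)).
Proof.
  intros hz. pose proof (proj1 (Cmod_gt_0 z) hz) as hm.
  apply cderiv_intro. intros eps he.
  set (m := Cmod z) in *.
  (* The first bound gives |z + h| >= m / 2. The remainder is h^2 / ((z + h) z^2), hence at most |h|
     |h| 2 / m^3, and the second bound turns this into eps |h|. *)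
  exists (Rmin (m / 2) (eps * m ^ 3 / 2)). split.
  { apply Rmin_pos; [lra|]. apply Rdiv_lt_0_compat; [|lra].
    apply Rmult_lt_0_compat; trivial. now apply pow_lt. }
  intros h hh.
  pose proof (Rlt_le_trans _ _ _ hh (Rmin_l _ _)) as h1.
  pose proof (Rlt_le_trans _ _ _ hh (Rmin_r _ _)) as h2.
  assert (hzh : m / 2 <= Cmod (z + h)).
  { pose proof (Cmod_triangle (z + h) (- h)) as ht. rewrite Cmod_opp in ht.
    replace (z + h + - h)%C with z in ht by ring. fold m in ht. lra. }
  assert (hne : (z + h)%C <> 0).
  { intros e. rewrite e, Cmod_0 in hzh. lra. }
  replace (/ (z + h) - / z - - (/ z * / z) * h)%C with (h * h * / (z + h) * (/ z * / z))%C by (field; auto).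
  rewrite !Cmod_mult, !Cmod_inv by trivial. fold m.
  pose proof (Cmod_ge_0 h) as hh0.
  assert (hi : / Cmod (z + h) <= 2 / m).
  { replace (2 / m) with (/ (m / 2)) by (field; lra). apply Rinv_le_contravar; lra. }
  assert (hi0 : 0 < / m * / m) by (apply Rmult_lt_0_compat; now apply Rinv_0_lt_compat).
  apply Rle_trans with (Cmod h * (eps * m ^ 3 / 2) * (2 / m) * (/ m * / m)).
  - apply Rmult_le_compat_r; [lra|]. apply Rmult_le_compat; trivial.
    + nra.
    + apply Rlt_le, Rinv_0_lt_compat. lra.
    + apply Rmult_le_compat_l; lra.
  - apply Req_le. field. lra.
Qed.

Lemma cderiv_ext (f g : C -> C) (z l k : C) :
  cderiv f z l -> (exists delta, delta > 0 /\ forall h, Cmod h < delta -> g (z + h)%C = f (z + h)%C) ->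
  k = l -> cderiv g z k.
Proof.
  intros Hf (d & hd & Hd) ->. eapply expands_ext; [exact Hf| | |].
  - exists d. split; trivial. intros h _ hh. now apply Hd.
  - replace z with (z + 0)%C by ring. symmetry. apply Hd. now rewrite Cmod_0.
  - reflexivity.
Qed.

Lemma cderiv_pow (f : C -> C) (z l : C) (n : nat) :
  cderiv f z l -> exists k, cderiv (fun w => f w ^ n)%C z k.
Proof.
  intros Hf. induction n as [|n [k IH]].
  - exists (RtoC 0). exact (cderiv_const (RtoC 1) z).
  - exists (f z * k + f z ^ n * l)%C. exact (cderiv_mult _ _ _ _ _ Hf IH).
Qed.

(** * The mean value property *)

Definition cexp (w : C) : C := (exp (Re w) * cos (Im w), exp (Re w) * sin (Im w)).

Lemma cexp_plus (w h : C) : cexp (w + h) = (cexp w * cexp h)%C.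
Proof.
  destruct w as [a b], h as [c d]. unfold cexp, Re, Im; simpl. rewrite exp_plus, cos_plus, sin_plus.
  apply injective_projections; simpl; ring.
Qed.

Lemma Cmod_cexp (w : C) : Cmod (cexp w) = exp (Re w).
Proof.
  unfold Cmod, cexp; simpl.
  replace (_ + _) with ((exp (Re w))²).
  - apply sqrt_Rsqr. apply Rlt_le, exp_pos.
  - pose proof (sin2_cos2 (Im w)) as e. unfold Rsqr in *. nra.
Qed.

Lemma Rabs_sin_le (x : R) : Rabs (sin x) <= Rabs x.
Proof.
  destruct (MVT_gen sin 0 x cos) as (c & _ & hc).
  - intros. apply is_derive_sin.
  - intros. apply continuity_sin.
  - rewrite sin_0, !Rminus_0_r in hc. rewrite hc, Rabs_mult.
    pose proof (COS_bound c). assert (Rabs (cos c) <= 1) by (apply Rabs_le; lra).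
    pose proof (Rabs_pos x). nra.
Qed.

Lemma cos_quad (x : R) : Rabs (cos x - 1) <= x * x / 2.
Proof.
  replace x with (2 * (x / 2)) at 1 by field. rewrite cos_2a_sin.
  replace (1 - 2 * sin (x / 2) * sin (x / 2) - 1) with (- (2 * (sin (x / 2) * sin (x / 2)))) by ring.
  rewrite Rabs_Ropp, Rabs_right by nra.
  pose proof (Rabs_sin_le (x / 2)) as h. apply Rsqr_le_abs_1 in h. unfold Rsqr in h. nra.
Qed.

Lemma sin_quad (x : R) : Rabs x <= 1 -> Rabs (sin x - x) <= x * x / 2.
Proof.
  intros hx.
  destruct (MVT_gen sin 0 x cos) as (c & hc1 & hc).
  - intros. apply is_derive_sin.
  - intros. apply continuity_sin.
  - rewrite sin_0, !Rminus_0_r in hc. rewrite hc.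
    replace (cos c * x - x) with ((cos c - 1) * x) by ring.
    rewrite Rabs_mult. pose proof (cos_quad c) as h.
    assert (c * c <= x * x).
    { unfold Rmin, Rmax in hc1. destruct Rle_dec; nra. }
    pose proof (Rabs_pos (cos c - 1)). pose proof (Rabs_pos x). nra.
Qed.

Lemma exp_quad (a : R) : Rabs a <= 1 / 2 -> 0 <= exp a - 1 - a <= 2 * (a * a).
Proof.
  intros ha. apply Rabs_le_between in ha.
  assert (G : forall x, 1 + x <= exp x).
  { intros x. destruct (Req_dec x 0) as [->|hx]; [rewrite exp_0; lra|]. now apply Rlt_le, exp_ineq1. }
  split; [specialize (G a); lra|].
  pose proof (G (- a)) as h1. pose proof (exp_pos a) as h2.
  assert (h3 : exp a * exp (- a) = 1) by (rewrite <- exp_plus, Rplus_opp_r; apply exp_0).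
  nra.
Qed.

Lemma cexp_quad (h : C) : Cmod h <= 1 / 2 -> Cmod (cexp h - 1 - h) <= 8 * (Cmod h * Cmod h).
Proof.
  intros hh. eapply Rle_trans; [apply Cmod_le_Re_Im|]. rewrite Cmod_sqr.
  pose proof (re_le_Cmod h) as ha. pose proof (im_le_Cmod h) as hb.
  destruct h as [a b]. unfold cexp; simpl in *.
  destruct (exp_quad a) as [e1 e2]; [lra|].
  pose proof (cos_quad b) as hc. assert (hs : Rabs (sin b - b) <= b * b / 2) by (apply sin_quad; lra).
  replace (exp a * cos b + - (1) + - a) with (exp a * (cos b - 1) + (exp a - 1 - a)) by ring.
  replace (exp a * sin b + -0 + - b) with (exp a * (sin b - b) + (exp a - 1) * b) by ring.
  assert (ha' : Rabs a <= 1 / 2) by lra. assert (hb' : Rabs b <= 1 / 2) by lra.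
  apply Rabs_le_between in ha'. apply Rabs_le_between in hb'.
  assert (ha2 : a * a <= 1 / 4) by nra.
  assert (he : 0 < exp a <= 2) by (pose proof (exp_pos a); lra).
  assert (Rabs (exp a * (cos b - 1) + (exp a - 1 - a)) <= 2 * (a * a) + 2 * (b * b)).
  { assert (Rabs (exp a * (cos b - 1)) <= 2 * (b * b / 2)).
    { rewrite Rabs_mult. apply Rmult_le_compat; try apply Rabs_pos; trivial.
      rewrite Rabs_right; lra. }
    eapply Rle_trans; [apply Rabs_triang|]. rewrite (Rabs_right (exp a - 1 - a)); nra. }
  assert (hm : Rabs ((exp a - 1) * b) <= 2 * (a * a) + 2 * (b * b)).
  { rewrite Rabs_mult. assert (Rabs (exp a - 1) <= 2 * Rabs a).
    { unfold Rabs; repeat destruct Rcase_abs; nra. }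
    pose proof (Rabs_pos a). pose proof (Rabs_pos b).
    pose proof (Rsqr_abs a) as q1. pose proof (Rsqr_abs b) as q2. unfold Rsqr in q1, q2.
    apply Rle_trans with (2 * Rabs a * Rabs b); [apply Rmult_le_compat_r; lra|].
    pose proof (Rle_0_sqr (Rabs a - Rabs b)) as q3. unfold Rsqr in q3. nra. }
  assert (Rabs (exp a * (sin b - b)) <= b * b).
  { replace (b * b) with (2 * (b * b / 2)) by field.
    rewrite Rabs_mult. apply Rmult_le_compat; try apply Rabs_pos; trivial.
    rewrite Rabs_right; lra. }
  pose proof (Rabs_triang (exp a * (sin b - b)) ((exp a - 1) * b)). nra.
Qed.

Lemma cderiv_cexp (w : C) : cderiv cexp w (cexp w).
Proof.
  apply cderiv_intro. intros eps he.
  pose proof (Cmod_ge_0 (cexp w)) as hm. set (m := Cmod (cexp w)) in *.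
  exists (Rmin (1 / 2) (eps / (8 * (m + 1)))). split.
  { apply Rmin_pos; [lra|]. apply Rdiv_lt_0_compat; lra. }
  intros h hh.
  pose proof (Rlt_le_trans _ _ _ hh (Rmin_l _ _)) as h1.
  pose proof (Rlt_le_trans _ _ _ hh (Rmin_r _ _)) as h2.
  rewrite cexp_plus.
  replace (cexp w * cexp h - cexp w - cexp w * h)%C with (cexp w * (cexp h - 1 - h))%C by ring.
  rewrite Cmod_mult. fold m.
  pose proof (cexp_quad h ltac:(lra)) as hq. pose proof (Cmod_ge_0 h) as h0.
  pose proof (Cmod_ge_0 (cexp h - 1 - h)) as h0'.
  apply Rle_trans with ((m + 1) * (8 * (eps / (8 * (m + 1)) * Cmod h))).
  - apply Rmult_le_compat; try lra. eapply Rle_trans; [exact hq|].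
    apply Rmult_le_compat_l; [lra|]. apply Rmult_le_compat_r; lra.
  - apply Req_le. field. lra.
Qed.

(** The form is Im (g dz) with dz = ds + i dt. By the Cauchy-Riemann equations both cross
    derivatives are Re l. *)
Lemma cderiv_closed_form (g : C -> C) (s0 t0 : R) (l : C) :
  cderiv g (s0, t0) l ->
  closed_form_at (fun s t => Im (g (s, t))) (fun s t => Re (g (s, t))) s0 t0.
Proof.
  intros [_ Hg]. exists (Im l), (Re l), (- Im l). intros eps he.
  destruct (Hg eps he) as (d & hd & Hd). exists (d / 2). split; [lra|].
  intros s t hs ht.
  pose (k := (s - s0, t - t0) : C).
  assert (hb : Cmod k <= Rabs (s - s0) + Rabs (t - t0)) by apply (Cmod_le_Re_Im k).
  specialize (Hd k I ltac:(lra)).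
  replace ((s0, t0) + k)%C with ((s, t) : C) in Hd
    by (apply injective_projections; simpl; ring).
  set (e := (g (s, t) - g (s0, t0) - l * k)%C) in *.
  assert (he' : Cmod e <= eps * (Rabs (s - s0) + Rabs (t - t0))).
  { eapply Rle_trans; [exact Hd|]. apply Rmult_le_compat_l; lra. }
  split.
  - replace (_ - _ - _ - _) with (Im e); [eapply Rle_trans; [apply im_le_Cmod|trivial]|].
    unfold e, k, Im, Re; simpl. ring.
  - replace (_ - _ - _ - _) with (Re e); [eapply Rle_trans; [apply re_le_Cmod|trivial]|].
    unfold e, k, Im, Re; simpl. ring.
Qed.

Definition circle (t : R) : C := (cos t, sin t).

Lemma Cmod_circle (t : R) : Cmod (circle t) = 1.
Proof.
  replace (circle t) with (cexp (0, t)); [rewrite Cmod_cexp; apply exp_0|].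
  unfold cexp, circle; simpl. now rewrite exp_0, !Rmult_1_l.
Qed.

(* Goursat's theorem for f o exp on the rectangles [s,0] x [0,2 pi], s -> -oo. *)
Theorem mean_value (f : C -> C) :
  (forall z : C, z <> 0 -> Cmod z <= 1 -> exists l, cderiv f z l) ->
  (forall eps, eps > 0 -> exists delta, delta > 0 /\
     forall z, Cmod z < delta -> Cmod (f z - f 0) < eps) ->
  ex_RInt (fun t => Re (f (circle t))) 0 (2 * PI) /\
  RInt (fun t => Re (f (circle t))) 0 (2 * PI) = Re (f 0) * (2 * PI).
Proof.
  intros Hf H0.
  pose proof PI_RGT_0 as hpi.
  set (g := fun w => f (cexp w)).
  assert (Hcf : forall s, s <= 0 -> closed_form_on (fun s t => Im (g (s, t))) (fun s t => Re (g (s, t))) s 0 0 (2 * PI)).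
  { intros s hs s' t' hs' ht'.
    destruct (Hf (cexp (s', t'))) as [l hl].
    - intros e. pose proof (Cmod_cexp (s', t')) as e'. rewrite e, Cmod_0 in e'. simpl in e'.
      pose proof (exp_pos s'). lra.
    - rewrite Cmod_cexp; simpl. rewrite <- exp_0. destruct (Rle_lt_or_eq_dec s' 0) as [h|h]; [lra| |].
      + now apply Rlt_le, exp_increasing.
      + subst; lra.
    - apply (cderiv_closed_form g s' t' (l * cexp (s', t'))%C). unfold g.
      apply cderiv_comp; trivial. apply cderiv_cexp. }
  assert (Hc : forall t, g (0, t) = f (circle t)).
  { intros t. unfold g, cexp, circle; simpl. now rewrite exp_0, !Rmult_1_l. }
  assert (Hex : forall s, s <= 0 -> ex_RInt (fun t => Re (g (s, t))) 0 (2 * PI)).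
  { intros s hs. destruct (closed_form_ex_RInt _ _ _ _ _ _ (Hcf s hs)) as [_ HQ]. apply HQ; lra. }
  assert (Heq : forall s, s <= 0 -> RInt (fun t => Re (f (circle t))) 0 (2 * PI) = RInt (fun t => Re (g (s, t))) 0 (2 * PI)).
  { intros s hs. pose proof (goursat _ _ _ _ _ _ hs (ltac:(lra) : 0 <= 2 * PI) (Hcf s hs)) as hg.
    unfold rect_integral in hg.
    (* By periodicity of exp the two horizontal sides cancel. The vertical sides are the integrals
       of Re f over the circles of radius 1 and exp s. *)
    rewrite (RInt_ext (fun s => Im (g (s, 2 * PI))) (fun s => Im (g (s, 0)))) in hg.
    - rewrite (RInt_ext (fun t => Re (g (0, t))) (fun t => Re (f (circle t)))) in hg; [lra|].
      intros; now rewrite Hc.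
    - intros x _. unfold g, cexp; simpl. now rewrite cos_2PI, sin_2PI, cos_0, sin_0. }
  split.
  - apply (ex_RInt_ext (fun t => Re (g (0, t)))); [intros; now rewrite Hc|]. apply Hex; lra.
  - apply Rminus_diag_uniq. apply cond_eq. intros eps he. rewrite Rminus_0_r.
    destruct (H0 (eps / (4 * PI))) as (d & hd & Hd).
    { apply Rdiv_lt_0_compat; lra. }
    (* Far enough to the left for the circle of radius exp s to lie where f is within eps / (4 PI)
       of f 0. *)
    pose (s := Rmin 0 (ln (d / 2))).
    assert (hs : s <= 0) by apply Rmin_l.
    assert (hes : exp s < d).
    { apply Rle_lt_trans with (exp (ln (d / 2))).
      - destruct (Rle_lt_or_eq_dec s (ln (d / 2))) as [h|h]; [apply Rmin_r| |].
        + now apply Rlt_le, exp_increasing.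
        + rewrite h; lra.
      - rewrite exp_ln; lra. }
    rewrite (Heq s hs).
    replace (Re (f 0) * (2 * PI)) with (Re (f 0) * (2 * PI - 0)) by ring.
    eapply Rle_lt_trans.
    + apply RInt_near_const with (M := eps / (4 * PI)); [lra|now apply Hex|].
      intros t ht. rewrite Rminus_def.
      change (Re (g (s, t)) + - Re (f 0)) with (Re (g (s, t) - f 0)).
      eapply Rle_trans; [apply re_le_Cmod|]. apply Rlt_le, Hd. rewrite Cmod_cexp. exact hes.
    + replace (eps / (4 * PI) * (2 * PI - 0)) with (eps / 2) by (field; lra). lra.
Qed.

(** * Schwarz's lemma *)

(* The mean value property of f precomposed with the Moebius map z |-> (r z + w) / (1 + conj w z / r),
   which sends the unit circle to the circle of radius r and 0 to w. *)
Lemma max_principle (f : C -> C) (r M : R) (w : C) :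
  0 < r -> (forall z, Cmod z <= r -> exists l, cderiv f z l) ->
  (forall z, Cmod z = r -> Cmod (f z) <= M) -> Cmod w < r -> Cmod (f w) <= M.
Proof.
  intros hr Hf HM hw. pose proof PI_RGT_0 as hpi.
  assert (hM : 0 <= M).
  { apply Rle_trans with (Cmod (f (RtoC r))); [apply Cmod_ge_0|]. apply HM.
    rewrite Cmod_R. apply Rabs_right. lra. }
  assert (hr' : RtoC r <> 0) by (intros e; apply RtoC_inj in e; lra).
  set (den := fun z => (1 + Cconj w * / r * z)%C).
  set (mu := fun z => ((r * z + w) * / den z)%C).
  assert (Hden : forall z, Cmod z <= 1 -> den z <> 0).
  { intros z hz e. assert (h : Cmod (Cconj w * / r * z) = 1).
    { replace (Cconj w * / r * z)%C with (den z - 1)%C by (unfold den; ring).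
      rewrite e. replace (0 - 1)%C with (- (1))%C by ring. now rewrite Cmod_opp, Cmod_1. }
    rewrite !Cmod_mult, Cmod_conj, Cmod_inv, Cmod_R, (Rabs_right r) in h by (trivial; lra).
    assert (hq : Cmod w * / r < 1).
    { apply Rmult_lt_reg_r with r; trivial. rewrite Rmult_assoc, Rinv_l; lra. }
    assert (0 <= Cmod w * / r).
    { apply Rmult_le_pos; [apply Cmod_ge_0|]. apply Rlt_le, Rinv_0_lt_compat; lra. }
    pose proof (Cmod_ge_0 z). nra. }
  (* This identity shows that [mu] maps the closed unit disc into the closed disc of radius r, and
     the unit circle to its boundary. *)
  assert (Hnum : forall z, Cmod (r * z + w) * Cmod (r * z + w)
     = r * r * (Cmod (den z) * Cmod (den z)) - (r * r - Cmod w * Cmod w) * (1 - Cmod z * Cmod z)).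
  { intros z. rewrite !Cmod_sqr. destruct z as [x y], w as [a b].
    unfold den, Cconj, Re, Im; simpl. field. lra. }
  assert (Hmu : forall z, Cmod z <= 1 -> Cmod (mu z) <= r /\ (Cmod z = 1 -> Cmod (mu z) = r)).
  { intros z hz. unfold mu. rewrite Cmod_mult, Cmod_inv by auto.
    pose proof (proj1 (Cmod_gt_0 _) (Hden z hz)) as hd. specialize (Hnum z).
    pose proof (Cmod_ge_0 (r * z + w)). pose proof (Cmod_ge_0 w). pose proof (Cmod_ge_0 z).
    split.
    - apply Rmult_le_reg_r with (Cmod (den z)); trivial.
      rewrite Rmult_assoc, Rinv_l, Rmult_1_r by lra.
      apply Rsqr_incr_0_var; [|nra]. unfold Rsqr.
      assert (0 <= (r * r - Cmod w * Cmod w) * (1 - Cmod z * Cmod z)) by (apply Rmult_le_pos; nra).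
      lra.
    - intros e. rewrite e in Hnum.
      replace (Cmod (r * z + w)) with (r * Cmod (den z)); [field; lra|].
      apply Rsqr_inj; [nra|trivial|]. unfold Rsqr. lra. }
  assert (H0 : mu 0 = w).
  { unfold mu, den. field. trivial. }
  (* The factor conj (f w) rotates the value at 0 to the real number |f w|^2, so the mean value of
     the real part is enough: |f w|^2 <= |f w| M. *)
  set (g := fun z => (Cconj (f w) * f (mu z))%C).
  assert (Hg : forall z, Cmod z <= 1 -> exists l, cderiv g z l).
  { intros z hz. destruct (Hf (mu z)) as [l hl]; [now apply Hmu|].
    eexists. unfold g. apply cderiv_mult; [apply cderiv_const|].
    apply cderiv_comp; [|exact hl]. unfold mu.
    apply cderiv_mult.
    - apply cderiv_plus; [|apply cderiv_const]. apply cderiv_mult; [apply cderiv_const|apply cderiv_id].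
    - apply (cderiv_comp den Cinv); [|apply cderiv_inv; now apply Hden].
      unfold den. apply cderiv_plus; [apply cderiv_const|].
      apply cderiv_mult; [apply cderiv_const|apply cderiv_id]. }
  destruct (mean_value g) as [hex heq].
  { intros z _ hz. now apply Hg. }
  { intros eps he. destruct (Hg 0) as [l hl]; [rewrite Cmod_0; lra|].
    destruct (expands_small _ _ _ _ _ _ hl he) as (d & hd & Hd). exists d. split; trivial.
    intros z hz. specialize (Hd z I hz). now replace (0 + z)%C with z in Hd by ring. }
  assert (hle : RInt (fun t => Re (g (circle t))) 0 (2 * PI) <= Cmod (f w) * M * (2 * PI - 0)).
  { rewrite <- RInt_const_R. apply RInt_le; [lra|trivial|apply ex_RInt_const|].
    intros t _. eapply Rle_trans; [apply Rle_abs|]. eapply Rle_trans; [apply re_le_Cmod|].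
    unfold g. rewrite Cmod_mult, Cmod_conj. apply Rmult_le_compat_l; [apply Cmod_ge_0|].
    apply HM, Hmu; rewrite Cmod_circle; lra. }
  rewrite heq in hle. unfold g in hle. rewrite H0 in hle.
  replace (Re (Cconj (f w) * f w)) with (Cmod (f w) * Cmod (f w)) in hle
    by (rewrite Cmod_sqr; unfold Cconj, Re, Im; simpl; ring).
  pose proof (Cmod_ge_0 (f w)). apply Rnot_lt_le. intros hlt.
  assert (0 < Cmod (f w) * (Cmod (f w) - M) * PI).
  { apply Rmult_lt_0_compat; [apply Rmult_lt_0_compat|]; lra. }
  lra.
Qed.

(** The value of g at 0 is multiplied by 0, so only its limit matters. This makes z (f z / z)^N
    differentiable at 0 without removing the singularity of f z / z. *)
Lemma cderiv_mult_id_at_0 (g : C -> C) (L : C) :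
  (forall eps, eps > 0 -> exists delta, delta > 0 /\
     forall h : C, h <> 0 -> Cmod h < delta -> Cmod (g h - L) < eps) ->
  cderiv (fun z => z * g z)%C 0 L.
Proof.
  intros H. apply cderiv_intro. intros eps he. destruct (H eps he) as (d & hd & Hd).
  exists d. split; trivial. intros h hh.
  destruct (Ceq_dec h 0) as [->|hne].
  - replace ((0 + 0) * g (0 + 0) - 0 * g 0 - L * 0)%C with (RtoC 0) by (rewrite !Cplus_0_l; ring).
    rewrite Cmod_0. lra.
  - replace ((0 + h) * g (0 + h) - 0 * g 0 - L * h)%C with (h * (g h - L))%C
      by (rewrite !Cplus_0_l; ring).
    rewrite Cmod_mult, Rmult_comm. apply Rmult_le_compat_r; [apply Cmod_ge_0|].
    now apply Rlt_le, Hd.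
Qed.

Lemma cderiv_quotient_limit (f : C -> C) (l : C) :
  cderiv f 0 l -> f 0 = 0 ->
  forall eps, eps > 0 -> exists delta, delta > 0 /\
     forall h : C, h <> 0 -> Cmod h < delta -> Cmod (f h * / h - l) < eps.
Proof.
  intros [_ Hf] h0 eps he. destruct (Hf (eps / 2)) as (d & hd & Hd); [lra|].
  exists d. split; trivial. intros h hne hh. specialize (Hd h I hh).
  rewrite h0, Cplus_0_l in Hd.
  pose proof (proj1 (Cmod_gt_0 h) hne) as hp.
  apply Rmult_lt_reg_r with (Cmod h); trivial. rewrite <- Cmod_mult.
  replace ((f h * / h - l) * h)%C with (f h - 0 - l * h)%C by (field; trivial).
  nra.
Qed.

(* The maximum principle applied to z (f z / z) ^ N, for N large. *)
Theorem schwarz (f : C -> C) :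
  (forall z, Cmod z < 1 -> exists l, cderiv f z l) -> f 0 = 0 ->
  (forall z, Cmod z < 1 -> Cmod (f z) <= 1) ->
  forall w, Cmod w < 1 -> Cmod (f w) <= Cmod w.
Proof.
  intros Hf h0 Hb w hw.
  destruct (Ceq_dec w 0) as [->|hne]; [rewrite h0, Cmod_0; lra|].
  pose proof (proj1 (Cmod_gt_0 w) hne) as hp.
  apply Rnot_lt_le. intros hlt.
  assert (hfw : Cmod (f w) <= 1) by now apply Hb.
  set (q := Cmod (f w) * / Cmod w).
  assert (hq : q * Cmod w = Cmod (f w)) by (unfold q; field; lra).
  assert (hq1 : 1 < q) by (apply Rmult_lt_reg_r with (Cmod w); lra).
  (* The midpoint of 1/q and 1: then |w| <= 1/q < r < 1 and r q > 1, which makes the powers of r q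
     unbounded. *)
  set (r := (1 + / q) / 2).
  assert (hiq : q * / q = 1) by (field; lra).
  assert (hiq0 : 0 < / q) by (apply Rinv_0_lt_compat; lra).
  assert (hiq1 : / q < 1) by (rewrite <- Rinv_1; apply Rinv_lt_contravar; lra).
  assert (hwq : Cmod w <= / q) by (apply Rmult_le_reg_l with q; lra).
  assert (hr1 : r < 1) by (unfold r; lra).
  assert (hwr : Cmod w < r) by (unfold r; lra).
  assert (hrq : r * q = 1 + (q - 1) / 2) by (unfold r; field; lra).
  assert (Hder : forall N, forall z, Cmod z <= r -> exists l, cderiv (fun z => z * (f z * / z) ^ N)%C z l).
  { intros N z hz. destruct (Hf z) as [l hl]; [lra|]. destruct (Ceq_dec z 0) as [->|hz0].
    - exists (l ^ N)%C. apply cderiv_mult_id_at_0. intros eps he.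
      destruct (cderiv_pow (fun z => z) l 1 N (cderiv_id l)) as [k hk].
      destruct (expands_small _ _ _ _ _ _ hk he) as (d & hd & Hd).
      destruct (cderiv_quotient_limit f l hl h0 d hd) as (d' & hd' & Hd').
      exists d'. split; trivial. intros h hn hh. specialize (Hd (f h * / h - l)%C I (Hd' h hn hh)).
      now replace (l + (f h * / h - l))%C with (f h * / h)%C in Hd by ring.
    - destruct (cderiv_pow (fun z => f z * / z)%C z _ N (cderiv_mult _ _ _ _ _ hl (cderiv_inv z hz0))) as [k hk].
      eexists. apply cderiv_mult; [apply cderiv_id|exact hk]. }
  (* On |z| = r the function z (f z / z)^N is at most r (1/r)^N, and at w its modulus is |w| q^N.
     Bernoulli's inequality then contradicts the resulting bound, which is uniform in N. *)
  assert (Hpow : forall N, (r * q) ^ N <= r / Cmod w).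
  { intros N. assert (h : Cmod (w * (f w * / w) ^ N) <= r * (/ r) ^ N).
    { apply (max_principle (fun z => z * (f z * / z) ^ N)%C r); [lra|apply Hder| |trivial].
      intros z hz. assert (hz0 : z <> 0) by (apply Cmod_gt_0; lra).
      rewrite Cmod_mult, Cmod_pow, Cmod_mult, Cmod_inv, hz by trivial.
      apply Rmult_le_compat_l; [lra|]. apply pow_incr. split.
      - apply Rmult_le_pos; [apply Cmod_ge_0|]. apply Rlt_le, Rinv_0_lt_compat; lra.
      - rewrite <- (Rmult_1_l (/ r)) at 2. apply Rmult_le_compat_r.
        + apply Rlt_le, Rinv_0_lt_compat; lra.
        + apply Hb. lra. }
    rewrite Cmod_mult, Cmod_pow, Cmod_mult, Cmod_inv in h by trivial. fold q in h.
    assert (hrn : 0 < r ^ N) by (apply pow_lt; lra).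
    rewrite Rpow_mult_distr.
    apply Rmult_le_reg_r with (Cmod w); trivial.
    replace (r / Cmod w * Cmod w) with r by (field; lra).
    apply (Rmult_le_compat_l (r ^ N)) in h; [|lra].
    replace (r ^ N * (r * (/ r) ^ N)) with r in h.
    - lra.
    - rewrite pow_inv by lra. field. lra. }
  destruct (INR_unbounded ((r / Cmod w) / ((q - 1) / 2))) as [N hN].
  specialize (Hpow N). rewrite hrq in Hpow.
  assert (hx : 0 < (q - 1) / 2) by lra.
  pose proof (poly N _ hx) as hB.
  apply (Rmult_lt_compat_r ((q - 1) / 2)) in hN; [|lra].
  replace (r / Cmod w / ((q - 1) / 2) * ((q - 1) / 2)) with (r / Cmod w) in hN by (field; lra).
  lra.
Qed.

Lemma schwarz_deriv (f : C -> C) (l : C) :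
  (forall z, Cmod z < 1 -> exists l, cderiv f z l) -> f 0 = 0 ->
  (forall z, Cmod z < 1 -> Cmod (f z) <= 1) -> cderiv f 0 l -> Cmod l <= 1.
Proof.
  intros Hf h0 Hb hl. apply le_epsilon. intros eps he.
  destruct (cderiv_quotient_limit f l hl h0 eps he) as (d & hd & Hd).
  pose (h := RtoC (Rmin (d / 2) (1 / 2))).
  assert (hm : Cmod h = Rmin (d / 2) (1 / 2)).
  { unfold h. rewrite Cmod_R. apply Rabs_right. apply Rle_ge, Rlt_le, Rmin_pos; lra. }
  pose proof (Rmin_l (d / 2) (1 / 2)). pose proof (Rmin_r (d / 2) (1 / 2)).
  assert (hp : 0 < Cmod h) by (rewrite hm; apply Rmin_pos; lra).
  assert (hne : h <> 0) by now apply Cmod_gt_0.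
  specialize (Hd h hne ltac:(lra)).
  pose proof (schwarz f Hf h0 Hb h ltac:(lra)) as hs.
  pose proof (Cmod_triangle (f h * / h) (- (f h * / h - l))) as ht.
  replace (f h * / h + - (f h * / h - l))%C with l in ht by ring.
  rewrite Cmod_opp, Cmod_mult, Cmod_inv in ht by trivial.
  assert (Cmod (f h) * / Cmod h <= 1).
  { apply Rmult_le_reg_r with (Cmod h); trivial. rewrite Rmult_assoc, Rinv_l; lra. }
  lra.
Qed.

(** The circle is the image of the imaginary axis under exp, and a coefficient of the closed form
    attached to f o exp is continuous along it. *)
Lemma circle_continuous (f : C -> C) (t : R) (l : C) :
  cderiv f (circle t) l -> continuous (fun t => Re (f (circle t))) t.
Proof.
  assert (hc : forall t, cexp (0, t) = circle t).
  { intros s. unfold cexp, circle; simpl. now rewrite exp_0, !Rmult_1_l. }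
  intros hl. apply continuous_ext with (f := fun t => Re (f (cexp (0, t)))).
  { intros s. now rewrite hc. }
  apply (closed_form_continuous (fun s t => Im (f (cexp (s, t)))) (fun s t => Re (f (cexp (s, t)))) 0 t).
  apply (cderiv_closed_form (fun w => f (cexp w)) 0 t (l * cexp (0, t))%C).
  apply cderiv_comp; [apply cderiv_cexp|]. now rewrite hc.
Qed.

Lemma RInt_nonneg_eq_0 (f : R -> R) (a x b : R) :
  a < x < b -> (forall t, a <= t <= b -> continuous f t) -> (forall t, a <= t <= b -> 0 <= f t) ->
  RInt f a b = 0 -> f x = 0.
Proof.
  intros hx Hc Hp H0. apply NNPP. intros hne.
  assert (hfx : 0 < f x) by (specialize (Hp x ltac:(lra)); lra).
  assert (Hex : forall u v, a <= u -> u <= v -> v <= b -> ex_RInt f u v).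
  { intros u v h1 h2 h3. apply (ex_RInt_continuous (V := R_CompleteNormedModule)).
    intros z; rewrite Rmin_left, Rmax_right by lra; intros hz. apply Hc; lra. }
  pose proof (Hc x ltac:(lra)) as hcx. apply continuity_pt_filterlim in hcx.
  destruct (hcx (f x) hfx) as (d & hd & Hd). simpl in Hd. unfold R_dist in Hd.
  pose (e := Rmin (d / 2) (Rmin ((x - a) / 2) ((b - x) / 2))).
  assert (he : 0 < e) by (unfold e; repeat apply Rmin_pos; lra).
  assert (he1 : e <= d / 2) by apply Rmin_l.
  assert (he2 : e <= (x - a) / 2) by (eapply Rle_trans; [apply Rmin_r|apply Rmin_l]).
  assert (he3 : e <= (b - x) / 2) by (eapply Rle_trans; [apply Rmin_r|apply Rmin_r]).
  assert (h1 : 0 < RInt f (x - e) (x + e)).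
  { apply RInt_gt_0; [lra| |].
    - intros t ht. destruct (Req_dec t x) as [->|hn]; trivial.
      assert (Rabs (f t - f x) < f x).
      { apply Hd. split; [split; [exact I|auto]|]. apply Rabs_lt_between; lra. }
      apply Rabs_lt_between in H. lra.
    - intros t ht. apply Hc; lra. }
  assert (h2 : 0 <= RInt f a (x - e)).
  { apply RInt_ge_0; [lra|apply Hex; lra|]. intros; apply Hp; lra. }
  assert (h3 : 0 <= RInt f (x + e) b).
  { apply RInt_ge_0; [lra|apply Hex; lra|]. intros; apply Hp; lra. }
  pose proof (RInt_Chasles (V := R_CompleteNormedModule) f a (x - e) (x + e) ltac:(apply Hex; lra) ltac:(apply Hex; lra)) as e1.
  pose proof (RInt_Chasles (V := R_CompleteNormedModule) f a (x + e) b ltac:(apply Hex; lra) ltac:(apply Hex; lra)) as e2.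
  unfold plus in e1, e2; simpl in e1, e2. lra.
Qed.

(** The quotient f z / z, completed by 1 at 0, has modulus at most 1, and its mean over the circle
    through w is 1. Hence 1 - Re of it is a nonnegative continuous function with integral 0, and it
    vanishes at w. A number of modulus at most 1 and real part 1 is 1. *)
Theorem schwarz_equality (f : C -> C) :
  (forall z, Cmod z < 1 -> exists l, cderiv f z l) -> f 0 = 0 ->
  (forall z, Cmod z < 1 -> Cmod (f z) <= 1) -> cderiv f 0 1 ->
  forall w, Cmod w < 1 -> f w = w.
Proof.
  intros Hf h0 Hb h1 w hw.
  destruct (Ceq_dec w 0) as [->|hne]; [exact h0|].
  pose proof (proj1 (Cmod_gt_0 w) hne) as hp. pose proof PI_RGT_0 as hpi.
  set (g := fun z => if Ceq_dec z 0 then RtoC 1 else (f z * / z)%C).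
  assert (Hg : forall z, Cmod z < 1 -> Cmod (g z) <= 1).
  { intros z hz. unfold g. destruct (Ceq_dec z 0) as [e|e]; [rewrite Cmod_1; lra|].
    rewrite Cmod_mult, Cmod_inv by trivial. pose proof (proj1 (Cmod_gt_0 z) e) as hz0.
    apply Rmult_le_reg_r with (Cmod z); trivial. rewrite Rmult_assoc, Rinv_l, Rmult_1_l, Rmult_1_r by lra.
    now apply schwarz. }
  assert (Hd : forall z : C, z <> 0 -> Cmod z < 1 -> exists l, cderiv g z l).
  { intros z hz hz1. destruct (Hf z hz1) as [l hl].
    eexists. eapply cderiv_ext; [exact (cderiv_mult _ _ _ _ _ hl (cderiv_inv z hz))| |reflexivity].
    pose proof (proj1 (Cmod_gt_0 z) hz) as hz0. exists (Cmod z). split; [lra|].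
    intros h hh. unfold g. destruct (Ceq_dec (z + h) 0) as [e|e]; trivial. exfalso.
    assert (h = - z)%C by (replace h with (z + h - z)%C by ring; rewrite e; ring). subst h.
    rewrite Cmod_opp in hh. lra. }
  (* The sign places w at the angle PI, an interior point of [0, 2 PI], as [RInt_nonneg_eq_0]
     requires. *)
  set (k := fun z => (g (- w * z))%C).
  assert (hkz : forall z, Cmod z <= 1 -> Cmod (- w * z)%C < 1).
  { intros z hz. rewrite Cmod_mult, Cmod_opp. pose proof (Cmod_ge_0 z). nra. }
  assert (Hk : forall z : C, z <> 0 -> Cmod z <= 1 -> exists l, cderiv k z l).
  { intros z hz hz1. destruct (Hd (- w * z)%C) as [l hl].
    - apply Cmult_neq_0; trivial. intros e. apply hne. replace w with (- (- w))%C by ring. rewrite e. ring.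
    - now apply hkz.
    - eexists. unfold k. apply cderiv_comp; [|exact hl].
      apply cderiv_mult; [apply cderiv_const|apply cderiv_id]. }
  assert (hcirc : forall t, circle t <> 0).
  { intros t. apply Cmod_gt_0. rewrite Cmod_circle. lra. }
  destruct (mean_value k Hk) as [hex heq].
  { intros eps he. destruct (cderiv_quotient_limit f 1 h1 h0 eps he) as (d & hd & Hdd).
    exists d. split; trivial. intros z hz. unfold k.
    replace (- w * 0)%C with (RtoC 0) by ring. unfold g at 2.
    destruct (Ceq_dec 0 0) as [_|e]; [|congruence].
    unfold g. destruct (Ceq_dec (- w * z) 0) as [e|e].
    - replace (1 - 1)%C with (RtoC 0) by ring. rewrite Cmod_0. lra.
    - apply Hdd; trivial. rewrite Cmod_mult, Cmod_opp. pose proof (Cmod_ge_0 z). nra. }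
  assert (hk1 : Re (k (circle PI)) = 1).
  { enough (1 - Re (k (circle PI)) = 0) by lra.
    apply (RInt_nonneg_eq_0 (fun t => 1 - Re (k (circle t))) 0 PI (2 * PI)); [lra| | |].
    - intros t _. apply (continuous_minus (V := R_NormedModule)); [apply continuous_const|].
      destruct (Hk (circle t) (hcirc t)) as [l hl]; [rewrite Cmod_circle; lra|].
      now apply circle_continuous with l.
    - intros t _. enough (Re (k (circle t)) <= 1) by lra.
      eapply Rle_trans; [apply Rle_abs|]. eapply Rle_trans; [apply re_le_Cmod|].
      apply Hg, hkz. rewrite Cmod_circle; lra.
    - rewrite (RInt_Rminus (fun _ => 1)); [|apply ex_RInt_const|exact hex].
      rewrite RInt_const_R, heq. unfold k. replace (- w * 0)%C with (RtoC 0) by ring.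
      unfold g. destruct (Ceq_dec 0 0) as [_|e]; [|congruence]. simpl. ring. }
  assert (hkw : k (circle PI) = (f w * / w)%C).
  { unfold k. replace (- w * circle PI)%C with w.
    - unfold g. now destruct (Ceq_dec w 0).
    - unfold circle. rewrite cos_PI, sin_PI. apply injective_projections; simpl; ring. }
  assert (hg1 : Cmod (f w * / w) <= 1).
  { rewrite <- hkw. apply Hg, hkz. rewrite Cmod_circle; lra. }
  rewrite hkw in hk1.
  assert (e1 : (f w * / w)%C = 1).
  { pose proof (Cmod_sqr (f w * / w)) as e. rewrite hk1 in e.
    pose proof (Cmod_ge_0 (f w * / w)).
    apply injective_projections; [exact hk1|]. simpl.
    change (Im (f w * / w)%C = 0). nra. }
  replace (f w) with (f w * / w * w)%C by (field; trivial). rewrite e1. ring.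
Qed.

(** * Sums, norms and derivatives in several variables *)

(* [Defs.C] and Coquelicot's [C] are convertible, but [ring] only knows the latter. *)
Ltac cring := match goal with |- @eq _ ?a ?b => change (@eq C a b) end; ring.

Lemma csum_S (n : nat) (f : nat -> C) : (csum (S n) f : C) = (csum n f + f n)%C.
Proof. reflexivity. Qed.

Lemma csum_ext (n : nat) (f g : nat -> C) :
  (forall i, (i < n)%nat -> f i = g i) -> csum n f = csum n g.
Proof.
  induction n; intros H; [reflexivity|]. simpl. rewrite IHn, H; auto.
Qed.

Lemma csum_zero (n : nat) (f : nat -> C) :
  (forall i, (i < n)%nat -> f i = 0) -> (csum n f : C) = 0.
Proof.
  induction n; intros H; [reflexivity|]. rewrite csum_S, IHn, H by auto. ring.
Qed.

Lemma csum_plus (n : nat) (f g : nat -> C) :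
  (csum n (fun i => f i + g i)%C : C) = (csum n f + csum n g)%C.
Proof.
  induction n; [simpl; apply injective_projections; simpl; ring|]. rewrite !csum_S, IHn. ring.
Qed.

Lemma csum_scal (n : nat) (k : C) (f : nat -> C) :
  (csum n (fun i => k * f i)%C : C) = (k * csum n f)%C.
Proof.
  induction n; [simpl; apply injective_projections; simpl; ring|]. rewrite !csum_S, IHn. ring.
Qed.

Lemma csum_swap (n m : nat) (f : nat -> nat -> C) :
  (csum n (fun i => csum m (fun j => f i j)) : C) = csum m (fun j => csum n (fun i => f i j)).
Proof.
  induction n.
  - symmetry. apply csum_zero. reflexivity.
  - rewrite csum_S, IHn, <- csum_plus. apply csum_ext. reflexivity.
Qed.

Lemma csum_single (n k : nat) (f : nat -> C) :
  (k < n)%nat -> (forall i, (i < n)%nat -> i <> k -> f i = 0) -> (csum n f : C) = f k.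
Proof.
  induction n; intros hk H; [lia|]. rewrite csum_S.
  destruct (Nat.eq_dec k n) as [->|hne].
  - rewrite csum_zero; [ring|]. intros i hi. apply H; lia.
  - rewrite IHn, (H n); try lia; [ring|]. intros i hi. apply H. lia.
Qed.

Lemma csum_add (n k : nat) (f : nat -> C) :
  (csum (n + k) f : C) = (csum n f + csum k (fun i => f (n + i)%nat))%C.
Proof.
  induction k.
  - rewrite Nat.add_0_r. apply injective_projections; simpl; ring.
  - rewrite Nat.add_succ_r, !csum_S, IHk. ring.
Qed.

Lemma csum_S_l (n : nat) (f : nat -> C) : (csum (S n) f : C) = (f O + csum n (fun i => f (S i)))%C.
Proof.
  rewrite (csum_add 1 n). f_equal. apply injective_projections; simpl; ring.
Qed.

Lemma csum_mul (n d : nat) (f : nat -> C) :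
  (csum (n * d) f : C) = csum d (fun j => csum n (fun i => f (n * j + i)%nat)).
Proof.
  induction d; [now rewrite Nat.mul_0_r|].
  rewrite Nat.mul_succ_r, csum_add, csum_S, IHd. reflexivity.
Qed.

Lemma csum_conj (n : nat) (f : nat -> C) : (csum n (fun i => Cconj (f i)) : C) = Cconj (csum n f).
Proof.
  induction n; [apply injective_projections; simpl; ring|].
  rewrite !csum_S, IHn. apply injective_projections; simpl; ring.
Qed.

Lemma Re_csum (n : nat) (f : nat -> C) : Re (csum n f) = rsum n (fun i => Re (f i)).
Proof. induction n; [reflexivity|]. simpl rsum. now rewrite <- IHn. Qed.

Lemma csum_RtoC (n : nat) (f : nat -> R) : (csum n (fun i => RtoC (f i)) : C) = RtoC (rsum n f).
Proof.
  induction n; [reflexivity|]. rewrite csum_S, IHn. simpl. now rewrite RtoC_plus.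
Qed.

Lemma rsum_ext (n : nat) (f g : nat -> R) :
  (forall i, (i < n)%nat -> f i = g i) -> rsum n f = rsum n g.
Proof. induction n; intros H; [reflexivity|]. simpl. rewrite IHn, H; auto. Qed.

Lemma rsum_le (n : nat) (f g : nat -> R) :
  (forall i, (i < n)%nat -> f i <= g i) -> rsum n f <= rsum n g.
Proof.
  induction n; intros H; simpl; [lra|]. pose proof (H n (Nat.lt_succ_diag_r n)).
  assert (rsum n f <= rsum n g) by auto. lra.
Qed.

Lemma rsum_nonneg (n : nat) (f : nat -> R) : (forall i, (i < n)%nat -> 0 <= f i) -> 0 <= rsum n f.
Proof.
  induction n; intros H; simpl; [lra|]. pose proof (H n (Nat.lt_succ_diag_r n)).
  assert (0 <= rsum n f) by auto. lra.
Qed.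

Lemma rsum_plus (n : nat) (f g : nat -> R) : rsum n (fun i => f i + g i) = rsum n f + rsum n g.
Proof. induction n; simpl; [ring|]. rewrite IHn. ring. Qed.

Lemma rsum_scal (n : nat) (k : R) (f : nat -> R) : rsum n (fun i => k * f i) = k * rsum n f.
Proof. induction n; simpl; [ring|]. rewrite IHn. ring. Qed.

Lemma rsum_minus (n : nat) (f g : nat -> R) : rsum n (fun i => f i - g i) = rsum n f - rsum n g.
Proof. induction n; simpl; [ring|]. rewrite IHn. ring. Qed.

Lemma rsum_const (n : nat) (k : R) : rsum n (fun _ => k) = INR n * k.
Proof. induction n; [simpl; ring|]. rewrite S_INR. simpl rsum. rewrite IHn. ring. Qed.

Lemma rsum_add (n k : nat) (f : nat -> R) :
  rsum (n + k) f = rsum n f + rsum k (fun i => f (n + i)%nat).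
Proof.
  induction k; [rewrite Nat.add_0_r; simpl; ring|].
  rewrite Nat.add_succ_r. simpl. rewrite IHk. ring.
Qed.

Lemma rsum_S_l (n : nat) (f : nat -> R) : rsum (S n) f = f O + rsum n (fun i => f (S i)).
Proof. rewrite (rsum_add 1 n). simpl. ring. Qed.

Lemma rsum_mul (n d : nat) (f : nat -> R) :
  rsum (n * d) f = rsum d (fun j => rsum n (fun i => f (n * j + i)%nat)).
Proof.
  induction d; [now rewrite Nat.mul_0_r|].
  rewrite Nat.mul_succ_r, rsum_add, IHd. reflexivity.
Qed.

Lemma rsum_term_le (n : nat) (f : nat -> R) (i : nat) :
  (forall i, (i < n)%nat -> 0 <= f i) -> (i < n)%nat -> f i <= rsum n f.
Proof.
  induction n; intros H hi; [lia|]. simpl. pose proof (H n ltac:(lia)).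
  destruct (Nat.eq_dec i n) as [->|hne].
  - assert (0 <= rsum n f) by (apply rsum_nonneg; intros; apply H; lia). lra.
  - assert (f i <= rsum n f) by (apply IHn; [|lia]; intros; apply H; lia). lra.
Qed.

Lemma rsum_single (n k : nat) (f : nat -> R) :
  (k < n)%nat -> (forall i, (i < n)%nat -> i <> k -> f i = 0) -> rsum n f = f k.
Proof.
  induction n; intros hk H; [lia|]. simpl.
  destruct (Nat.eq_dec k n) as [->|hne].
  - rewrite (rsum_ext n f (fun _ => 0)), rsum_const; [ring|]. intros i hi. apply H; lia.
  - rewrite IHn, (H n); try lia; [ring|]. intros i hi. apply H. lia.
Qed.

Lemma Cnorm2_Cmod (a : C) : Cnorm2 a = Cmod a * Cmod a.
Proof. rewrite Cmod_sqr. reflexivity. Qed.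

Lemma Cnorm2_mult (a b : C) : Cnorm2 (a * b)%C = Cnorm2 a * Cnorm2 b.
Proof. rewrite !Cnorm2_Cmod, Cmod_mult. ring. Qed.

Lemma Cnorm2_ge0 (a : C) : 0 <= Cnorm2 a.
Proof. rewrite Cnorm2_Cmod. pose proof (Cmod_ge_0 a). nra. Qed.

Lemma Cnorm2_eq0 (a : C) : Cnorm2 a = 0 -> a = 0.
Proof.
  rewrite Cnorm2_Cmod. intros h. apply Cmod_eq_0. pose proof (Cmod_ge_0 a). nra.
Qed.

Lemma Cnorm2_conj (a : C) : (a * Cconj a)%C = RtoC (Cnorm2 a).
Proof. apply injective_projections; unfold Cnorm2; simpl; ring. Qed.

Lemma vnorm2_ge0 (n : nat) (z : Vec) : 0 <= vnorm2 n z.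
Proof. apply rsum_nonneg. intros. apply Cnorm2_ge0. Qed.

Lemma vnorm2_eq0 (n : nat) (z : Vec) : vnorm2 n z <= 0 -> forall i, (i < n)%nat -> z i = RtoC 0.
Proof.
  intros h i hi. apply Cnorm2_eq0.
  pose proof (rsum_term_le n (fun i => Cnorm2 (z i)) i (fun i _ => Cnorm2_ge0 (z i)) hi) as h'.
  pose proof (Cnorm2_ge0 (z i)). unfold vnorm2 in h. lra.
Qed.

Lemma vnorm2_vsub_eq (n : nat) (z w : Vec) :
  vnorm2 n (vsub z w) <= 0 -> forall i, (i < n)%nat -> z i = w i.
Proof.
  intros h i hi. pose proof (vnorm2_eq0 n _ h i hi) as e.
  apply (f_equal (fun a => (fst a, snd a))) in e. injection e as e1 e2.
  apply injective_projections; lra.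
Qed.

Lemma vnorm_ge0 (n : nat) (z : Vec) : 0 <= vnorm n z.
Proof. apply sqrt_pos. Qed.

Lemma vnorm_sqr (n : nat) (z : Vec) : vnorm n z * vnorm n z = vnorm2 n z.
Proof. apply sqrt_sqrt, vnorm2_ge0. Qed.

Lemma Cmod_le_vnorm (n : nat) (z : Vec) (i : nat) : (i < n)%nat -> Cmod (z i) <= vnorm n z.
Proof.
  intros hi. apply Rsqr_incr_0_var; [|apply vnorm_ge0]. unfold Rsqr.
  rewrite vnorm_sqr, <- Cnorm2_Cmod.
  apply (rsum_term_le n (fun i => Cnorm2 (z i))); trivial. intros; apply Cnorm2_ge0.
Qed.

Lemma vnorm_le_sum (n : nat) (z : Vec) : vnorm n z <= rsum n (fun i => Cmod (z i)).
Proof.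
  assert (H : forall k, 0 <= rsum k (fun i => Cmod (z i)))
    by (intros; apply rsum_nonneg; intros; apply Cmod_ge_0).
  apply Rsqr_incr_0_var; trivial. unfold Rsqr. rewrite vnorm_sqr. unfold vnorm2.
  induction n; simpl; [lra|]. rewrite Cnorm2_Cmod. pose proof (H n). pose proof (Cmod_ge_0 (z n)). nra.
Qed.

Lemma Cmod_csum_le (n : nat) (f : nat -> C) : Cmod (csum n f) <= rsum n (fun i => Cmod (f i)).
Proof.
  induction n; [unfold csum; change C0 with (RtoC 0); rewrite Cmod_0; unfold vnorm2; simpl; lra|]. rewrite csum_S.
  eapply Rle_trans; [apply Cmod_triangle|]. simpl. lra.
Qed.

Lemma cauchy_schwarz (n : nat) (a b : nat -> C) :
  Cmod (csum n (fun i => a i * b i)%C) <= vnorm n a * vnorm n b.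
Proof.
  apply Rsqr_incr_0_var; [|apply Rmult_le_pos; apply vnorm_ge0].
  unfold Rsqr. replace (vnorm n a * vnorm n b * (vnorm n a * vnorm n b)) with
    ((vnorm n a * vnorm n a) * (vnorm n b * vnorm n b)) by ring.
  rewrite !vnorm_sqr. induction n; [unfold csum; change C0 with (RtoC 0); rewrite Cmod_0; unfold vnorm2; simpl; lra|].
  rewrite csum_S. set (s := (csum n (fun i => a i * b i)%C : C)) in *.
  unfold vnorm2 in *. simpl. fold (vnorm2 n a) (vnorm2 n b) in *. rewrite !Cnorm2_Cmod.
  pose proof (Cmod_triangle s (a n * b n)) as ht. rewrite Cmod_mult in ht.
  pose proof (Cmod_ge_0 s). pose proof (Cmod_ge_0 (a n)). pose proof (Cmod_ge_0 (b n)).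
  pose proof (vnorm2_ge0 n a). pose proof (vnorm2_ge0 n b).
  set (A := vnorm2 n a) in *. set (B := vnorm2 n b) in *. set (x := Cmod (a n)) in *. set (y := Cmod (b n)) in *.
  assert (h1 : Cmod (s + a n * b n) * Cmod (s + a n * b n) <= (Cmod s + x * y) * (Cmod s + x * y)).
  { apply Rmult_le_compat; trivial; apply Cmod_ge_0. }
  assert (h2 : 2 * (Cmod s * (x * y)) <= A * (y * y) + B * (x * x)).
  { apply Rsqr_incr_0_var; [|nra]. unfold Rsqr.
    assert (Cmod s * Cmod s * ((x * y) * (x * y)) <= A * B * ((x * y) * (x * y))).
    { apply Rmult_le_compat_r; [nra|trivial]. }
    pose proof (Rle_0_sqr (A * (y * y) - B * (x * x))) as h. unfold Rsqr in h. nra. }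
  nra.
Qed.

(** * Complex differentials of scalar functions of several variables *)

Definition sderiv (n : nat) (f : Vec -> C) (z : Vec) (a : nat -> C) : Prop :=
  expands (supported n) (vnorm n) (fun h => f (vadd z h)) (f z) (fun h => csum n (fun i => a i * h i)%C).

Lemma sderiv_intro (n : nat) (f : Vec -> C) (z : Vec) (a : nat -> C) :
  (forall eps, eps > 0 -> exists delta, delta > 0 /\
    forall h, supported n h -> vnorm n h < delta ->
      Cmod (f (vadd z h) - f z - csum n (fun i => a i * h i)%C)%C <= eps * vnorm n h) ->
  sderiv n f z a.
Proof.
  intros H. split; trivial. exists (vnorm n a). split; [apply vnorm_ge0|]. intros h _.
  apply cauchy_schwarz.
Qed.

Lemma expands_sderiv (n : nat) (f : Vec -> C) (z : Vec) (L : Vec -> C) (a : nat -> C) :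
  expands (supported n) (vnorm n) (fun h => f (vadd z h)) (f z) L ->
  (forall h, supported n h -> L h = csum n (fun i => a i * h i)%C) -> sderiv n f z a.
Proof.
  intros H HL. eapply expands_ext; [exact H| |reflexivity|].
  - exists 1. split; [lra|reflexivity].
  - intros h hh. symmetry. auto.
Qed.

Lemma holomorphic_sderiv (n m : nat) (U : Vec -> Prop) (F : Vec -> Vec) (z : Vec) :
  holomorphic n m U F -> U z ->
  exists A, forall j, (j < m)%nat -> sderiv n (fun w => F w j) z (A j).
Proof.
  intros HF hz. destruct (HF z hz) as [A HA]. exists A. intros j hj. apply sderiv_intro.
  intros eps he. destruct (HA eps he) as (d & hd & Hd). exists d. split; trivial.
  intros h hs hh. eapply Rle_trans; [|exact (Hd h hs hh)].
  exact (Cmod_le_vnorm m (vsub (vsub (F (vadd z h)) (F z)) _) j hj).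
Qed.

Lemma rsum_small {H : Type} (D : H -> Prop) (nu : H -> R) (m : nat) (r : nat -> H -> R) :
  (forall j, (j < m)%nat -> forall eps, eps > 0 -> exists delta, delta > 0 /\
     forall h, D h -> nu h < delta -> r j h <= eps * nu h) ->
  (forall h, 0 <= nu h) ->
  forall eps, eps > 0 -> exists delta, delta > 0 /\
     forall h, D h -> nu h < delta -> rsum m (fun j => r j h) <= eps * nu h.
Proof.
  intros Hr hnu. induction m; intros eps he.
  - exists 1. split; [lra|]. intros h _ _. simpl. pose proof (hnu h). nra.
  - destruct (IHm (fun j hj => Hr j (Nat.lt_lt_succ_r _ _ hj)) (eps / 2)) as (d & hd & Hd); [lra|].
    destruct (Hr m (Nat.lt_succ_diag_r m) (eps / 2)) as (d' & hd' & Hd'); [lra|].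
    exists (Rmin d d'). split; [now apply Rmin_pos|]. intros h hD hh.
    pose proof (Rlt_le_trans _ _ _ hh (Rmin_l _ _)) as h1.
    pose proof (Rlt_le_trans _ _ _ hh (Rmin_r _ _)) as h2.
    specialize (Hd h hD h1). specialize (Hd' h hD h2). simpl. lra.
Qed.

Lemma sderiv_holomorphic (n m : nat) (U : Vec -> Prop) (F : Vec -> Vec) :
  (forall z, U z -> forall j, (j < m)%nat -> exists a, sderiv n (fun w => F w j) z a) ->
  holomorphic n m U F.
Proof.
  intros H z hz.
  assert (H' : forall j, exists a, (j < m)%nat -> sderiv n (fun w => F w j) z a).
  { intros j. destruct (Compare_dec.lt_dec j m) as [hj|hj].
    - destruct (H z hz j hj) as [a ha]. now exists a.
    - exists (fun _ => RtoC 0). contradiction. }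
  pose (A := fun j => proj1_sig (constructive_indefinite_description _ (H' j))).
  assert (HA : forall j, (j < m)%nat -> sderiv n (fun w => F w j) z (A j)).
  { intros j. unfold A. destruct constructive_indefinite_description as [a ha]. exact ha. }
  exists A.
  pose proof (rsum_small (supported n) (vnorm n) m
    (fun j h => Cmod (F (vadd z h) j - F z j - csum n (fun i => A j i * h i)%C)%C)) as Hs.
  intros eps he. destruct (Hs (fun j hj => proj2 (HA j hj)) (vnorm_ge0 n) eps he) as (d & hd & Hd).
  exists d. split; trivial. intros h hs hh. eapply Rle_trans; [apply vnorm_le_sum|].
  exact (Hd h hs hh).
Qed.

Lemma vadd_vsub (z w : Vec) : vadd z (vsub w z) = w.
Proof.
  apply functional_extensionality. intros i.
  apply injective_projections; unfold vadd, vsub, Cadd, Csub; simpl; ring.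
Qed.

Lemma supported_vsub (n : nat) (z w : Vec) : supported n z -> supported n w -> supported n (vsub z w).
Proof.
  intros hz hw i hi. unfold vsub. rewrite hz, hw by trivial.
  apply injective_projections; unfold Csub, C0; simpl; ring.
Qed.

Lemma supported_vadd (n : nat) (z w : Vec) : supported n z -> supported n w -> supported n (vadd z w).
Proof.
  intros hz hw i hi. unfold vadd. rewrite hz, hw by trivial.
  apply injective_projections; unfold Cadd, C0; simpl; ring.
Qed.

Section Chain.
Context {H : Type} (D : H -> Prop) (nu : H -> R) (nu_ge0 : forall h, 0 <= nu h).

Lemma expands_vector_lipschitz (m : nat) (F : H -> Vec) (F0 : Vec) (L : nat -> H -> C) :
  (forall j, (j < m)%nat -> expands D nu (fun h => F h j) (F0 j) (L j)) ->
  exists K delta, 0 < K /\ 0 < delta /\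
    forall h, D h -> nu h < delta -> vnorm m (vsub (F h) F0) <= K * nu h.
Proof.
  intros HF.
  enough (E : exists K delta, 0 < K /\ 0 < delta /\
    forall h, D h -> nu h < delta -> rsum m (fun j => Cmod (F h j - F0 j)%C) <= K * nu h).
  { destruct E as (K & d & hK & hd & Hd). exists K, d. repeat split; trivial.
    intros h hD hh. eapply Rle_trans; [apply vnorm_le_sum|]. exact (Hd h hD hh). }
  induction m.
  - exists 1, 1. repeat split; try lra. intros h _ _. simpl. pose proof (nu_ge0 h). lra.
  - destruct IHm as (K & d & hK & hd & Hd); [auto|].
    destruct (expands_lipschitz _ _ _ _ _ (HF m (Nat.lt_succ_diag_r m))) as (K' & d' & hK' & hd' & Hd').
    exists (K + K'), (Rmin d d'). repeat split; [lra|now apply Rmin_pos|]. intros h hD hh.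
    pose proof (Rlt_le_trans _ _ _ hh (Rmin_l _ _)) as h1.
    pose proof (Rlt_le_trans _ _ _ hh (Rmin_r _ _)) as h2.
    specialize (Hd h hD h1). specialize (Hd' h hD h2). simpl. lra.
Qed.

Lemma expands_scal (k : C) F f0 L :
  expands D nu F f0 L -> expands D nu (fun h => k * F h)%C (k * f0)%C (fun h => k * L h)%C.
Proof.
  intros HF. eapply expands_ext; [exact (expands_mult D nu nu_ge0 _ _ _ _ _ _ (expands_const D nu nu_ge0 k) HF)| | |].
  - exists 1. split; [lra|reflexivity].
  - reflexivity.
  - intros h _. simpl. ring.
Qed.

(** The increments range over an arbitrary type, so that the same rule covers composition with a map
    of several variables and restriction to a complex line. The support conditions are there because
    a differential is only tested on increments with m coordinates. *)
Lemma expands_chain (m : nat) (g : Vec -> C) (b : nat -> C) (F : H -> Vec) (F0 : Vec) (L : nat -> H -> C) :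
  sderiv m g F0 b ->
  (forall j, (j < m)%nat -> expands D nu (fun h => F h j) (F0 j) (L j)) ->
  supported m F0 ->
  (exists delta, delta > 0 /\ forall h, D h -> nu h < delta -> supported m (F h)) ->
  expands D nu (fun h => g (F h)) (g F0) (fun h => csum m (fun j => b j * L j h)%C).
Proof.
  intros [_ Hg] HF hs0 (d0 & hd0 & Hs).
  destruct (expands_vector_lipschitz m F F0 L HF) as (K & d1 & hK & hd1 & Hd1).
  assert (HL : expands D nu (fun h => csum m (fun j => b j * F h j)%C) (csum m (fun j => b j * F0 j)%C)
    (fun h => csum m (fun j => b j * L j h)%C)).
  { apply (expands_sum D nu nu_ge0 m (fun j h => b j * F h j)%C (fun j => b j * F0 j)%C (fun j h => b j * L j h)%C).
    intros j hj. now apply expands_scal, HF. }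
  destruct HL as [HB HL]. split; trivial.
  intros eps he.
  destruct (Hg (eps / (2 * K))) as (d2 & hd2 & Hd2).
  { apply Rdiv_lt_0_compat; lra. }
  destruct (HL (eps / 2)) as (d3 & hd3 & Hd3); [lra|].
  exists (Rmin (Rmin d0 d1) (Rmin d3 (d2 / K))). split.
  { repeat apply Rmin_pos; trivial. now apply Rdiv_lt_0_compat. }
  intros h hD hh.
  pose proof (Rlt_le_trans _ _ _ hh (Rmin_l _ _)) as h1.
  pose proof (Rlt_le_trans _ _ _ hh (Rmin_r _ _)) as h2.
  pose proof (Rlt_le_trans _ _ _ h1 (Rmin_l _ _)) as h3.
  pose proof (Rlt_le_trans _ _ _ h1 (Rmin_r _ _)) as h4.
  pose proof (Rlt_le_trans _ _ _ h2 (Rmin_l _ _)) as h5.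
  pose proof (Rlt_le_trans _ _ _ h2 (Rmin_r _ _)) as h6.
  specialize (Hd1 h hD h4). specialize (Hd3 h hD h5).
  assert (hsmall : vnorm m (vsub (F h) F0) < d2).
  { eapply Rle_lt_trans; [exact Hd1|]. apply (Rmult_lt_compat_l K) in h6; trivial.
    replace (K * (d2 / K)) with d2 in h6 by (field; lra). exact h6. }
  specialize (Hd2 (vsub (F h) F0) (supported_vsub m _ _ (Hs h hD h3) hs0) hsmall).
  rewrite vadd_vsub in Hd2.
  set (SF := (csum m (fun j => b j * F h j)%C : C)) in *.
  set (SF0 := (csum m (fun j => b j * F0 j)%C : C)) in *.
  set (SL := (csum m (fun j => b j * L j h)%C : C)) in *.
  assert (E : (csum m (fun i => b i * vsub (F h) F0 i)%C : C) = (SF - SF0)%C).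
  { unfold SF, SF0. rewrite (csum_ext m _ (fun i => b i * F h i + (-1) * (b i * F0 i))%C).
    - rewrite csum_plus, csum_scal. ring.
    - intros i _. unfold vsub. change Csub with Cminus. ring. }
  rewrite E in Hd2.
  replace (g (F h) - g F0 - SL)%C with ((g (F h) - g F0 - (SF - SF0)) + (SF - SF0 - SL))%C by ring.
  eapply Rle_trans; [apply Cmod_triangle|].
  assert (Cmod (g (F h) - g F0 - (SF - SF0))%C <= eps / 2 * nu h).
  { eapply Rle_trans; [exact Hd2|]. apply Rle_trans with (eps / (2 * K) * (K * nu h)).
    - apply Rmult_le_compat_l; trivial. apply Rlt_le, Rdiv_lt_0_compat; lra.
    - apply Req_le. field. lra. }
  lra.
Qed.
End Chain.

Lemma sderiv_chain (n m : nat) (g : Vec -> C) (b : nat -> C) (F : Vec -> Vec) (z : Vec) (A : nat -> nat -> C) :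
  sderiv m g (F z) b ->
  (forall j, (j < m)%nat -> sderiv n (fun w => F w j) z (A j)) ->
  supported m (F z) ->
  (exists delta, delta > 0 /\ forall h, supported n h -> vnorm n h < delta -> supported m (F (vadd z h))) ->
  sderiv n (fun w => g (F w)) z (fun i => csum m (fun j => b j * A j i)%C).
Proof.
  intros Hg HF hs Hs.
  eapply expands_sderiv;
    [exact (expands_chain _ _ (vnorm_ge0 n) m g b (fun h => F (vadd z h)) (F z) _ Hg HF hs Hs)|].
  intros h _. simpl.
  rewrite (csum_ext m _ (fun j => csum n (fun i => b j * (A j i * h i))%C)).
  - rewrite csum_swap. apply csum_ext. intros i _.
    rewrite <- Cmult_comm, <- csum_scal. apply csum_ext. intros j _. ring.
  - intros j _. now rewrite csum_scal.
Qed.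

Definition vscal (k : C) (x : Vec) : Vec := fun i => (k * x i)%C.

Lemma supported_vscal (n : nat) (k : C) (x : Vec) : supported n x -> supported n (vscal k x).
Proof. intros hx i hi. unfold vscal. rewrite hx by trivial. apply injective_projections; simpl; ring. Qed.

Lemma vnorm2_vscal (n : nat) (k : C) (x : Vec) : vnorm2 n (vscal k x) = Cnorm2 k * vnorm2 n x.
Proof.
  unfold vnorm2, vscal. rewrite <- rsum_scal. apply rsum_ext. intros. apply Cnorm2_mult.
Qed.

Lemma cderiv_line (m : nat) (g : Vec -> C) (b : nat -> C) (x : Vec) (k : C) :
  supported m x -> sderiv m g (vscal k x) b ->
  cderiv (fun w => g (vscal w x)) k (csum m (fun j => b j * x j)%C).
Proof.
  intros hx Hg.
  assert (HF : forall j, (j < m)%nat -> expands (fun _ => True) Cmod (fun h => vscal (k + h) x j) (vscal k x j)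
     (fun h => x j * h)%C).
  { intros j _. pose proof (cderiv_mult _ _ _ _ _ (cderiv_id k) (cderiv_const (x j) k)) as h.
    eapply expands_ext; [exact h| |reflexivity|].
    - exists 1. split; [lra|reflexivity].
    - intros w _. simpl. ring. }
  eapply expands_ext; [exact (expands_chain _ _ Cmod_ge_0 m g b (fun h => vscal (k + h) x) (vscal k x) _ Hg HF
    (supported_vscal m k x hx) (ex_intro _ 1 (conj Rlt_0_1 (fun h _ _ => supported_vscal m (k + h) x hx))))| | |].
  - exists 1. split; [lra|reflexivity].
  - reflexivity.
  - intros h _. simpl. rewrite Cmult_comm, <- csum_scal. apply csum_ext. intros j _. ring.
Qed.

(** A complex differential that is known to exist is determined by real increments. This reads off
    derivatives from exact affine formulas, and it is what gives the differential of an involution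
    at a real point when its values are known only at real points. *)
Lemma sderiv_affine (n : nat) (f : Vec -> C) (z : Vec) (a : nat -> C) (k : Vec) (l : C) (d : R) :
  sderiv n f z a -> supported n k -> d > 0 ->
  (forall t : R, Rabs t < d -> f (vadd z (vscal t k)) = (f z + t * l)%C) ->
  (csum n (fun i => a i * k i)%C : C) = l.
Proof.
  intros [_ Hf] hk hd Haff.
  set (s := (csum n (fun i => a i * k i)%C : C)).
  enough (E : Cmod (l - s) <= 0).
  { assert (E0 : (l - s)%C = 0) by (apply Cmod_eq_0; pose proof (Cmod_ge_0 (l - s)); lra).
    replace l with (l - s + s)%C by ring. rewrite E0. ring. }
  apply le_epsilon. intros eps he.
  pose proof (vnorm_ge0 n k) as hn.
  destruct (Hf (eps / (vnorm n k + 1))) as (d' & hd' & Hd').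
  { apply Rdiv_lt_0_compat; lra. }
  pose (t := Rmin (d / 2) (d' / (2 * (vnorm n k + 1)))).
  assert (ht : 0 < t) by (apply Rmin_pos; [lra|apply Rdiv_lt_0_compat; lra]).
  assert (ht1 : t <= d / 2) by apply Rmin_l.
  assert (ht2 : t * (vnorm n k + 1) <= d' / 2).
  { apply Rle_trans with (d' / (2 * (vnorm n k + 1)) * (vnorm n k + 1)).
    - apply Rmult_le_compat_r; [lra|]. apply Rmin_r.
    - apply Req_le. field. lra. }
  assert (hv : vnorm n (vscal t k) = t * vnorm n k).
  { unfold vnorm. rewrite vnorm2_vscal, Cnorm2_Cmod, Cmod_R, Rabs_right by lra.
    rewrite sqrt_mult_alt by nra. rewrite sqrt_square; lra. }
  specialize (Hd' (vscal t k) (supported_vscal n t k hk)). rewrite hv in Hd'.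
  specialize (Hd' ltac:(lra)).
  rewrite Haff in Hd' by (rewrite Rabs_right; lra).
  rewrite (csum_ext n _ (fun i => t * (a i * k i))%C), csum_scal in Hd' by (intros i _; unfold vscal; ring).
  fold s in Hd'.
  replace (f z + t * l - f z - t * s)%C with (t * (l - s))%C in Hd' by ring.
  rewrite Cmod_mult, Cmod_R, Rabs_right in Hd' by lra.
  apply Rmult_le_reg_l with t; trivial.
  apply Rle_trans with (1 := Hd').
  apply Rle_trans with (eps / (vnorm n k + 1) * (t * (vnorm n k + 1))).
  - apply Rmult_le_compat_l; [apply Rlt_le, Rdiv_lt_0_compat; lra|]. nra.
  - apply Req_le. field. lra.
Qed.

(** * Involutions of the type IV domain fixing the origin *)

Lemma cderiv_csum (n : nat) (f : nat -> C -> C) (z : C) (l : nat -> C) :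
  (forall i, (i < n)%nat -> cderiv (f i) z (l i)) ->
  cderiv (fun w => csum n (fun i => f i w)) z (csum n l).
Proof.
  induction n; intros H.
  - exact (cderiv_const 0 z).
  - apply (cderiv_plus (fun w => csum n (fun i => f i w)) (f n)); auto.
Qed.

Section ScaledSchwarz.
Context (f : C -> C) (M : R) (HM : 0 < M)
  (Hf : forall z, Cmod z < 1 -> exists l, cderiv f z l) (h0 : f 0 = 0)
  (Hb : forall z, Cmod z < 1 -> Cmod (f z) <= M).

Let g := fun z => (/ M * f z)%C.
Let HMC : RtoC M <> 0.
Proof. intros e. apply RtoC_inj in e. lra. Qed.

Let Hg_mod z : Cmod (g z) = / M * Cmod (f z).
Proof.
  unfold g. rewrite Cmod_mult, Cmod_inv, Cmod_R, Rabs_right by (trivial; lra). reflexivity.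
Qed.

Let Hg_deriv z l : cderiv f z l -> cderiv g z (/ RtoC M * l)%C.
Proof.
  intros h. eapply cderiv_ext; [exact (cderiv_mult _ _ _ _ _ (cderiv_const (/ RtoC M)%C z) h)| |].
  - exists 1. split; [lra|reflexivity].
  - cbv beta. ring.
Qed.

Let Hg : forall z, Cmod z < 1 -> exists l, cderiv g z l.
Proof. intros z hz. destruct (Hf z hz) as [l hl]. eexists. apply Hg_deriv, hl. Qed.
Let Hg0 : g 0 = 0.
Proof. unfold g. rewrite h0. ring. Qed.
Let Hgb : forall z, Cmod z < 1 -> Cmod (g z) <= 1.
Proof.
  intros z hz. rewrite Hg_mod. apply Rmult_le_reg_l with M; trivial.
  rewrite <- Rmult_assoc, Rinv_r, Rmult_1_l, Rmult_1_r by lra. auto.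
Qed.

Lemma schwarz_scaled w : Cmod w < 1 -> Cmod (f w) <= M * Cmod w.
Proof.
  intros hw. pose proof (schwarz g Hg Hg0 Hgb w hw) as h. rewrite Hg_mod in h.
  apply (Rmult_le_compat_l M) in h; [|lra]. rewrite <- Rmult_assoc, Rinv_r, Rmult_1_l in h by lra. exact h.
Qed.

Lemma schwarz_deriv_scaled l : cderiv f 0 l -> Cmod l <= M.
Proof.
  intros hl. pose proof (schwarz_deriv g _ Hg Hg0 Hgb (Hg_deriv _ _ hl)) as h.
  rewrite Cmod_mult, Cmod_inv, Cmod_R, Rabs_right in h by (trivial; lra).
  apply (Rmult_le_compat_l M) in h; [|lra]. rewrite <- Rmult_assoc, Rinv_r in h by lra. lra.
Qed.

Lemma schwarz_equality_scaled w : cderiv f 0 M -> Cmod w < 1 -> f w = (M * w)%C.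
Proof.
  intros hl hw. apply Hg_deriv in hl.
  replace (/ M * M)%C with (RtoC 1) in hl by (field; trivial).
  pose proof (schwarz_equality g Hg Hg0 Hgb hl w hw) as h. rewrite <- h at 2. unfold g. field. trivial.
Qed.
End ScaledSchwarz.

Definition real_vec (m : nat) (x : nat -> R) : Vec :=
  fun i => if (i <? m)%nat then RtoC (x i) else C0.

Lemma real_vec_lt (m : nat) (x : nat -> R) (i : nat) : (i < m)%nat -> real_vec m x i = RtoC (x i).
Proof. intros hi. unfold real_vec. now apply Nat.ltb_lt in hi as ->. Qed.

Lemma supported_real_vec (m : nat) (x : nat -> R) : supported m (real_vec m x).
Proof. intros i hi. unfold real_vec. now apply Nat.ltb_ge in hi as ->. Qed.

(** Bilinear, not Hermitian: [cdot m Z Z] is the Z Z^t in the definition of the domain. *)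
Definition cdot (m : nat) (a b : nat -> C) : C := csum m (fun i => a i * b i)%C.

Lemma cdot_vscal (m : nat) (a : nat -> C) (k : C) (Z : Vec) : cdot m a (vscal k Z) = (k * cdot m a Z)%C.
Proof. unfold cdot, vscal. rewrite <- csum_scal. apply csum_ext. intros. ring. Qed.

Lemma cdot_conj_self (m : nat) (Z : Vec) : cdot m (fun j => Cconj (Z j)) Z = RtoC (vnorm2 m Z).
Proof.
  unfold cdot, vnorm2. rewrite <- csum_RtoC. apply csum_ext. intros i _.
  rewrite <- Cnorm2_conj. ring.
Qed.

Lemma vnorm_conj (m : nat) (Z : nat -> C) : vnorm m (fun j => Cconj (Z j)) = vnorm m Z.
Proof.
  unfold vnorm, vnorm2. f_equal. apply rsum_ext. intros. unfold Cnorm2; simpl. ring.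
Qed.

Lemma DIV_sq (m : nat) (Z : Vec) :
  DIV m Z <-> supported m Z /\ vnorm2 m Z < 2 /\ 1 - vnorm2 m Z + / 4 * Cnorm2 (cdot m Z Z) > 0.
Proof. reflexivity. Qed.

Lemma real_vec_vnorm2 (m : nat) (x : nat -> R) : vnorm2 m (real_vec m x) = rsum m (fun i => x i * x i).
Proof.
  apply rsum_ext. intros i hi. rewrite real_vec_lt by trivial. unfold Cnorm2; simpl. ring.
Qed.

Lemma real_vec_sq (m : nat) (x : nat -> R) :
  cdot m (real_vec m x) (real_vec m x) = RtoC (rsum m (fun i => x i * x i)).
Proof.
  unfold cdot. rewrite <- csum_RtoC. apply csum_ext. intros i hi.
  rewrite real_vec_lt by trivial. now rewrite RtoC_mult.
Qed.

(** On this disc Z Z^t = 2 k^2 and |Z|^2 = 2 |k|^2, so the defining function is the square (1 -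
    |k|^2)^2. *)
Lemma real_disc_DIV (m : nat) (x : nat -> R) (k : C) :
  rsum m (fun i => x i * x i) = 2 -> Cmod k < 1 -> DIV m (vscal k (real_vec m x)).
Proof.
  intros hx hk. apply DIV_sq.
  assert (hk2 : 0 <= Cnorm2 k < 1).
  { rewrite Cnorm2_Cmod. pose proof (Cmod_ge_0 k). nra. }
  rewrite vnorm2_vscal, real_vec_vnorm2, hx.
  replace (cdot m (vscal k (real_vec m x)) (vscal k (real_vec m x))) with (k * k * 2)%C.
  - rewrite !Cnorm2_mult. replace (Cnorm2 (RtoC 2)) with 4 by (unfold Cnorm2; simpl; ring).
    split; [apply supported_vscal, supported_real_vec|]. split; nra.
  - rewrite cdot_vscal. unfold cdot.
    rewrite (csum_ext m _ (fun i => k * (real_vec m x i * real_vec m x i))%C) by (intros; unfold vscal; ring).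
    rewrite csum_scal. change (csum m _) with (cdot m (real_vec m x) (real_vec m x)).
    rewrite real_vec_sq, hx. ring.
Qed.

Lemma sqrt2_mult (a b : R) : (sqrt 2 * a) * (sqrt 2 * b) = 2 * (a * b).
Proof.
  transitivity (sqrt 2 * sqrt 2 * (a * b)); [ring|]. rewrite sqrt_sqrt; lra.
Qed.

Section FixedReflection.
Context (m : nat) (tau : Vec -> Vec) (u c : nat -> C)
  (tau_DIV : forall Z, DIV m Z -> DIV m (tau Z))
  (tau_diff : forall Z j, DIV m Z -> (j < m)%nat -> exists a, sderiv m (fun W => tau W j) Z a)
  (tau_0 : tau (fun _ => C0) = fun _ => C0)
  (tau_deriv : forall j, (j < m)%nat -> sderiv m (fun W => tau W j) (fun _ => C0)
     (fun k => (if (j =? k)%nat then RtoC 1 else RtoC 0) - 2 * (u j * c k))%C)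
  (cu : cdot m c u = 1).

(** The differential of [tau] at 0: the identity minus twice the projection onto u along the kernel
    of c. *)
Definition lin (Z : Vec) : Vec := fun j => (Z j - 2 * (u j * cdot m c Z))%C.

Lemma tau_deriv_line (X : Vec) (j : nat) :
  supported m X -> (j < m)%nat -> cderiv (fun w => tau (vscal w X) j) 0 (lin X j).
Proof.
  intros hX hj.
  assert (e : vscal 0 X = fun _ => C0).
  { apply functional_extensionality. intros i. apply injective_projections; simpl; ring. }
  pose proof (tau_deriv j hj) as h. rewrite <- e in h.
  apply (cderiv_line m (fun W => tau W j) _ X 0 hX) in h.
  replace (lin X j) with (csum m (fun k => ((if (j =? k)%nat then RtoC 1 else RtoC 0) - 2 * (u j * c k)) * X k)%C : C);
    [exact h|].
  rewrite (csum_ext m _ (fun k => (if (j =? k)%nat then RtoC 1 else RtoC 0) * X k + (- 2 * u j) * (c k * X k))%C)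
    by (intros; ring).
  rewrite csum_plus, csum_scal, (csum_single m j); trivial.
  - rewrite Nat.eqb_refl. unfold lin, cdot. ring.
  - intros i _ hi. rewrite (proj2 (Nat.eqb_neq j i)) by auto. ring.
Qed.

Section RealDisc.
Context (x : nat -> R) (hx : rsum m (fun i => x i * x i) = 2).
Let X := real_vec m x.
(** Pairing with a fixed vector d makes the vector-valued disc a scalar function bounded by |d| sqrt
    2, to which the one-variable Schwarz lemma applies. The useful choices of d are the value of the
    disc at w and its derivative at 0. *)
Let pair (d : nat -> C) (w : C) : C := cdot m (fun j => Cconj (d j)) (tau (vscal w X)).

Let pair_0 d : pair d 0 = 0.
Proof.
  unfold pair. replace (vscal 0 X) with (fun _ : nat => C0).
  - rewrite tau_0. apply csum_zero. intros. apply injective_projections; simpl; ring.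
  - apply functional_extensionality. intros i. apply injective_projections; simpl; ring.
Qed.

Let pair_diff d z : Cmod z < 1 -> exists l, cderiv (pair d) z l.
Proof.
  intros hz.
  assert (H : forall j, exists l, (j < m)%nat -> cderiv (fun w => Cconj (d j) * tau (vscal w X) j)%C z l).
  { intros j. destruct (Compare_dec.lt_dec j m) as [hj|hj]; [|exists 0; contradiction].
    destruct (tau_diff (vscal z X) j (real_disc_DIV m x z hx hz) hj) as [a ha].
    eexists. intros _. apply cderiv_mult; [apply cderiv_const|].
    apply (cderiv_line m (fun W => tau W j)); [apply supported_real_vec|exact ha]. }
  pose (l := fun j => proj1_sig (constructive_indefinite_description _ (H j))).
  exists (csum m l). apply (cderiv_csum m (fun j w => Cconj (d j) * tau (vscal w X) j)%C).
  intros j hj. unfold l. destruct constructive_indefinite_description as [a ha]. auto.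
Qed.

Let pair_deriv d : cderiv (pair d) 0 (cdot m (fun j => Cconj (d j)) (lin X)).
Proof.
  apply (cderiv_csum m (fun j w => Cconj (d j) * tau (vscal w X) j)%C 0 (fun j => Cconj (d j) * lin X j)%C).
  intros j hj.
  eapply cderiv_ext; [exact (cderiv_mult _ _ _ _ _ (cderiv_const (Cconj (d j)) 0)
    (tau_deriv_line X j (supported_real_vec m x) hj))| |].
  - exists 1. split; [lra|reflexivity].
  - cbv beta. ring.
Qed.

Let pair_bound d z : Cmod z < 1 -> Cmod (pair d z) <= vnorm m d * sqrt 2.
Proof.
  intros hz. unfold pair. eapply Rle_trans; [apply cauchy_schwarz|]. rewrite vnorm_conj.
  apply Rmult_le_compat_l; [apply vnorm_ge0|].
  apply sqrt_le_1_alt. apply Rlt_le. apply (tau_DIV _ (real_disc_DIV m x z hx hz)).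
Qed.

Let sqrt2_pos : 0 < sqrt 2.
Proof. apply sqrt_lt_R0. lra. Qed.

Let sqrt2_sqr : sqrt 2 * sqrt 2 = 2.
Proof. apply sqrt_sqrt. lra. Qed.

Lemma tau_norm_le w : Cmod w < 1 -> vnorm2 m (tau (vscal w X)) <= 2 * (Cmod w * Cmod w).
Proof.
  intros hw. set (d := tau (vscal w X)). pose proof (Cmod_ge_0 w) as hw0.
  rewrite <- vnorm_sqr. pose proof (vnorm_ge0 m d) as hd.
  destruct (Rle_lt_or_eq_dec 0 (vnorm m d) hd) as [hp|e]; [|rewrite <- e; nra].
  assert (h : Cmod (pair d w) <= vnorm m d * sqrt 2 * Cmod w).
  { apply schwarz_scaled; auto. now apply Rmult_lt_0_compat. }
  unfold pair in h. fold d in h. rewrite cdot_conj_self, Cmod_R, Rabs_right in h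
    by (apply Rle_ge, vnorm2_ge0).
  rewrite <- vnorm_sqr, Rmult_assoc in h. apply Rmult_le_reg_l in h; trivial.
  replace (2 * (Cmod w * Cmod w)) with ((sqrt 2 * Cmod w) * (sqrt 2 * Cmod w)) by (rewrite sqrt2_mult; ring).
  apply Rmult_le_compat; trivial.
Qed.

Lemma lin_norm_le : vnorm2 m (lin X) <= 2.
Proof.
  set (d := lin X). rewrite <- vnorm_sqr. pose proof (vnorm_ge0 m d) as hd.
  destruct (Rle_lt_or_eq_dec 0 (vnorm m d) hd) as [hp|e]; [|rewrite <- e; nra].
  assert (h : Cmod (cdot m (fun j => Cconj (d j)) (lin X)) <= vnorm m d * sqrt 2).
  { apply (schwarz_deriv_scaled (pair d)); auto. now apply Rmult_lt_0_compat. }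
  fold d in h. rewrite cdot_conj_self, Cmod_R, Rabs_right in h by (apply Rle_ge, vnorm2_ge0).
  rewrite <- vnorm_sqr in h. apply Rmult_le_reg_l in h; trivial.
  rewrite <- sqrt2_sqr. apply Rmult_le_compat; trivial.
Qed.

(** Paired with d = L X, the disc has derivative |d|^2 = 2 at 0, equal to its bound, so the pairing
    is exactly 2 w. With |tau (w X)|^2 <= 2 |w|^2 this gives |tau (w X) - w d|^2 <= 2 |w|^2 + 2
    |w|^2 - 4 |w|^2 = 0. *)
Lemma tau_eq_lin_disc w j : vnorm2 m (lin X) = 2 -> Cmod w < 1 -> (j < m)%nat ->
  tau (vscal w X) j = (w * lin X j)%C.
Proof.
  intros h2 hw hj. set (d := lin X) in *.
  assert (hv : vnorm m d = sqrt 2) by (unfold vnorm; now rewrite h2).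
  assert (h : pair d w = (2 * w)%C).
  { apply (schwarz_equality_scaled (pair d) 2); auto; [lra| |].
    - intros z hz. rewrite <- sqrt2_sqr. rewrite <- hv at 1. auto.
    - rewrite <- h2, <- cdot_conj_self. apply pair_deriv. }
  assert (e : vnorm2 m (vsub (tau (vscal w X)) (vscal w d)) <= 0).
  { pose proof (tau_norm_le w hw) as ht.
    assert (E : vnorm2 m (vsub (tau (vscal w X)) (vscal w d))
      = vnorm2 m (tau (vscal w X)) + Cnorm2 w * vnorm2 m d - 2 * Re (Cconj w * pair d w)%C).
    { unfold pair, cdot. rewrite <- csum_scal, Re_csum. unfold vnorm2.
      rewrite <- !rsum_scal, <- rsum_plus, <- rsum_minus.
      apply rsum_ext. intros i _. unfold vsub, vscal, Cnorm2, Re, Cconj. simpl. ring. }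
    rewrite E, h, h2, Cnorm2_Cmod.
    replace (Re (Cconj w * (2 * w))%C) with (2 * Cnorm2 w)
      by (clear; destruct w as [a b]; unfold Cnorm2, Re, Cconj; simpl; ring).
    rewrite Cnorm2_Cmod. lra. }
  exact (vnorm2_vsub_eq m _ _ e j hj).
Qed.

(** Along the disc [tau] is linear and stays in the domain, so 1 - 2 y + y^2 Q / 4 > 0 for 0 < y <
    1, y being the square of the real parameter. At the boundary value y = 1 this becomes Q >= 4. *)
Lemma lin_sq_ge : vnorm2 m (lin X) = 2 -> 4 <= Cnorm2 (cdot m (lin X) (lin X)).
Proof.
  intros h2. apply Rnot_lt_le. set (Q := Cnorm2 (cdot m (lin X) (lin X))). intros hQ.
  assert (hQ0 : 0 <= Q) by apply Cnorm2_ge0.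
  (* With e = (4 - Q) / 16 and y = 1 - e the defining function is e (e - 4 y^2), which is negative
     since e <= 1/4 and y >= 3/4. *)
  set (y := 1 - (4 - Q) / 16). assert (hy : 0 < y < 1) by (unfold y; lra).
  assert (hs : sqrt y * sqrt y = y) by (apply sqrt_sqrt; lra).
  pose proof (sqrt_pos y) as hs0.
  assert (hm : Cmod (sqrt y) < 1).
  { rewrite Cmod_R, Rabs_right by lra. nra. }
  destruct (tau_DIV _ (real_disc_DIV m x (sqrt y) hx hm)) as (_ & _ & hD).
  fold X in hD. change (csum m _) with (cdot m (tau (vscal (sqrt y) X)) (tau (vscal (sqrt y) X))) in hD.
  assert (E1 : vnorm2 m (tau (vscal (sqrt y) X)) = y * 2).
  { rewrite <- h2. replace y with (Cnorm2 (RtoC (sqrt y))) at 2 by (unfold Cnorm2; simpl; lra).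
    rewrite <- vnorm2_vscal. apply rsum_ext. intros i hi. now rewrite tau_eq_lin_disc. }
  assert (E2 : cdot m (tau (vscal (sqrt y) X)) (tau (vscal (sqrt y) X)) = (y * cdot m (lin X) (lin X))%C).
  { unfold cdot. rewrite <- csum_scal. apply csum_ext. intros i hi.
    rewrite tau_eq_lin_disc by trivial.
    replace (RtoC y) with (sqrt y * sqrt y)%C by (rewrite <- RtoC_mult; now rewrite hs). ring. }
  rewrite E1, E2, Cnorm2_mult in hD. fold Q in hD.
  replace (Cnorm2 (RtoC y)) with (y * y) in hD by (unfold Cnorm2; simpl; ring).
  unfold y in hD. nra.
Qed.
End RealDisc.

Let sum_cu : Re (cdot m c u) = 1.
Proof. now rewrite cu. Qed.

(** Schwarz's lemma at x = sqrt 2 e_k bounds |L e_k|^2 by 1. Summing over k bounds the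
    Hilbert-Schmidt norm: m - 4 Re (c u) + 4 |u|^2 |c|^2 <= m, where c u = 1. *)
Lemma norm_product_le : vnorm2 m u * vnorm2 m c <= 1.
Proof.
  assert (H : forall k, (k < m)%nat ->
    rsum m (fun j => (if (j =? k)%nat then 1 - 4 * Re (c k * u k)%C else 0) + 4 * (Cnorm2 (u j) * Cnorm2 (c k))) <= 1).
  { intros k hk.
    set (x := fun i => if (i =? k)%nat then sqrt 2 else 0).
    assert (s2 : sqrt 2 * sqrt 2 = 2) by (apply sqrt_sqrt; lra).
    assert (hx : rsum m (fun i => x i * x i) = 2).
    { rewrite (rsum_single m k); trivial.
      - unfold x. now rewrite Nat.eqb_refl.
      - intros i _ hi. unfold x. apply Nat.eqb_neq in hi as ->. ring. }
    pose proof (lin_norm_le x hx) as h.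
    assert (hc : cdot m c (real_vec m x) = (c k * sqrt 2)%C).
    { unfold cdot. rewrite (csum_single m k); trivial.
      - rewrite real_vec_lt by trivial. unfold x. now rewrite Nat.eqb_refl.
      - intros i hi hne. rewrite real_vec_lt by trivial. unfold x. apply Nat.eqb_neq in hne as ->. ring. }
    apply Rmult_le_reg_l with 2; [lra|]. rewrite Rmult_1_r. eapply Rle_trans; [|exact h]. apply Req_le.
    rewrite <- rsum_scal. apply rsum_ext. intros j hj. unfold lin. rewrite hc, real_vec_lt by trivial.
    unfold x. destruct (Nat.eqb_spec j k) as [->|hne];
    unfold Cnorm2, Re; destruct (c k) as [c1 c2]; [destruct (u k) as [u1 u2]|destruct (u j) as [u1 u2]]; simpl.
    - replace 2 with (sqrt 2 * sqrt 2) at 1 by exact s2. ring.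
    - replace 2 with (sqrt 2 * sqrt 2) at 1 by exact s2. ring. }
  pose proof (rsum_le m _ _ H) as h. rewrite rsum_const in h.
  rewrite (rsum_ext m _ (fun k => (1 + (- 4) * Re (c k * u k)%C) + (4 * vnorm2 m u) * Cnorm2 (c k))) in h.
  - rewrite !rsum_plus, !rsum_scal, rsum_const, <- Re_csum in h.
    change (csum m _) with (cdot m c u) in h. rewrite sum_cu in h. fold (vnorm2 m c) in h. lra.
  - intros k hk. rewrite rsum_plus, (rsum_single m k); trivial.
    + rewrite Nat.eqb_refl. unfold vnorm2. rewrite !rsum_scal.
      rewrite (rsum_ext m _ (fun j => Cnorm2 (c k) * Cnorm2 (u j))) by (intros; ring).
      rewrite rsum_scal. ring.
    + intros i _ hi. now apply Nat.eqb_neq in hi as ->.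
Qed.

(** The equality case of Cauchy-Schwarz: c u = 1 while |u|^2 |c|^2 <= 1, hence |S u - conj c|^2 = S
    (S |u|^2 - 1) <= 0. Thus L is the orthogonal reflection in the hyperplane c Z = 0. *)
Lemma u_eq_conj_c j : (j < m)%nat -> (vnorm2 m c * u j)%C = Cconj (c j).
Proof.
  intros hj. set (S := vnorm2 m c).
  assert (e : vnorm2 m (vsub (vscal S u) (fun j => Cconj (c j))) <= 0).
  { assert (E : vnorm2 m (vsub (vscal S u) (fun j => Cconj (c j)))
      = S * S * vnorm2 m u + S - 2 * S * Re (cdot m c u)).
    { unfold S at 4. unfold vnorm2, cdot. rewrite Re_csum, <- !rsum_scal, <- rsum_plus, <- rsum_minus.
      apply rsum_ext. intros i _. unfold vsub, vscal, Cnorm2, Re, Cconj. simpl. ring. }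
    rewrite E, sum_cu. pose proof norm_product_le as h. fold S in h.
    assert (0 <= S) by apply vnorm2_ge0. nra. }
  exact (vnorm2_vsub_eq m _ _ e j hj).
Qed.

Lemma norm_c_pos : 0 < vnorm2 m c.
Proof.
  destruct (Rle_lt_or_eq_dec _ _ (vnorm2_ge0 m c)) as [h|h]; trivial. exfalso.
  assert (e : cdot m c u = 0).
  { apply csum_zero. intros i hi. rewrite (vnorm2_eq0 m c) by (trivial; lra). ring. }
  rewrite cu in e. apply RtoC_inj in e. lra.
Qed.

Lemma cdot_u (Z : Vec) : (vnorm2 m c * cdot m Z u)%C = cdot m Z (fun j => Cconj (c j)).
Proof.
  unfold cdot. rewrite <- csum_scal. apply csum_ext. intros i hi.
  rewrite <- u_eq_conj_c by trivial. ring.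
Qed.

Lemma cdot_real_conj (x : nat -> R) :
  cdot m (real_vec m x) (fun j => Cconj (c j)) = Cconj (cdot m c (real_vec m x)).
Proof.
  unfold cdot. rewrite <- csum_conj. apply csum_ext. intros i hi.
  rewrite real_vec_lt by trivial. apply injective_projections; simpl; ring.
Qed.

Lemma norm_product_eq : vnorm2 m c * vnorm2 m u = 1.
Proof.
  pose proof norm_c_pos as hp.
  apply Rmult_eq_reg_l with (vnorm2 m c); [|lra]. rewrite Rmult_1_r, <- Rmult_assoc.
  unfold vnorm2 at 3. rewrite <- rsum_scal. apply rsum_ext. intros i hi.
  replace (vnorm2 m c * vnorm2 m c) with (Cnorm2 (RtoC (vnorm2 m c))) by (unfold Cnorm2; simpl; ring).
  rewrite <- Cnorm2_mult, u_eq_conj_c by trivial. unfold Cnorm2; simpl. ring.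
Qed.

Lemma lin_isometry (x : nat -> R) :
  vnorm2 m (lin (real_vec m x)) = rsum m (fun i => x i * x i).
Proof.
  pose proof norm_c_pos as hp. rewrite <- real_vec_vnorm2.
  set (X := real_vec m x). set (s := cdot m c X).
  assert (E : vnorm2 m (lin X) = vnorm2 m X + 4 * Cnorm2 s * vnorm2 m u - 4 * Re (s * cdot m X u)%C).
  { unfold cdot at 1. rewrite <- csum_scal, Re_csum. unfold vnorm2. rewrite <- !rsum_scal, <- rsum_plus, <- rsum_minus.
    apply rsum_ext. intros i hi. unfold lin. fold s. unfold X. rewrite real_vec_lt by trivial.
    unfold Cnorm2, Re. simpl. ring. }
  rewrite E. apply Rmult_eq_reg_l with (vnorm2 m c); [|lra].
  assert (E2 : vnorm2 m c * Re (s * cdot m X u)%C = Cnorm2 s).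
  { replace (vnorm2 m c * Re (s * cdot m X u)%C) with (Re (s * (vnorm2 m c * cdot m X u))%C)
      by (unfold Re; simpl; ring).
    rewrite cdot_u. unfold X. rewrite cdot_real_conj. fold X s. unfold Re, Cnorm2; simpl. ring. }
  transitivity (vnorm2 m c * vnorm2 m X + 4 * Cnorm2 s * (vnorm2 m c * vnorm2 m u)
    - 4 * (vnorm2 m c * Re (s * cdot m X u)%C)); [ring|].
  rewrite E2, norm_product_eq. ring.
Qed.

Theorem tau_eq_lin_real (p : Vec) (j : nat) :
  DIV m p -> (forall i, Im (p i) = 0) -> (j < m)%nat -> tau p j = lin p j.
Proof.
  intros hp hr hj. destruct hp as (hs & hn & _).
  assert (hre : forall i, p i = RtoC (Re (p i))).
  { intros i. apply injective_projections; [reflexivity|]. exact (hr i). }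
  destruct (Rle_lt_or_eq_dec _ _ (vnorm2_ge0 m p)) as [hpos|h0].
  - set (N := vnorm m p).
    assert (hN : 0 < N) by (apply sqrt_lt_R0; exact hpos).
    assert (hNN : N * N = vnorm2 m p) by apply vnorm_sqr.
    assert (s2 : sqrt 2 * sqrt 2 = 2) by (apply sqrt_sqrt; lra).
    assert (s2p : 0 < sqrt 2) by (apply sqrt_lt_R0; lra).
    (* The point p rescaled to norm sqrt 2, so that p = w X with w = N / sqrt 2; here w < 1 because
       |p|^2 < 2. *)
    set (x := fun i => sqrt 2 / N * Re (p i)).
    assert (hx : rsum m (fun i => x i * x i) = 2).
    { rewrite (rsum_ext m _ (fun i => (2 / (N * N)) * Cnorm2 (p i))).
      - rewrite rsum_scal. fold (vnorm2 m p). rewrite <- hNN. field. lra.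
      - intros i _. unfold x, Cnorm2. fold (Re (p i)) (Im (p i)). rewrite (hr i).
        transitivity ((sqrt 2 * (/ N * Re (p i))) * (sqrt 2 * (/ N * Re (p i)))); [unfold Rdiv; ring|].
        rewrite sqrt2_mult. field. lra. }
    set (w := RtoC (N / sqrt 2)).
    assert (hw : Cmod w < 1).
    { unfold w. rewrite Cmod_R, Rabs_right by (apply Rle_ge, Rlt_le, Rdiv_lt_0_compat; lra).
      apply Rmult_lt_reg_r with (sqrt 2); trivial.
      replace (N / sqrt 2 * sqrt 2) with N by (field; lra). nra. }
    assert (ep : p = vscal w (real_vec m x)).
    { apply functional_extensionality. intros i. destruct (Compare_dec.lt_dec i m) as [hi|hi].
      - unfold vscal, w. rewrite real_vec_lt, hre by trivial. unfold x. rewrite <- RtoC_mult. f_equal.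
        field. lra.
      - rewrite (hs i) by lia. unfold vscal. rewrite supported_real_vec by lia.
        apply injective_projections; simpl; ring. }
    rewrite ep. rewrite tau_eq_lin_disc; trivial.
    + unfold lin. rewrite cdot_vscal. unfold vscal. cring.
    + now rewrite lin_isometry.
  - assert (ep : p = fun _ => C0).
    { apply functional_extensionality. intros i. destruct (Compare_dec.lt_dec i m) as [hi|hi].
      - apply (vnorm2_eq0 m p); trivial; lra.
      - apply hs; lia. }
    rewrite ep, tau_0. unfold lin. replace (cdot m c (fun _ => C0)) with (RtoC 0).
    + apply injective_projections; simpl; ring.
    + symmetry. apply csum_zero. intros. apply injective_projections; simpl; ring.
Qed.

(* Evaluating |L x . L x| >= 2 at x = sqrt 2 (t e_j + sqrt (1 - t^2) e_n) and letting t -> 0. *)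
Theorem c_phase_real (n j : nat) :
  (n < m)%nat -> c n = 0 -> (j < m)%nat ->
  (vnorm2 m c * Cconj (c j))%C = (Cconj (cdot m c c) * c j)%C.
Proof.
  intros hn hcn hj. set (S := vnorm2 m c). assert (hS : 0 < S) by apply norm_c_pos.
  destruct (Nat.eq_dec j n) as [->|hjn].
  { rewrite hcn. apply injective_projections; simpl; ring. }
  set (q := cdot m c c).
  assert (s2 : sqrt 2 * sqrt 2 = 2) by (apply sqrt_sqrt; lra).
  (* As c_n = 0, the vector e_n is fixed by L and the bound is an equality at t = 0. The number
     [kap] is the coefficient of t^2 in S^2 (L x . L x) / 2, so its real part cannot be negative. *)
  set (kap := (4 * (c j * c j * Cconj q - S * (c j * Cconj (c j))))%C).
  assert (H : forall t, 0 < t <= 1 -> 0 <= 2 * (S * S) * Re kap + t * t * Cnorm2 kap).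
  { intros t ht.
    set (r := sqrt (1 - t * t)).
    assert (hr : r * r = 1 - t * t) by (apply sqrt_sqrt; nra).
    set (x := fun i => if (i =? j)%nat then sqrt 2 * t else if (i =? n)%nat then sqrt 2 * r else 0).
    assert (hx : rsum m (fun i => x i * x i) = 2).
    { rewrite (rsum_ext m _ (fun i => (if (i =? j)%nat then 2 * (t * t) else 0) + (if (i =? n)%nat then 2 * (r * r) else 0))).
      - rewrite rsum_plus, (rsum_single m j), (rsum_single m n); trivial.
        + rewrite !Nat.eqb_refl, hr. ring.
        + intros i _ hi. now apply Nat.eqb_neq in hi as ->.
        + intros i _ hi. now apply Nat.eqb_neq in hi as ->.
      - intros i _. unfold x. destruct (Nat.eqb_spec i j) as [->|h1].
        + rewrite (proj2 (Nat.eqb_neq j n) hjn), sqrt2_mult. ring.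
        + destruct (Nat.eqb_spec i n); rewrite ?sqrt2_mult; ring. }
    pose proof (lin_sq_ge x hx ltac:(now rewrite lin_isometry)) as h.
    set (X := real_vec m x) in *. set (s := cdot m c X).
    assert (hs : s = (sqrt 2 * t * c j)%C).
    { unfold s, cdot. rewrite (csum_single m j); trivial.
      - unfold X. rewrite real_vec_lt by trivial. unfold x. rewrite Nat.eqb_refl, RtoC_mult. ring.
      - intros i hi hij. unfold X. rewrite real_vec_lt by trivial. unfold x.
        rewrite (proj2 (Nat.eqb_neq i j) hij). destruct (Nat.eqb_spec i n) as [->|_]; [rewrite hcn|]; ring. }
    assert (E : (S * S * cdot m (lin X) (lin X))%C = (2 * (S * S + (t * t) * kap))%C).
    { assert (E1 : cdot m (lin X) (lin X) = (cdot m X X - 4 * s * cdot m X u + 4 * s * s * cdot m u u)%C).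
      { transitivity (cdot m X X + (- 4 * s) * cdot m X u + (4 * s * s) * cdot m u u)%C; [|ring].
        unfold cdot. rewrite <- !csum_scal, <- !csum_plus.
        apply csum_ext. intros i _. unfold lin. fold s. cring. }
      assert (E2 : (S * cdot m X u)%C = Cconj s).
      { unfold S. rewrite cdot_u. apply cdot_real_conj. }
      assert (E3 : (S * S * cdot m u u)%C = Cconj q).
      { replace (S * S * cdot m u u)%C with (S * (S * cdot m u u))%C by ring. unfold S at 2.
        rewrite cdot_u. unfold q, cdot. rewrite <- csum_conj, <- csum_scal. apply csum_ext. intros i hi.
        rewrite <- u_eq_conj_c by trivial. fold S. rewrite Cmult_conj, <- u_eq_conj_c by trivial. fold S. ring. }
      rewrite E1. unfold X at 1 2. rewrite real_vec_sq, hx.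
      replace (S * S * (2 - 4 * s * cdot m X u + 4 * s * s * cdot m u u))%C with
        (2 * (S * S) - 4 * S * s * (S * cdot m X u) + 4 * s * s * (S * S * cdot m u u))%C by ring.
      rewrite E2, E3, hs. unfold kap. rewrite !Cmult_conj.
      replace (Cconj (sqrt 2)) with (RtoC (sqrt 2)) by (apply injective_projections; simpl; ring).
      replace (Cconj t) with (RtoC t) by (apply injective_projections; simpl; ring).
      assert (s2C : (sqrt 2 * sqrt 2)%C = 2) by (rewrite <- RtoC_mult; now rewrite s2).
      replace (4 * S * (sqrt 2 * t * c j) * (sqrt 2 * t * Cconj (c j)))%C with
        (4 * S * (t * t) * (c j * Cconj (c j)) * (sqrt 2 * sqrt 2))%C by ring.
      replace (4 * (sqrt 2 * t * c j) * (sqrt 2 * t * c j) * Cconj q)%C with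
        (4 * (t * t) * (c j * c j) * Cconj q * (sqrt 2 * sqrt 2))%C by ring.
      rewrite s2C. ring. }
    apply (f_equal Cnorm2) in E. rewrite !Cnorm2_mult in E.
    replace (Cnorm2 (RtoC S)) with (S * S) in E by (unfold Cnorm2; simpl; ring).
    replace (Cnorm2 (RtoC 2)) with 4 in E by (unfold Cnorm2; simpl; ring).
    replace (Cnorm2 (S * S + t * t * kap)%C) with
      (S * S * (S * S) + t * t * (2 * (S * S) * Re kap + t * t * Cnorm2 kap)) in E
      by (unfold Cnorm2, Re; simpl; ring).
    assert (hS4 : 0 < S * S * (S * S)) by (repeat apply Rmult_lt_0_compat; trivial).
    assert (ht2 : 0 < t * t) by nra.
    assert (h4 : S * S * (S * S) * 4 <= S * S * (S * S) * Cnorm2 (cdot m (lin X) (lin X)))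
      by (apply Rmult_le_compat_l; lra).
    apply Rmult_le_reg_l with (t * t); trivial. lra. }
  assert (hk : 0 <= Re kap).
  { apply Rnot_lt_le. intros hneg. pose proof (Cnorm2_ge0 kap) as hk0.
    set (a := - (2 * (S * S) * Re kap)).
    assert (ha : 0 < a).
    { unfold a. assert (0 < S * S * - Re kap) by (repeat apply Rmult_lt_0_compat; lra). lra. }
    (* Since t <= 1, this makes t^2 |kap|^2 at most a / 2, which is less than a, against [H]. *)
    set (t := Rmin 1 (a / (2 * (Cnorm2 kap + 1)))).
    assert (ht : 0 < t) by (apply Rmin_pos; [lra|apply Rdiv_lt_0_compat; lra]).
    assert (ht1 : t <= 1) by apply Rmin_l.
    assert (ht2 : t * (Cnorm2 kap + 1) <= a / 2).
    { apply Rle_trans with (a / (2 * (Cnorm2 kap + 1)) * (Cnorm2 kap + 1)).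
      - apply Rmult_le_compat_r; [lra|apply Rmin_r].
      - apply Req_le. field. lra. }
    specialize (H t (conj ht ht1)). unfold a in *. nra. }
  (* The sign of Re kap says B <= Re A, while |q| <= S by Cauchy-Schwarz gives |A| <= B. Hence A =
     B, and dividing by c_j yields the phase relation. *)
  set (A := (c j * c j * Cconj q)%C). set (B := S * Cnorm2 (c j)).
  assert (hA : B <= Re A).
  { unfold kap in hk. rewrite Cnorm2_conj in hk. fold A in hk. unfold B.
    revert hk. unfold Re; simpl. lra. }
  assert (hA2 : Cmod A <= B).
  { unfold A, B. rewrite !Cmod_mult, Cmod_conj, Cnorm2_Cmod, (Rmult_comm S).
    apply Rmult_le_compat_l; [apply Rmult_le_pos; apply Cmod_ge_0|].
    unfold S. rewrite <- vnorm_sqr. apply cauchy_schwarz. }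
  assert (hB : 0 <= B) by (apply Rmult_le_pos; [lra|apply Cnorm2_ge0]).
  assert (eA : A = RtoC B).
  { pose proof (Cmod_sqr A) as e. pose proof (Cmod_ge_0 A).
    apply injective_projections; simpl; [change (Re A = B)|change (Im A = 0)]; nra. }
  destruct (Ceq_dec (c j) 0) as [e|hne].
  { rewrite e. apply injective_projections; simpl; ring. }
  assert (e : (c j * (S * Cconj (c j)))%C = (c j * (Cconj q * c j))%C).
  { replace (c j * (Cconj q * c j))%C with A by (unfold A; ring). rewrite eA. unfold B.
    rewrite RtoC_mult, <- Cnorm2_conj. ring. }
  replace (S * Cconj (c j))%C with (/ c j * (c j * (S * Cconj (c j))))%C by (field; trivial).
  rewrite e. field. trivial.
Qed.
End FixedReflection.

(** * The map *)

(** The principal branch, by the half-angle formula; it serves as a square root where Re w > 0, and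
    there the denominator is positive. *)
Definition csqrt (w : C) : C :=
  (sqrt ((Cmod w + Re w) / 2), Im w / (2 * sqrt ((Cmod w + Re w) / 2))).

Lemma csqrt_re_pos (w : C) : 0 < Re w -> 0 < Re (csqrt w).
Proof.
  intros hw. apply sqrt_lt_R0. pose proof (Cmod_ge_0 w). lra.
Qed.

Lemma csqrt_sqr (w : C) : 0 < Re w -> (csqrt w * csqrt w)%C = w.
Proof.
  intros hw. pose proof (csqrt_re_pos w hw) as hr. unfold csqrt in *.
  pose proof (Cmod_ge_0 w) as hm0. pose proof (Cmod_sqr w) as hm.
  set (rho := sqrt ((Cmod w + Re w) / 2)) in *. change (0 < rho) in hr.
  assert (hrr : rho * rho = (Cmod w + Re w) / 2) by (apply sqrt_sqrt; lra).
  apply injective_projections; simpl.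
  - change (fst w) with (Re w).
    apply Rmult_eq_reg_l with (4 * (rho * rho)); [|nra].
    replace (4 * (rho * rho) * (rho * rho - Im w / (2 * rho) * (Im w / (2 * rho))))
      with (4 * (rho * rho) * (rho * rho) - Im w * Im w) by (field; lra).
    rewrite hrr. nra.
  - change (snd w) with (Im w). field. lra.
Qed.

Lemma Cmod_plus_re_pos (a b : C) : 0 < Re a -> 0 < Re b -> Re a <= Cmod (a + b) /\ (a + b)%C <> 0.
Proof.
  intros ha hb.
  assert (h : Re a <= Cmod (a + b)).
  { eapply Rle_trans; [|apply re_le_Cmod]. eapply Rle_trans; [|apply Rle_abs].
    change (Re (a + b)) with (Re a + Re b). lra. }
  split; trivial. intros e. rewrite e, Cmod_0 in h. lra.
Qed.

(** For the roots s of w and s' of w + h, s' - s = h / (s + s'), and the remainder is - h^2 / (2 s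
    (s + s')^2). Both roots have positive real part, so |s + s'| >= Re s, and no prior continuity of
    the root is needed. *)
Lemma cderiv_csqrt (w : C) : 0 < Re w -> cderiv csqrt w (/ (2 * csqrt w)).
Proof.
  intros hw. set (s := csqrt w). pose proof (csqrt_re_pos w hw) as hs. fold s in hs.
  pose proof (csqrt_sqr w hw) as hss. fold s in hss.
  set (a := Re s) in *.
  assert (hsn : s <> 0) by (intros e; unfold a in hs; rewrite e in hs; simpl in hs; lra).
  assert (has : a <= Cmod s).
  { eapply Rle_trans; [apply Rle_abs|]. apply re_le_Cmod. }
  apply cderiv_intro. intros eps he.
  exists (Rmin (Re w) (2 * eps * a ^ 3)). split.
  { apply Rmin_pos; trivial. apply Rmult_lt_0_compat; [lra|]. now apply pow_lt. }
  intros h hh.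
  pose proof (Rlt_le_trans _ _ _ hh (Rmin_l _ _)) as h1.
  pose proof (Rlt_le_trans _ _ _ hh (Rmin_r _ _)) as h2.
  assert (hwh : 0 < Re (w + h)).
  { pose proof (re_le_Cmod h) as hr. apply Rabs_le_between in hr.
    change (Re (w + h)) with (Re w + Re h). lra. }
  set (s' := csqrt (w + h)). pose proof (csqrt_re_pos _ hwh) as hs'. fold s' in hs'.
  pose proof (csqrt_sqr _ hwh) as hss'. fold s' in hss'.
  destruct (Cmod_plus_re_pos s s' hs hs') as [hsum hne]. fold a in hsum.
  assert (e1 : h = ((s' - s) * (s + s'))%C).
  { replace ((s' - s) * (s + s'))%C with (s' * s' - s * s)%C by ring. rewrite hss', hss. ring. }
  assert (e2 : (s' - s)%C = (h * / (s + s'))%C) by (rewrite e1 at 1; field; trivial).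
  fold s. replace (s' - s - / (2 * s) * h)%C with (- (h * (h * / (s + s'))) * / (2 * s * (s + s')))%C.
  2:{ rewrite <- e2. rewrite e1. field. split; trivial. }
  assert (hden : (2 * s * (s + s'))%C <> 0).
  { repeat apply Cmult_neq_0; trivial. intros e. apply RtoC_inj in e. lra. }
  assert (E : Cmod (- (h * (h * / (s + s'))) * / (2 * s * (s + s')))%C
    = Cmod h * (Cmod h * / Cmod (s + s')) * / (2 * Cmod s * Cmod (s + s'))).
  { rewrite Cmod_mult, Cmod_opp, (Cmod_inv _ hden), !Cmod_mult, (Cmod_inv _ hne), Cmod_R, (Rabs_right 2); lra. }
  rewrite E.
  pose proof (Cmod_ge_0 h) as hh0.
  rewrite Rmult_assoc, (Rmult_comm eps). apply Rmult_le_compat_l; trivial.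
  assert (hi : 0 < / Cmod (s + s') <= / a).
  { split; [apply Rinv_0_lt_compat; lra|]. apply Rinv_le_contravar; lra. }
  assert (hj : 0 < / (2 * Cmod s * Cmod (s + s')) <= / (2 * a * a)).
  { split; [apply Rinv_0_lt_compat; nra|]. apply Rinv_le_contravar; [nra|].
    apply Rmult_le_compat; lra. }
  apply Rle_trans with (2 * eps * a ^ 3 * / a * / (2 * a * a)).
  - apply Rmult_le_compat; try lra; [|apply Rmult_le_compat; lra].
    apply Rmult_le_pos; lra.
  - apply Req_le. field. lra.
Qed.

(** * Rules of differentiation in several variables *)

Definition sdiff (n : nat) (f : Vec -> C) (z : Vec) : Prop := exists a, sderiv n f z a.

Lemma sdiff_const n k z : sdiff n (fun _ => k) z.
Proof.
  exists (fun _ => RtoC 0). eapply expands_sderiv; [apply (expands_const _ _ (vnorm_ge0 n) k)|].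
  intros h _. symmetry. apply csum_zero. intros. ring.
Qed.

Lemma sderiv_coord n i z : (i < n)%nat ->
  sderiv n (fun w => w i) z (fun k => if (k =? i)%nat then RtoC 1 else RtoC 0).
Proof.
  intros hi. apply sderiv_intro. intros eps he. exists 1. split; [lra|]. intros h _ _.
  rewrite (csum_single n i); trivial.
  - rewrite Nat.eqb_refl. unfold vadd. change Cadd with Cplus.
    replace (z i + h i - z i - 1 * h i)%C with (RtoC 0) by ring. rewrite Cmod_0.
    pose proof (vnorm_ge0 n h). nra.
  - intros k _ hk. apply Nat.eqb_neq in hk as ->. ring.
Qed.

Lemma sdiff_coord n i z : (i < n)%nat -> sdiff n (fun w => w i) z.
Proof. intros hi. eexists. now apply sderiv_coord. Qed.

Lemma sdiff_plus n f g z : sdiff n f z -> sdiff n g z -> sdiff n (fun w => f w + g w)%C z.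
Proof.
  intros [a ha] [b hb]. exists (fun i => a i + b i)%C.
  eapply expands_sderiv; [exact (expands_plus _ _ _ _ _ _ _ _ ha hb)|].
  intros h _. simpl. rewrite <- csum_plus. apply csum_ext. intros. ring.
Qed.

Lemma sdiff_mult n f g z : sdiff n f z -> sdiff n g z -> sdiff n (fun w => f w * g w)%C z.
Proof.
  intros [a ha] [b hb]. exists (fun i => f z * b i + g z * a i)%C.
  eapply expands_sderiv; [exact (expands_mult _ _ (vnorm_ge0 n) _ _ _ _ _ _ ha hb)|].
  intros h _. simpl. rewrite <- !csum_scal, <- csum_plus. apply csum_ext. intros. ring.
Qed.

Lemma sdiff_comp n (g : C -> C) f z l : cderiv g (f z) l -> sdiff n f z -> sdiff n (fun w => g (f w)) z.
Proof.
  intros hg [a ha]. exists (fun i => l * a i)%C.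
  eapply expands_sderiv; [exact (expands_comp _ _ _ _ _ _ _ hg ha)|].
  intros h _. simpl. rewrite <- !csum_scal. apply csum_ext. intros. ring.
Qed.

Lemma sdiff_pow n f z k : sdiff n f z -> sdiff n (fun w => f w ^ k)%C z.
Proof.
  intros hf. destruct (cderiv_pow (fun w => w) (f z) 1 k (cderiv_id (f z))) as [l hl].
  exact (sdiff_comp n (fun w => w ^ k)%C f z l hl hf).
Qed.

Lemma sdiff_csum n k (f : nat -> Vec -> C) z :
  (forall i, (i < k)%nat -> sdiff n (f i) z) -> sdiff n (fun w => csum k (fun i => f i w)) z.
Proof.
  induction k; intros H; [exact (sdiff_const n (RtoC 0) z)|].
  apply (sdiff_plus n (fun w => csum k (fun i => f i w)) (f k)); auto.
Qed.

(* The component z_0^j z_i has index n j + i; the last r components repeat, multiplied by the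
   imaginary unit, the linear components z_1, ..., z_r.  On the sphere the squared norms add up
   to 1: they telescope in powers of |z_0|^2. *)
Definition hweight (d r j i : nat) : R :=
  if (i =? 0)%nat then / INR d
  else if ((j =? 0)%nat && (i <=? r)%nat)%bool then / 2 else (INR d - INR j) / INR d.

Definition hmap (n d r : nat) (z : Vec) (t : nat) : C :=
  if (t <? n * d)%nat
  then (sqrt (hweight d r (t / n) (t mod n)) * z 0%nat ^ (t / n) * z (t mod n)%nat)%C
  else (sqrt (/ 2) * Ci * z (S (t - n * d)))%C.

Definition Fmap (n d r : nat) (z : Vec) : Vec := fun t =>
  if (t <? n * d + r)%nat then hmap n d r z t
  else if (t =? n * d + r)%nat
  then (1 - csqrt (1 - cdot (n * d + r) (hmap n d r z) (hmap n d r z)))%C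
  else C0.

Lemma Cnorm2_pow (w : C) (k : nat) : Cnorm2 (w ^ k)%C = Cnorm2 w ^ k.
Proof.
  induction k; [unfold Cnorm2; simpl; ring|]. simpl. rewrite Cnorm2_mult, IHk. reflexivity.
Qed.

Lemma Cnorm2_sqrt (x : R) : 0 <= x -> Cnorm2 (RtoC (sqrt x)) = x.
Proof. intros hx. unfold Cnorm2; simpl. rewrite Rmult_0_r, Rplus_0_r. now apply sqrt_sqrt. Qed.

Lemma rsum_telescope (f : nat -> R) (k : nat) : rsum k (fun j => f j - f (S j)) = f O - f k.
Proof. induction k; simpl; [ring|]. rewrite IHk. ring. Qed.

Lemma ball_first (n : nat) (z : Vec) : (1 <= n)%nat -> Ball n z -> 0 <= Cnorm2 (z 0%nat) <= 1.
Proof.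
  intros hn [_ hz]. split; [apply Cnorm2_ge0|].
  pose proof (rsum_term_le n (fun i => Cnorm2 (z i)) 0 (fun i _ => Cnorm2_ge0 (z i)) hn).
  unfold vnorm2 in hz. lra.
Qed.

Definition axis (x : R) : Vec := fun i => if (i =? 0)%nat then RtoC x else C0.

Lemma axis_ball (n : nat) (x : R) : (1 <= n)%nat -> 0 <= x < 1 -> Ball n (axis x).
Proof.
  intros hn hx. split.
  - intros i hi. unfold axis. rewrite (proj2 (Nat.eqb_neq _ _)) by lia. reflexivity.
  - unfold vnorm2. rewrite (rsum_single n 0); [|lia|].
    + unfold axis, Cnorm2; simpl. nra.
    + intros i _ hi. unfold axis. apply Nat.eqb_neq in hi as ->. unfold Cnorm2; simpl. ring.
Qed.

(** The factor in 1 - |h|^2 = psum (1 - |z|^2), taken at X = |z_0|^2. Its lower bound 1 keeps h in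
    the ball, its upper bound d gives properness. *)
Definition psum (d : nat) (X : R) : R := rsum d (fun j => (INR d - INR j) / INR d * X ^ j).

Lemma psum_bounds (d : nat) (X : R) : (1 <= d)%nat -> 0 <= X <= 1 -> 1 <= psum d X <= INR d.
Proof.
  intros hd hX. assert (INRd : 1 <= INR d) by exact (le_INR 1 d hd). split.
  - unfold psum. replace 1 with ((INR d - INR 0) / INR d * X ^ 0) at 1 by (simpl; field; lra).
    apply (rsum_term_le d (fun j => (INR d - INR j) / INR d * X ^ j)); [|lia].
    intros j hj. apply lt_INR in hj. apply Rmult_le_pos; [|apply pow_le; lra].
    apply Rlt_le, Rdiv_lt_0_compat; lra.
  - apply Rle_trans with (rsum d (fun _ => 1)); [|rewrite rsum_const; lra]. apply rsum_le.
    intros j hj. apply lt_INR in hj. pose proof (pos_INR j).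
    assert (h1 : 0 < (INR d - INR j) / INR d) by (apply Rdiv_lt_0_compat; lra).
    assert (h2 : (INR d - INR j) / INR d <= 1) by (apply Rmult_le_reg_r with (INR d); [lra|]; unfold Rdiv; rewrite Rmult_assoc, Rinv_l; lra).
    assert (h3 : 0 <= X ^ j) by (apply pow_le; lra).
    assert (h4 : X ^ j <= 1) by (rewrite <- (pow1 j); apply pow_incr; lra).
    nra.
Qed.

(** * Norm identities, holomorphy and real points of the map *)

Section Construction.
Context (n d r : nat) (hn : (1 <= n)%nat) (hd : (1 <= d)%nat) (hr : (r < n)%nat).

Let N := (n * d + r)%nat.
Let h := hmap n d r.
Let F := Fmap n d r.

Let INRd : 1 <= INR d.
Proof. apply (le_INR 1). exact hd. Qed.

Lemma index_div_mod j i : (i < n)%nat -> ((n * j + i) / n = j /\ (n * j + i) mod n = i)%nat.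
Proof.
  intros hi. split.
  - symmetry. now apply Nat.div_unique with i.
  - symmetry. now apply Nat.mod_unique with j.
Qed.

Lemma hmap_main z j i : (j < d)%nat -> (i < n)%nat ->
  h z (n * j + i)%nat = (sqrt (hweight d r j i) * z 0%nat ^ j * z i)%C.
Proof.
  intros hj hi. unfold h, hmap. destruct (index_div_mod j i hi) as [-> ->].
  rewrite (proj2 (Nat.ltb_lt _ _)) by nia. reflexivity.
Qed.

Lemma hmap_extra z e : h z (n * d + e)%nat = (sqrt (/ 2) * Ci * z (S e))%C.
Proof.
  unfold h, hmap. rewrite (proj2 (Nat.ltb_ge _ _)) by lia.
  now replace (n * d + e - n * d)%nat with e by lia.
Qed.

Lemma hweight_pos j i : (j < d)%nat -> 0 < hweight d r j i.
Proof.
  intros hj. unfold hweight.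
  destruct (i =? 0)%nat; [apply Rinv_0_lt_compat; lra|].
  destruct ((j =? 0)%nat && (i <=? r)%nat)%bool; [lra|].
  apply Rdiv_lt_0_compat; [|lra]. apply lt_INR in hj. lra.
Qed.

Lemma rsum_shift (f : nat -> R) :
  rsum n (fun i => if (i =? 0)%nat then 0 else if (i <=? r)%nat then f i else 0) = rsum r (fun e => f (S e)).
Proof.
  set (g := fun i => if (i =? 0)%nat then 0 else if (i <=? r)%nat then f i else 0).
  replace n with ((1 + r) + (n - 1 - r))%nat by lia.
  rewrite !rsum_add.
  replace (rsum 1 g) with 0 by (unfold g; simpl; ring).
  rewrite (rsum_ext (n - 1 - r) _ (fun _ => 0)), rsum_const.
  - rewrite (rsum_ext r _ (fun e => f (S e))); [ring|].
    intros e he. unfold g. simpl (1 + e)%nat. rewrite (proj2 (Nat.leb_le (S e) r)) by lia. reflexivity.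
  - intros e he. unfold g. rewrite (proj2 (Nat.eqb_neq _ _)), (proj2 (Nat.leb_gt _ _)) by lia. reflexivity.
Qed.

(** Let a_j = (d - j) / d X^j. The weight 1/d of z_0^(j+1) is chosen so that a_j X - X^(j+1) / d =
    a_(j+1); row j then contributes a_j |z|^2 - a_(j+1), with a_0 = 1 and a_d = 0. What the weights
    1/2 remove from row 0 is restored by the repeated components. *)
Lemma hmap_norm z : vnorm2 N (h z) = 1 - psum d (Cnorm2 (z 0%nat)) * (1 - vnorm2 n z).
Proof.
  set (X := Cnorm2 (z 0%nat)). set (S := vnorm2 n z).
  set (T := rsum r (fun e => Cnorm2 (z (Datatypes.S e)))).
  unfold vnorm2 at 1. unfold N. rewrite rsum_add, rsum_mul.
  rewrite (rsum_ext r _ (fun e => / 2 * Cnorm2 (z (Datatypes.S e)))).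
  2:{ intros e he. rewrite hmap_extra, !Cnorm2_mult, Cnorm2_sqrt by lra.
      unfold Cnorm2 at 1; simpl. ring. }
  rewrite rsum_scal. fold T.
  set (a := fun j => (INR d - INR j) / INR d * X ^ j).
  rewrite (rsum_ext d _ (fun j => (a j * S - a (Datatypes.S j)) + (if (j =? 0)%nat then - / 2 * T else 0))).
  - rewrite rsum_plus, (rsum_single d 0 (fun j => if (j =? 0)%nat then _ else _)); [|lia|intros i _ hi; now apply Nat.eqb_neq in hi as ->].
    rewrite Nat.eqb_refl.
    rewrite (rsum_ext d _ (fun j => (a j - a (Datatypes.S j)) + (S - 1) * a j)) by (intros; ring).
    rewrite rsum_plus, rsum_telescope, rsum_scal. fold (psum d X).
    replace (a O) with 1 by (unfold a; simpl; field; lra).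
    replace (a d) with 0 by (unfold a; field; lra). change (rsum d a) with (psum d X). ring.
  - intros j hj.
    rewrite (rsum_ext n _ (fun i => (a j * Cnorm2 (z i) + (if (i =? 0)%nat then - a (Datatypes.S j) else 0))
       + (- / 2 * (if (j =? 0)%nat then 1 else 0)) * (if (i =? 0)%nat then 0 else if (i <=? r)%nat then Cnorm2 (z i) else 0))).
    + rewrite rsum_plus, rsum_plus, !rsum_scal, rsum_shift. fold T. fold (vnorm2 n z). fold S.
      rewrite (rsum_single n 0 (fun i => if (i =? 0)%nat then _ else _)); [|lia|intros i _ hi; now apply Nat.eqb_neq in hi as ->].
      rewrite Nat.eqb_refl. destruct (j =? 0)%nat; ring.
    + intros i hi. rewrite hmap_main by trivial. pose proof (hweight_pos j i hj) as hw.
      rewrite !Cnorm2_mult, Cnorm2_pow, Cnorm2_sqrt by lra. fold X. unfold hweight, a in *.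
      rewrite S_INR.
      destruct (Nat.eqb_spec i 0) as [->|hi0].
      * fold X. simpl pow. field. lra.
      * destruct (Nat.eqb_spec j 0) as [->|hj0]; simpl andb.
        -- destruct (i <=? r)%nat; simpl; field; lra.
        -- cbv iota. ring.
Qed.

Lemma hmap_ball z : Ball n z -> vnorm2 N (h z) < 1.
Proof.
  intros hz. rewrite hmap_norm. pose proof (psum_bounds d _ hd (ball_first n z hn hz)). destruct hz as [_ hz]. nra.
Qed.

Lemma hmap_sq_lt z : Ball n z -> Cmod (cdot N (h z) (h z)) < 1.
Proof.
  intros hz. eapply Rle_lt_trans; [apply cauchy_schwarz|]. rewrite vnorm_sqr. now apply hmap_ball.
Qed.

Lemma hmap_sq_re z : Ball n z -> 0 < Re (1 - cdot N (h z) (h z)).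
Proof.
  intros hz. pose proof (hmap_sq_lt z hz) as hl.
  pose proof (re_le_Cmod (cdot N (h z) (h z))) as hl'. apply Rabs_le_between in hl'.
  change (Re (1 - cdot N (h z) (h z))) with (1 + - Re (cdot N (h z) (h z))). lra.
Qed.

Definition Flast (z : Vec) : C := (1 - csqrt (1 - cdot N (h z) (h z)))%C.

Lemma Fmap_lt z t : (t < N)%nat -> F z t = h z t.
Proof. intros ht. unfold F, Fmap. fold N. now apply Nat.ltb_lt in ht as ->. Qed.

Lemma Fmap_last z : F z N = Flast z.
Proof. unfold F, Fmap. fold N. now rewrite Nat.ltb_irrefl, Nat.eqb_refl. Qed.

Lemma Fmap_supported z : supported (S N) (F z).
Proof.
  intros t ht. unfold F, Fmap. fold N.
  rewrite (proj2 (Nat.ltb_ge _ _)), (proj2 (Nat.eqb_neq _ _)) by lia. reflexivity.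
Qed.

Lemma Fmap_cdot (c : nat -> C) z : cdot (S N) c (F z) = (cdot N c (h z) + c N * Flast z)%C.
Proof.
  unfold cdot at 1. rewrite csum_S, Fmap_last. f_equal. apply csum_ext. intros t ht. now rewrite Fmap_lt.
Qed.

Lemma Flast_eq z : Ball n z -> (cdot N (h z) (h z) + Flast z * Flast z)%C = (2 * Flast z)%C.
Proof.
  intros hz. pose proof (csqrt_sqr _ (hmap_sq_re z hz)) as e. unfold Flast.
  set (s := csqrt (1 - cdot N (h z) (h z))) in *.
  replace (cdot N (h z) (h z)) with (1 - s * s)%C by (rewrite e; ring). ring.
Qed.

(** With s the square root, h h^t = (1 - s) (1 + s) has modulus below 1, and Re s > 0 gives |1 + s|
    >= 1. Together with |h| < 1 this yields |F|^2 < 2. *)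
Lemma Flast_lt z : Ball n z -> Cmod (Flast z) < 1.
Proof.
  intros hz. pose proof (csqrt_sqr _ (hmap_sq_re z hz)) as e.
  pose proof (csqrt_re_pos _ (hmap_sq_re z hz)) as hp. pose proof (hmap_sq_lt z hz) as hl.
  unfold Flast. set (s := csqrt (1 - cdot N (h z) (h z))) in *.
  assert (e' : cdot N (h z) (h z) = ((1 - s) * (1 + s))%C).
  { replace ((1 - s) * (1 + s))%C with (1 - s * s)%C by ring. rewrite e. ring. }
  rewrite e', Cmod_mult in hl.
  assert (1 <= Cmod (1 + s)).
  { eapply Rle_trans; [|apply re_le_Cmod]. eapply Rle_trans; [|apply Rle_abs].
    change (Re (1 + s)) with (1 + Re s). lra. }
  pose proof (Cmod_ge_0 (1 - s)). nra.
Qed.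

Lemma Fmap_norm z : vnorm2 (S N) (F z) = vnorm2 N (h z) + Cnorm2 (Flast z).
Proof.
  unfold vnorm2. simpl. rewrite Fmap_last. f_equal. apply rsum_ext. intros t ht. now rewrite Fmap_lt.
Qed.

Lemma Fmap_sq z : Ball n z -> cdot (S N) (F z) (F z) = (2 * Flast z)%C.
Proof.
  intros hz. rewrite <- Flast_eq by trivial. unfold cdot at 1. rewrite csum_S, Fmap_last. f_equal.
  apply csum_ext. intros t ht. now rewrite Fmap_lt.
Qed.

(** Squaring the root gives F F^t = 2 f for the last component f, so |F F^t|^2 / 4 cancels the |f|^2
    in |F|^2. *)
Lemma Fmap_defining z : Ball n z ->
  1 - vnorm2 (S N) (F z) + / 4 * Cnorm2 (cdot (S N) (F z) (F z))
    = psum d (Cnorm2 (z 0%nat)) * (1 - vnorm2 n z).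
Proof.
  intros hz. rewrite Fmap_norm, Fmap_sq, Cnorm2_mult, hmap_norm by trivial.
  replace (Cnorm2 (RtoC 2)) with 4 by (unfold Cnorm2; simpl; ring). field.
Qed.

Lemma Fmap_DIV z : Ball n z -> DIV (S N) (F z).
Proof.
  intros hz. apply DIV_sq. split; [apply Fmap_supported|]. split.
  - rewrite Fmap_norm, Cnorm2_Cmod. pose proof (hmap_ball z hz). pose proof (Flast_lt z hz).
    pose proof (Cmod_ge_0 (Flast z)). nra.
  - rewrite Fmap_defining by trivial. pose proof (psum_bounds d _ hd (ball_first n z hn hz)). destruct hz as [_ hz]. nra.
Qed.

Lemma hmap_sdiff z t : (t < N)%nat -> sdiff n (fun w => h w t) z.
Proof.
  intros ht. unfold N in ht. unfold h, hmap. destruct (Nat.ltb_spec t (n * d)).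
  - apply sdiff_mult; [apply sdiff_mult|].
    + apply sdiff_const.
    + apply sdiff_pow, sdiff_coord. lia.
    + apply sdiff_coord. apply Nat.mod_upper_bound. lia.
  - apply sdiff_mult; [apply sdiff_const|]. apply sdiff_coord. lia.
Qed.

Lemma Fmap_sdiff z t : Ball n z -> (t < S N)%nat -> sdiff n (fun w => F w t) z.
Proof.
  intros hz ht. unfold F, Fmap. fold N. destruct (Nat.ltb_spec t N) as [h1|h1].
  - now apply hmap_sdiff.
  - replace (t =? N)%nat with true by (symmetry; apply Nat.eqb_eq; lia).
    assert (hq : sdiff n (fun w => 1 - cdot N (h w) (h w))%C z).
    { apply sdiff_plus; [apply sdiff_const|].
      destruct (sdiff_mult n (fun _ => (- (1))%C) (fun w => cdot N (h w) (h w)) z) as [a ha].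
      - apply sdiff_const.
      - apply sdiff_csum. intros i hi. apply sdiff_mult; now apply hmap_sdiff.
      - exists a. eapply expands_ext; [exact ha| | |reflexivity].
        + exists 1. split; [lra|]. intros; ring.
        + ring. }
    pose proof (sdiff_comp n csqrt (fun w => 1 - cdot N (h w) (h w))%C z _ (cderiv_csqrt _ (hmap_sq_re z hz)) hq) as hs.
    destruct (sdiff_plus n _ _ z (sdiff_const n 1 z) (sdiff_mult n _ _ z (sdiff_const n (- (1))%C z) hs)) as [a ha].
    exists a. eapply expands_ext; [exact ha| | |reflexivity].
    + exists 1. split; [lra|]. intros; fold h; ring.
    + fold h; ring.
Qed.

Lemma Fmap_holomorphic : holomorphic n (S N) (Ball n) F.
Proof. apply sderiv_holomorphic. intros z hz j hj. now apply Fmap_sdiff. Qed.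

Lemma Fmap_holo_map : holo_map n (Ball n) (S N) (DIV (S N)) F.
Proof. split; [apply Fmap_holomorphic|apply Fmap_DIV]. Qed.

Lemma hmap_axis_main x j i : (j < d)%nat -> (i < n)%nat ->
  h (axis x) (n * j + i)%nat = RtoC (if (i =? 0)%nat then sqrt (/ INR d) * x ^ S j else 0).
Proof.
  intros hj hi. rewrite hmap_main by trivial. unfold axis, hweight. rewrite Nat.eqb_refl.
  destruct (i =? 0)%nat.
  - rewrite RtoC_mult, RtoC_pow. simpl. ring.
  - apply injective_projections; simpl; ring.
Qed.

Lemma hmap_axis_extra x e : h (axis x) (n * d + e)%nat = 0.
Proof. rewrite hmap_extra. unfold axis. simpl. apply injective_projections; simpl; ring. Qed.

Lemma hmap_axis_cdot (c : nat -> C) x :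
  cdot N c (h (axis x)) = csum d (fun j => c (n * j)%nat * RtoC (sqrt (/ INR d) * x ^ S j))%C.
Proof.
  unfold cdot, N. rewrite csum_add, csum_mul, (csum_zero r).
  2:{ intros e _. rewrite hmap_axis_extra. ring. }
  rewrite Cplus_0_r. apply csum_ext. intros j hj. rewrite (csum_single n 0); [|lia|].
  - rewrite hmap_axis_main by (trivial; lia). simpl Nat.eqb. rewrite Nat.add_0_r. reflexivity.
  - intros i hi hne. rewrite hmap_axis_main by trivial. apply Nat.eqb_neq in hne as ->. ring.
Qed.

Lemma hmap_axis_sq x :
  cdot N (h (axis x)) (h (axis x)) = RtoC (rsum d (fun j => / INR d * x ^ (2 * S j))).
Proof.
  rewrite hmap_axis_cdot, <- csum_RtoC. apply csum_ext. intros j hj.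
  rewrite <- (Nat.add_0_r (n * j)) at 1. rewrite hmap_axis_main by (trivial; lia). simpl Nat.eqb.
  rewrite <- RtoC_mult. f_equal.
  transitivity (sqrt (/ INR d) * sqrt (/ INR d) * (x ^ S j * x ^ S j)); [ring|].
  rewrite sqrt_sqrt by (apply Rlt_le, Rinv_0_lt_compat; lra). rewrite <- pow_add. do 2 f_equal. lia.
Qed.

(** The components with the factor i involve only z_1, ..., z_r and vanish on the axis; the others
    are real there. These are the real points at which the involution is known to be linear. *)
Lemma Fmap_axis_real x t : Im (F (axis x) t) = 0.
Proof.
  unfold F, Fmap. fold N h. destruct (Nat.ltb_spec t N) as [ht|ht].
  - unfold N in ht. destruct (Compare_dec.lt_dec t (n * d)) as [h1|h1].
    + rewrite (Nat.div_mod_eq t n), hmap_axis_main; [reflexivity| |].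
      * apply Nat.Div0.div_lt_upper_bound. lia.
      * apply Nat.mod_upper_bound. lia.
    + replace t with (n * d + (t - n * d))%nat by lia. now rewrite hmap_axis_extra.
  - destruct (t =? N)%nat; [|reflexivity]. rewrite hmap_axis_sq. unfold csqrt, Im; simpl.
    unfold Rdiv. ring.
Qed.

Lemma Fmap_0 : F (fun _ => C0) = fun _ => C0.
Proof.
  assert (hz : Ball n (fun _ => C0)).
  { replace (fun _ : nat => C0) with (axis 0); [apply axis_ball; [exact hn|lra]|].
    apply functional_extensionality. intros i. unfold axis. now destruct (i =? 0)%nat. }
  assert (h0 : forall t, h (fun _ => C0) t = 0).
  { intros t. unfold h, hmap. destruct (t <? n * d)%nat; apply injective_projections; simpl; ring. }
  apply functional_extensionality. intros t. unfold F, Fmap. fold N h.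
  destruct (t <? N)%nat; [apply h0|]. destruct (t =? N)%nat; [|reflexivity].
  replace (cdot N (h (fun _ => C0)) (h (fun _ => C0))) with (RtoC 0).
  - replace (1 - 0)%C with (RtoC 1) by ring. unfold csqrt. rewrite Cmod_1. simpl.
    replace ((1 + 1) / 2) with 1 by field. rewrite sqrt_1. apply injective_projections; simpl; field.
  - symmetry. apply csum_zero. intros t' _. rewrite h0. ring.
Qed.
End Construction.

(** * Compactness and properness *)

(** Doubling by recursion, so that a tuple of length [double (S k)] unfolds to two real coordinates
    followed by a tuple of length [double k]; C^n is thus read as R^(2n). *)
Fixpoint double (n : nat) : nat := match n with O => O | S k => S (S (double k)) end.

Fixpoint tuple_of_vec (n : nat) (z : Vec) : Compactness.Tn (double n) R :=
  match n with
  | O => tt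
  | S k => (Re (z O), (Im (z O), tuple_of_vec k (fun i => z (S i))))
  end.

Fixpoint vec_of_tuple (n : nat) : Compactness.Tn (double n) R -> Vec :=
  match n with
  | O => fun _ _ => C0
  | S k => fun t i => match i with
                      | O => (fst t, fst (snd t))
                      | S j => vec_of_tuple k (snd (snd t)) j
                      end
  end.

Fixpoint const_tuple (n : nat) (a : R) : Compactness.Tn n R :=
  match n with O => tt | S k => (a, const_tuple k a) end.

Lemma vec_of_tuple_supported (n : nat) t : supported n (vec_of_tuple n t).
Proof.
  induction n; intros i hi; [reflexivity|]. destruct i; [lia|]. simpl. apply IHn. lia.
Qed.

Lemma tuple_of_vec_bounded (n : nat) (z : Vec) :
  (forall i, (i < n)%nat -> Cmod (z i) <= 1) ->
  bounded_n (double n) (const_tuple _ (-1)) (const_tuple _ 1) (tuple_of_vec n z).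
Proof.
  revert z. induction n; intros z H; [exact I|]. simpl.
  pose proof (H O ltac:(lia)) as h0. pose proof (re_le_Cmod (z O)) as h1. pose proof (im_le_Cmod (z O)) as h2.
  split; [apply Rabs_le_between; lra|]. split; [apply Rabs_le_between; lra|].
  apply IHn. intros i hi. apply H. lia.
Qed.

Lemma tuple_of_vec_close (n : nat) (d : R) (z : Vec) t :
  close_n (double n) d (tuple_of_vec n z) t ->
  rsum n (fun i => Cmod (vsub z (vec_of_tuple n t) i)) <= INR n * (2 * d).
Proof.
  revert z t. induction n; intros z t H; [simpl; lra|].
  destruct t as [a [b t]]. simpl in H. destruct H as (h1 & h2 & h3).
  rewrite rsum_S_l, S_INR.
  assert (IH' : rsum n (fun i => Cmod (vsub z (vec_of_tuple (S n) (a, (b, t))) (S i))) <= INR n * (2 * d))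
    by exact (IHn _ _ h3).
  assert (h : Cmod (vsub z (vec_of_tuple (S n) (a, (b, t))) O) <= 2 * d).
  { eapply Rle_trans; [apply Cmod_le_Re_Im|]. unfold vsub, Csub; simpl. unfold Re, Im in *. lra. }
  replace ((INR n + 1) * (2 * d)) with (2 * d + INR n * (2 * d)) by ring.
  now apply Rplus_le_compat.
Qed.

Lemma heine_borel (n : nat) (delta : Vec -> R) :
  (forall t, 0 < delta t) ->
  exists l : list Vec, forall z, supported n z -> vnorm2 n z <= 1 ->
    exists t, In t l /\ supported n t /\ vnorm n (vsub z t) < delta t.
Proof.
  intros hd.
  (* Closeness within e in each real coordinate bounds the norm by 2 n e. The + 1 keeps the division
     valid for n = 0 and the final inequality strict. *)
  assert (hp : forall t, 0 < delta t / (2 * INR n + 1)).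
  { intros t. pose proof (pos_INR n). apply Rdiv_lt_0_compat; [apply hd|lra]. }
  pose (gauge := fun t => mkposreal _ (hp (vec_of_tuple n t))).
  pose proof (NNPP _ (compactness_list (double n) (const_tuple _ (-1)) (const_tuple _ 1) gauge)) as [l Hl].
  exists (map (vec_of_tuple n) l). intros z hs hz.
  destruct (Hl (tuple_of_vec n z)) as (t & ht & _ & hc).
  { apply tuple_of_vec_bounded. intros i hi. eapply Rle_trans; [apply (Cmod_le_vnorm n z i hi)|].
    rewrite <- sqrt_1. now apply sqrt_le_1_alt. }
  exists (vec_of_tuple n t). split; [now apply in_map|]. split; [apply vec_of_tuple_supported|].
  eapply Rle_lt_trans; [apply vnorm_le_sum|]. eapply Rle_lt_trans; [apply (tuple_of_vec_close n _ z t hc)|].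
  unfold gauge; simpl. pose proof (pos_INR n). specialize (hd (vec_of_tuple n t)).
  apply Rmult_lt_reg_r with (2 * INR n + 1); [lra|].
  replace (INR n * (2 * (delta (vec_of_tuple n t) / (2 * INR n + 1))) * (2 * INR n + 1))
    with (2 * INR n * delta (vec_of_tuple n t)) by (field; lra).
  lra.
Qed.

(** Each point t gets a radius: inside a member of the cover if P t, missing P otherwise. Finitely
    many of these balls cover the closed unit ball, and those centred outside P contain no point of
    P. *)
Lemma closed_in_ball_compact (n : nat) (P : Vec -> Prop) :
  (forall z, P z -> supported n z /\ vnorm2 n z <= 1) ->
  (forall t, supported n t -> ~ P t -> exists r, r > 0 /\
     forall y, supported n y -> vnorm n (vsub y t) < r -> ~ P y) ->
  Defs.compact n P.
Proof.
  intros HP Hcl. split; [intros; now apply HP|].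
  intros I O HO Hcov.
  assert (H : forall t, exists r, 0 < r /\ (supported n t ->
     (P t -> exists i, forall y, supported n y -> vnorm n (vsub y t) < r -> O i y) /\
     (~ P t -> forall y, supported n y -> vnorm n (vsub y t) < r -> ~ P y))).
  { intros t. destruct (classic (supported n t)) as [hs|hs]; [|exists 1; split; [lra|contradiction]].
    destruct (classic (P t)) as [hp|hp].
    - destruct (Hcov t hp) as [i hi]. destruct (HO i t hi) as (r & hr & Hr).
      exists r. split; trivial. intros _. split; [|contradiction]. intros _. now exists i.
    - destruct (Hcl t hs hp) as (r & hr & Hr). exists r. split; trivial. intros _. split; [contradiction|].
      intros _. exact Hr. }
  pose (delta := fun t => proj1_sig (constructive_indefinite_description _ (H t))).
  assert (Hdelta : forall t, 0 < delta t /\ (supported n t ->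
     (P t -> exists i, forall y, supported n y -> vnorm n (vsub y t) < delta t -> O i y) /\
     (~ P t -> forall y, supported n y -> vnorm n (vsub y t) < delta t -> ~ P y))).
  { intros t. unfold delta. destruct constructive_indefinite_description as [r h]. exact h. }
  destruct (heine_borel n delta) as [l Hl]; [intros; apply Hdelta|].
  assert (HL : exists L, forall t, In t l -> supported n t -> P t ->
     exists i, In i L /\ forall y, supported n y -> vnorm n (vsub y t) < delta t -> O i y).
  { clear Hl. induction l as [|a l [L IH]]; [exists nil; contradiction|].
    destruct (classic (supported n a /\ P a)) as [[ha hpa]|hna].
    - destruct (proj1 (proj2 (Hdelta a) ha) hpa) as [i hi]. exists (i :: L).
      intros t [<-|ht] hs hp; [exists i; split; [now left|trivial]|].
      destruct (IH t ht hs hp) as (i' & hi' & Hi'). exists i'. split; [now right|trivial].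
    - exists L. intros t [<-|ht] hs hp; [tauto|]. now apply IH. }
  destruct HL as [L HL]. exists L. intros z hz.
  destruct (HP z hz) as [hs hb]. destruct (Hl z hs hb) as (t & ht & hts & hzt).
  destruct (classic (P t)) as [hp|hp].
  - destruct (HL t ht hts hp) as (i & hi & Hi). exists i. split; trivial. now apply Hi.
  - exfalso. exact (proj2 (proj2 (Hdelta t) hts) hp z hs hzt hz).
Qed.

(** * Continuity of the defining functions and openness of the domains *)

Definition rcontinuous (n : nat) (f : Vec -> R) (z : Vec) : Prop :=
  forall eps, eps > 0 -> exists delta, delta > 0 /\
    forall y, supported n y -> vnorm n (vsub y z) < delta -> Rabs (f y - f z) < eps.

Lemma rcontinuous_const n k z : rcontinuous n (fun _ => k) z.
Proof.
  intros eps he. exists 1. split; [lra|]. intros y _ _. rewrite Rminus_diag, Rabs_R0. exact he.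
Qed.

Lemma rcontinuous_plus n f g z :
  rcontinuous n f z -> rcontinuous n g z -> rcontinuous n (fun y => f y + g y) z.
Proof.
  intros Hf Hg eps he. destruct (Hf (eps / 2)) as (d & hd & Hd); [lra|].
  destruct (Hg (eps / 2)) as (d' & hd' & Hd'); [lra|].
  exists (Rmin d d'). split; [now apply Rmin_pos|]. intros y hs hy.
  pose proof (Hd y hs (Rlt_le_trans _ _ _ hy (Rmin_l _ _))) as h1.
  pose proof (Hd' y hs (Rlt_le_trans _ _ _ hy (Rmin_r _ _))) as h2.
  apply Rabs_lt_between in h1. apply Rabs_lt_between in h2. apply Rabs_lt_between. lra.
Qed.

Lemma rcontinuous_scal n k f z : rcontinuous n f z -> rcontinuous n (fun y => k * f y) z.
Proof.
  intros Hf eps he. pose proof (Rabs_pos k).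
  destruct (Hf (eps / (Rabs k + 1))) as (d & hd & Hd); [apply Rdiv_lt_0_compat; lra|].
  exists d. split; trivial. intros y hs hy. specialize (Hd y hs hy).
  rewrite <- Rmult_minus_distr_l, Rabs_mult. pose proof (Rabs_pos (f y - f z)).
  apply (Rmult_lt_compat_l (Rabs k + 1)) in Hd; [|lra].
  replace ((Rabs k + 1) * (eps / (Rabs k + 1))) with eps in Hd by (field; lra). nra.
Qed.

Lemma rcontinuous_rsum n k (f : nat -> Vec -> R) z :
  (forall i, (i < k)%nat -> rcontinuous n (f i) z) -> rcontinuous n (fun y => rsum k (fun i => f i y)) z.
Proof.
  induction k; intros H; [exact (rcontinuous_const n 0 z)|].
  apply (rcontinuous_plus n (fun y => rsum k (fun i => f i y)) (f k)); auto.
Qed.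

Lemma rcontinuous_Cnorm2 n (g : Vec -> C) z :
  supported n z -> sdiff n g z -> rcontinuous n (fun y => Cnorm2 (g y)) z.
Proof.
  intros hs [a ha] eps he. pose proof (Cmod_ge_0 (g z)) as hg.
  set (e := Rmin 1 (eps / (2 * Cmod (g z) + 2))).
  assert (hep : 0 < e) by (apply Rmin_pos; [lra|apply Rdiv_lt_0_compat; lra]).
  assert (he1 : e <= 1) by apply Rmin_l.
  assert (he2 : e * (2 * Cmod (g z) + 2) <= eps).
  { apply Rle_trans with (eps / (2 * Cmod (g z) + 2) * (2 * Cmod (g z) + 2)).
    - apply Rmult_le_compat_r; [lra|apply Rmin_r].
    - apply Req_le. field. lra. }
  destruct (expands_small _ _ _ _ _ _ ha hep) as (d & hd & Hd).
  exists d. split; trivial. intros y hy hyz. specialize (Hd _ (supported_vsub n y z hy hs) hyz).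
  rewrite vadd_vsub in Hd. rewrite !Cnorm2_Cmod.
  pose proof (Cmod_ge_0 (g y)) as hgy.
  pose proof (Cmod_triangle (g z) (g y - g z)) as t1. replace (g z + (g y - g z))%C with (g y) in t1 by ring.
  pose proof (Cmod_triangle (g y) (- (g y - g z))) as t2. rewrite Cmod_opp in t2.
  replace (g y + - (g y - g z))%C with (g z) in t2 by ring.
  apply Rabs_lt_between. split; nra.
Qed.

Lemma rcontinuous_vnorm2 n m (F : Vec -> Vec) z :
  supported n z -> (forall i, (i < m)%nat -> sdiff n (fun y => F y i) z) ->
  rcontinuous n (fun y => vnorm2 m (F y)) z.
Proof.
  intros hs H. apply (rcontinuous_rsum n m (fun i y => Cnorm2 (F y i))).
  intros i hi. apply rcontinuous_Cnorm2; auto.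
Qed.

Lemma rcontinuous_vnorm2_sub n m (F : Vec -> Vec) z w :
  supported n z -> (forall i, (i < m)%nat -> sdiff n (fun y => F y i) z) ->
  rcontinuous n (fun y => vnorm2 m (vsub (F y) w)) z.
Proof.
  intros hs H. apply (rcontinuous_vnorm2 n m (fun y => vsub (F y) w)); trivial.
  intros i hi. apply (sdiff_plus n (fun y => F y i) (fun _ => Copp (w i))); auto. apply sdiff_const.
Qed.

Lemma rcontinuous_gt n f z k :
  rcontinuous n f z -> k < f z -> exists r, r > 0 /\
    forall y, supported n y -> vnorm n (vsub y z) < r -> k < f y.
Proof.
  intros Hf hk. destruct (Hf (f z - k)) as (r & hr & Hr); [lra|]. exists r. split; trivial.
  intros y hs hy. specialize (Hr y hs hy). apply Rabs_lt_between in Hr. lra.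
Qed.

Definition rho (m : nat) (Z : Vec) : R := 1 - vnorm2 m Z + / 4 * Cnorm2 (cdot m Z Z).

Lemma rho_continuous m Z : supported m Z -> rcontinuous m (rho m) Z.
Proof.
  intros hs. unfold rho. apply rcontinuous_plus.
  - apply (rcontinuous_plus m (fun _ => 1) (fun y => - vnorm2 m y)); [apply rcontinuous_const|].
    intros eps he. destruct (rcontinuous_scal m (-1) (vnorm2 m) Z) with (eps := eps) as (d & hd & Hd); trivial.
    + apply (rcontinuous_vnorm2 m m (fun y => y)); trivial. intros; now apply sdiff_coord.
    + exists d. split; trivial. intros y h1 h2. specialize (Hd y h1 h2).
      now replace (- vnorm2 m y - - vnorm2 m Z) with (-1 * vnorm2 m y - -1 * vnorm2 m Z) by ring.
  - apply rcontinuous_scal. apply rcontinuous_Cnorm2; trivial.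
    apply (sdiff_csum m m (fun i y => y i * y i)%C). intros. apply sdiff_mult; now apply sdiff_coord.
Qed.

Lemma vsub_vadd (z h : Vec) : vsub (vadd z h) z = h.
Proof.
  apply functional_extensionality. intros i.
  apply injective_projections; unfold vadd, vsub, Cadd, Csub; simpl; ring.
Qed.

Lemma DIV_open m Z : DIV m Z -> exists r, r > 0 /\
  forall h, supported m h -> vnorm m h < r -> DIV m (vadd Z h).
Proof.
  intros (hs & hn & hr).
  destruct (rcontinuous_gt m (rho m) Z 0 (rho_continuous m Z hs) hr) as (r1 & hr1 & H1).
  destruct (rcontinuous_gt m (fun y => -1 * vnorm2 m y) Z (-2)) as (r2 & hr2 & H2).
  { apply rcontinuous_scal, (rcontinuous_vnorm2 m m (fun y => y)); trivial. intros; now apply sdiff_coord. }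
  { lra. }
  exists (Rmin r1 r2). split; [now apply Rmin_pos|]. intros h hh hl.
  assert (hs' : supported m (vadd Z h)) by now apply supported_vadd.
  assert (e : vnorm m (vsub (vadd Z h) Z) = vnorm m h) by now rewrite vsub_vadd.
  specialize (H1 (vadd Z h) hs'). specialize (H2 (vadd Z h) hs'). rewrite e in H1, H2.
  specialize (H1 (Rlt_le_trans _ _ _ hl (Rmin_l _ _))). specialize (H2 (Rlt_le_trans _ _ _ hl (Rmin_r _ _))).
  split; trivial. split; [lra|exact H1].
Qed.

Lemma ball_open n z : Ball n z -> exists r, r > 0 /\
  forall h, supported n h -> vnorm n h < r -> Ball n (vadd z h).
Proof.
  intros (hs & hn).
  destruct (rcontinuous_gt n (fun y => -1 * vnorm2 n y) z (-1)) as (r & hr & H).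
  { apply rcontinuous_scal, (rcontinuous_vnorm2 n n (fun y => y)); trivial. intros; now apply sdiff_coord. }
  { lra. }
  exists r. split; trivial. intros h hh hl.
  assert (hs' : supported n (vadd z h)) by now apply supported_vadd.
  specialize (H (vadd z h) hs'). rewrite vsub_vadd in H. split; trivial. specialize (H hl). lra.
Qed.

Lemma inv_INR_pos (k : nat) : 0 < / INR (S k).
Proof. apply Rinv_0_lt_compat, lt_0_INR. lia. Qed.

(** K is covered by the open sets f > 1 / (k + 1); a finite subcover provides the bound. *)
Lemma compact_lower_bound m K (f : Vec -> R) :
  Defs.compact m K -> (forall Z, supported m Z -> rcontinuous m f Z) -> (forall w, K w -> 0 < f w) ->
  exists e, e > 0 /\ forall w, K w -> e < f w.
Proof.
  intros [hs hK] Hf Hpos.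
  destruct (hK nat (fun k Z => supported m Z /\ / INR (S k) < f Z)) as [l Hl].
  - intros k Z [hZ hk]. destruct (rcontinuous_gt m f Z _ (Hf Z hZ) hk) as (r & hr & Hr).
    exists r. split; trivial. intros y hy hyz. split; auto.
  - intros w hw. specialize (Hpos w hw).
    destruct (archimed_cor1 (f w) Hpos) as (k & hk & hk0). exists (pred k). split; [auto|].
    now replace (S (pred k)) with k by lia.
  - assert (E : exists e, e > 0 /\ forall k, In k l -> e <= / INR (S k)).
    { clear Hl. induction l as [|a l (e & he & IH)]; [exists 1; split; [lra|contradiction]|].
      exists (Rmin e (/ INR (S a))). split; [apply Rmin_pos; trivial; apply inv_INR_pos|].
      intros k [<-|hk]; [apply Rmin_r|]. eapply Rle_trans; [apply Rmin_l|]. now apply IH. }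
    destruct E as (e & he & HE). exists e. split; trivial. intros w hw.
    destruct (Hl w hw) as (k & hk & _ & h). specialize (HE k hk). lra.
Qed.

Lemma Fmap_proper (n d r : nat) : (1 <= n)%nat -> (1 <= d)%nat -> (r < n)%nat ->
  proper n (Ball n) (S (n * d + r)) (DIV (S (n * d + r))) (Fmap n d r).
Proof.
  intros hn hd hr K hK hKD. set (m := S (n * d + r)) in *.
  assert (hINR : 1 <= INR d) by now apply (le_INR 1).
  destruct (compact_lower_bound m K (rho m) hK (rho_continuous m)) as (e & he & HE).
  { intros w hw. apply hKD, hw. }
  (* On K the defining function exceeds e, and at F z it is at most d (1 - |z|^2), so the preimage
     of K keeps away from the sphere. *)
  assert (Hdef : forall z, Ball n z -> K (Fmap n d r z) -> e / INR d < 1 - vnorm2 n z).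
  { intros z hz hk. specialize (HE _ hk). unfold rho in HE. unfold m in HE.
    rewrite Fmap_defining in HE by trivial.
    pose proof (psum_bounds d _ hd (ball_first n z hn hz)) as hp. destruct hz as [_ hz].
    apply Rmult_lt_reg_r with (INR d); [lra|]. unfold Rdiv. rewrite Rmult_assoc, Rinv_l by lra. nra. }
  assert (hed : 0 < e / INR d) by (apply Rdiv_lt_0_compat; lra).
  apply closed_in_ball_compact.
  - intros z [[h1 h2] _]. split; trivial. lra.
  - intros t ht hnt. destruct (Rlt_le_dec (vnorm2 n t) 1) as [h1|h1].
    + assert (hb : Ball n t) by now split.
      assert (hFt : ~ K (Fmap n d r t)) by tauto.
      (* Inside the ball: F t has positive distance from the compact set K, and F is continuous at
         t. *)
      destruct (compact_lower_bound m K (fun Z => vnorm2 m (vsub Z (Fmap n d r t))) hK) as (e' & he' & HE').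
      { intros Z hZ. apply (rcontinuous_vnorm2_sub m m (fun y => y)); trivial. intros; now apply sdiff_coord. }
      { intros w hw. destruct (Rlt_le_dec 0 (vnorm2 m (vsub w (Fmap n d r t)))) as [h|h]; trivial.
        exfalso. apply hFt. replace (Fmap n d r t) with w; trivial.
        apply functional_extensionality. intros i. destruct (Compare_dec.lt_dec i m) as [hi|hi].
        - exact (vnorm2_vsub_eq m _ _ h i hi).
        - destruct hK as [hKs _]. rewrite (hKs w hw i) by lia. symmetry. apply Fmap_supported; trivial; unfold m in hi; lia. }
      destruct (rcontinuous_gt n (fun y => -1 * vnorm2 m (vsub (Fmap n d r y) (Fmap n d r t))) t (- e')) as (r0 & hr0 & Hr0).
      { apply rcontinuous_scal, rcontinuous_vnorm2_sub; trivial. intros i hi. now apply Fmap_sdiff. }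
      { replace (vnorm2 m (vsub (Fmap n d r t) (Fmap n d r t))) with 0; [lra|].
        unfold vnorm2. symmetry. rewrite (rsum_ext m _ (fun _ => 0)), rsum_const; [ring|].
        intros i _. unfold vsub, Cnorm2; simpl. ring. }
      exists r0. split; trivial. intros y hy hyt [_ hky]. specialize (Hr0 y hy hyt). specialize (HE' _ hky). simpl in *. lra.
    (* On or outside the sphere: points near t violate the margin given by [Hdef]. *)
    + destruct (rcontinuous_gt n (vnorm2 n) t (1 - e / INR d)) as (r0 & hr0 & Hr0).
      { apply (rcontinuous_vnorm2 n n (fun y => y)); trivial. intros; now apply sdiff_coord. }
      { lra. }
      exists r0. split; trivial. intros y hy hyt [hb hk]. specialize (Hr0 y hy hyt). specialize (Hdef y hb hk). lra.
Qed.

(** * Coefficients annihilating the map *)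

(** Letting x tend to 0 kills the constant coefficient; dividing by x lowers the degree. *)
Lemma poly_zero (d : nat) (b : nat -> C) :
  (forall x, 0 < x < 1 -> (csum d (fun j => b j * RtoC (x ^ j))%C : C) = 0) ->
  forall j, (j < d)%nat -> b j = 0.
Proof.
  revert b. induction d; intros b H j hj; [lia|].
  set (K := rsum d (fun j => Cmod (b (S j)))).
  assert (hK : 0 <= K) by (apply rsum_nonneg; intros; apply Cmod_ge_0).
  assert (hsplit : forall x, 0 < x < 1 -> (b O + RtoC x * csum d (fun j => b (S j) * RtoC (x ^ j)))%C = 0).
  { intros x hx. rewrite <- (H x hx), csum_S_l, <- csum_scal. f_equal; [simpl; ring|].
    apply csum_ext. intros i _. simpl pow. rewrite RtoC_mult. ring. }
  assert (hb0 : b O = 0).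
  { apply Cmod_eq_0. apply Rle_antisym; [|apply Cmod_ge_0]. apply le_epsilon. intros eps he.
    set (x := Rmin (1 / 2) (eps / (K + 1))).
    assert (hx0 : 0 < x) by (apply Rmin_pos; [lra|apply Rdiv_lt_0_compat; lra]).
    assert (hx1 : x <= 1 / 2) by apply Rmin_l.
    assert (hx2 : x * (K + 1) <= eps).
    { apply Rle_trans with (eps / (K + 1) * (K + 1)).
      - apply Rmult_le_compat_r; [lra|apply Rmin_r].
      - apply Req_le. field. lra. }
    set (q := csum d (fun j => b (S j) * RtoC (x ^ j))%C : C) in *.
    assert (e : b O = (- (RtoC x * q))%C).
    { replace (b O) with (b O + RtoC x * q - RtoC x * q)%C by ring. unfold q. rewrite hsplit by lra. ring. }
    rewrite e, Cmod_opp, Cmod_mult, Cmod_R, Rabs_right by lra.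
    assert (Cmod q <= K).
    { eapply Rle_trans; [apply Cmod_csum_le|]. apply rsum_le. intros i _.
      rewrite Cmod_mult, Cmod_R, Rabs_right by (apply Rle_ge, pow_le; lra).
      pose proof (Cmod_ge_0 (b (S i))). assert (x ^ i <= 1) by (rewrite <- (pow1 i); apply pow_incr; lra).
      nra. }
    nra. }
  destruct j; [exact hb0|]. apply (IHd (fun j => b (S j))); [|lia].
  intros x hx. specialize (hsplit x hx). rewrite hb0, Cplus_0_l in hsplit.
  assert (hxn : RtoC x <> 0) by (intros e; apply RtoC_inj in e; lra).
  set (q := csum d (fun j => b (S j) * RtoC (x ^ j))%C : C) in *.
  replace q with (/ x * (x * q))%C by (field; trivial). rewrite hsplit. ring.
Qed.

Lemma pow_lipschitz (k : nat) (x y : R) :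
  0 <= x <= 1 -> 0 <= y <= 1 -> Rabs (x ^ k - y ^ k) <= INR k * Rabs (x - y).
Proof.
  intros hx hy. induction k; [simpl; rewrite Rminus_diag, Rabs_R0; lra|].
  rewrite S_INR. simpl pow.
  replace (x * x ^ k - y * y ^ k) with (x * (x ^ k - y ^ k) + (x - y) * y ^ k) by ring.
  eapply Rle_trans; [apply Rabs_triang|]. rewrite !Rabs_mult.
  assert (0 <= y ^ k <= 1) by (split; [apply pow_le; lra|rewrite <- (pow1 k); apply pow_incr; lra]).
  rewrite (Rabs_right x), (Rabs_right (y ^ k)) by lra.
  pose proof (Rabs_pos (x ^ k - y ^ k)). pose proof (Rabs_pos (x - y)). nra.
Qed.

(* A function behaving like sqrt (1 - x) at 1 is not Lipschitz there. *)
Lemma sqrt_singularity (a : C) (s P : R -> C) (K B : R) :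
  0 <= K -> 0 <= B ->
  (forall x, 0 <= x < 1 -> (a * s x)%C = P x) ->
  (forall x y, 0 <= x < 1 -> 0 <= y < 1 -> Cmod (P x - P y) <= K * Rabs (x - y)) ->
  (forall x, 0 <= x < 1 -> 1 - x <= Cnorm2 (s x) <= B * (1 - x)) -> a = 0.
Proof.
  intros hK hB HP HL Hs.
  pose proof (Cnorm2_ge0 a) as ha. set (A := Cnorm2 a) in *.
  assert (HPn : forall x, 0 <= x < 1 -> Cmod (P x) * Cmod (P x) = A * Cnorm2 (s x)).
  { intros x hx. rewrite <- HP, <- Cnorm2_Cmod, Cnorm2_mult by trivial. reflexivity. }
  (* P tends to 0 at 1 because |P y|^2 = A |s y|^2 <= A B (1 - y); the Lipschitz bound between x and
     y near 1 then gives the claim. The constant e below makes |P y| <= eps as soon as 1 - y <=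
     e. *)
  assert (Hb : forall x, 0 <= x < 1 -> Cmod (P x) <= K * (1 - x)).
  { intros x hx. apply le_epsilon. intros eps he.
    assert (hAB : 0 <= A * B) by now apply Rmult_le_pos.
    set (e := eps * eps / (A * B + 1)).
    assert (hep : 0 < e) by (apply Rdiv_lt_0_compat; [now apply Rmult_lt_0_compat|lra]).
    set (y := Rmax x (1 - e)).
    assert (hy1 : x <= y) by apply Rmax_l. assert (hy2 : 1 - e <= y) by apply Rmax_r.
    assert (hy : 0 <= y < 1) by (split; [lra|apply Rmax_lub_lt; lra]).
    assert (hPy : Cmod (P y) <= eps).
    { apply Rsqr_incr_0_var; [|lra]. unfold Rsqr. rewrite HPn by trivial.
      destruct (Hs y hy) as [_ h2].
      apply Rle_trans with (A * (B * e)).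
      - apply Rmult_le_compat_l; trivial. eapply Rle_trans; [exact h2|]. apply Rmult_le_compat_l; lra.
      - apply Rle_trans with ((A * B + 1) * e); [nra|]. apply Req_le. unfold e. field. lra. }
    pose proof (HL x y hx hy) as h. rewrite Rabs_left1 in h by lra.
    pose proof (Cmod_triangle (P x - P y) (P y)) as ht. replace (P x - P y + P y)%C with (P x) in ht by ring.
    assert (K * - (x - y) <= K * (1 - x)) by (apply Rmult_le_compat_l; lra). lra. }
  (* A (1 - x) <= |P x|^2 <= K^2 (1 - x)^2, and dividing by 1 - x leaves a bound on A that tends to
     0 at 1. *)
  assert (Hfin : forall x, 0 <= x < 1 -> A <= K * K * (1 - x)).
  { intros x hx. pose proof (Hb x hx) as h1. pose proof (HPn x hx) as h2. destruct (Hs x hx) as [h3 _].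
    pose proof (Cmod_ge_0 (P x)).
    assert (h4 : A * (1 - x) <= A * Cnorm2 (s x)) by (apply Rmult_le_compat_l; trivial).
    assert (h5 : Cmod (P x) * Cmod (P x) <= (K * (1 - x)) * (K * (1 - x))) by (apply Rmult_le_compat; trivial).
    apply Rmult_le_reg_r with (1 - x); lra. }
  apply Cnorm2_eq0. fold A. apply Rle_antisym; trivial.
  apply le_epsilon. intros eps he. rewrite Rplus_0_l.
  assert (hKK : 0 <= K * K) by nra.
  set (e := Rmin 1 (eps / (K * K + 1))).
  assert (hep : 0 < e) by (apply Rmin_pos; [lra|apply Rdiv_lt_0_compat; lra]).
  assert (he1 : e <= 1) by apply Rmin_l.
  assert (he2 : (K * K + 1) * e <= eps).
  { apply Rle_trans with ((K * K + 1) * (eps / (K * K + 1))).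
    - apply Rmult_le_compat_l; [lra|apply Rmin_r].
    - apply Req_le. field. lra. }
  specialize (Hfin (1 - e) ltac:(lra)). lra.
Qed.

(** * Partial derivatives, the reflection, and the behaviour of the map along the axis *)

Definition unit_vec (i : nat) : Vec := fun k => if (k =? i)%nat then RtoC 1 else C0.

Lemma supported_unit_vec (m i : nat) : (i < m)%nat -> supported m (unit_vec i).
Proof. intros hi k hk. unfold unit_vec. rewrite (proj2 (Nat.eqb_neq k i)) by lia. reflexivity. Qed.

Lemma cdot_unit_vec (m i : nat) (a : nat -> C) : (i < m)%nat -> cdot m a (unit_vec i) = a i.
Proof.
  intros hi. unfold cdot. rewrite (csum_single m i); trivial.
  - unfold unit_vec. rewrite Nat.eqb_refl. ring.
  - intros k _ hk. unfold unit_vec. apply Nat.eqb_neq in hk as ->. apply injective_projections; simpl; ring.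
Qed.

Lemma vnorm_unit_vec (m i : nat) : (i < m)%nat -> vnorm m (unit_vec i) = 1.
Proof.
  intros hi. unfold vnorm, vnorm2. rewrite (rsum_single m i); trivial.
  - unfold unit_vec. rewrite Nat.eqb_refl. unfold Cnorm2; simpl. replace (1 * 1 + 0 * 0) with 1 by ring. apply sqrt_1.
  - intros k _ hk. unfold unit_vec. apply Nat.eqb_neq in hk as ->. unfold Cnorm2; simpl. ring.
Qed.

Lemma vnorm_vscal_unit (m i : nat) (t : R) : (i < m)%nat -> vnorm m (vscal t (unit_vec i)) = Rabs t.
Proof.
  intros hi. unfold vnorm. rewrite vnorm2_vscal, <- vnorm_sqr, vnorm_unit_vec by trivial.
  rewrite Cnorm2_Cmod, Cmod_R, !Rmult_1_r. apply sqrt_square, Rabs_pos.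
Qed.

Lemma sderiv_partial (m i : nat) (f : Vec -> C) (Z : Vec) (a : nat -> C) (l : C) (d : R) :
  sderiv m f Z a -> (i < m)%nat -> d > 0 ->
  (forall t : R, Rabs t < d -> f (vadd Z (vscal t (unit_vec i))) = (f Z + t * l)%C) -> a i = l.
Proof.
  intros hf hi hd H. rewrite <- (cdot_unit_vec m i a hi).
  exact (sderiv_affine m f Z a (unit_vec i) l d hf (supported_unit_vec m i hi) hd H).
Qed.

Lemma sderiv_eq_coefs (m : nat) (f : Vec -> C) (Z : Vec) (a b : nat -> C) :
  sderiv m f Z a -> (forall i, (i < m)%nat -> b i = a i) -> sderiv m f Z b.
Proof.
  intros hf H. eapply expands_sderiv; [exact hf|]. intros h _. apply csum_ext.
  intros i hi. now rewrite H.
Qed.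

(** Applied to the components of the two composites of an automorphism with its inverse, it says
    that their differentials are inverse matrices. *)
Lemma DIV_partial_identity (m : nat) (f : Vec -> C) (Z : Vec) (a : nat -> C) (j i : nat) :
  DIV m Z -> (forall W, DIV m W -> f W = W j) -> sderiv m f Z a -> (i < m)%nat ->
  a i = if (j =? i)%nat then RtoC 1 else RtoC 0.
Proof.
  intros hZ Hf hd hi. destruct (DIV_open m Z hZ) as (r & hr & Hr).
  apply (sderiv_partial m i f Z a _ r hd hi hr).
  intros t ht.
  assert (hD : DIV m (vadd Z (vscal t (unit_vec i)))).
  { apply Hr; [now apply supported_vscal, supported_unit_vec|]. now rewrite vnorm_vscal_unit. }
  rewrite (Hf Z hZ), (Hf _ hD). unfold vadd, vscal, unit_vec.
  destruct (j =? i)%nat; apply injective_projections; simpl; ring.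
Qed.

Definition reflect (N : nat) (Z : Vec) : Vec := fun i => if (i =? N)%nat then Copp (Z i) else Z i.

Lemma reflect_fix (N : nat) (Z : Vec) : Z N = C0 -> reflect N Z = Z.
Proof.
  intros hZ. apply functional_extensionality. intros i. unfold reflect.
  destruct (Nat.eqb_spec i N) as [->|]; trivial. rewrite hZ. apply injective_projections; simpl; ring.
Qed.

Lemma reflect_DIV (N m : nat) (Z : Vec) : (N < m)%nat -> DIV m Z -> DIV m (reflect N Z).
Proof.
  intros hN (h1 & h2 & h3).
  assert (e1 : vnorm2 m (reflect N Z) = vnorm2 m Z).
  { apply rsum_ext. intros i _. unfold reflect. destruct (i =? N)%nat; trivial.
    unfold Cnorm2; simpl; ring. }
  assert (e2 : cdot m (reflect N Z) (reflect N Z) = cdot m Z Z).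
  { apply csum_ext. intros i _. unfold reflect. destruct (i =? N)%nat; trivial.
    apply injective_projections; simpl; ring. }
  apply DIV_sq. rewrite e1, e2. split; [|now split].
  intros i hi. unfold reflect. rewrite (proj2 (Nat.eqb_neq i N)) by lia. now apply h1.
Qed.

Lemma DIV_succ (N : nat) (Z : Vec) : DIV N Z -> DIV (S N) Z.
Proof.
  intros (h1 & h2 & h3).
  assert (hN : Z N = C0) by now apply h1.
  assert (e1 : vnorm2 (S N) Z = vnorm2 N Z).
  { unfold vnorm2. simpl. rewrite hN. unfold Cnorm2; simpl. ring. }
  assert (e2 : cdot (S N) Z Z = cdot N Z Z).
  { unfold cdot. rewrite csum_S, hN. apply injective_projections; simpl; ring. }
  apply DIV_sq. rewrite e1, e2. split; [|now split].
  intros i hi. apply h1. lia.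
Qed.

(* The derivative of the component h_t with respect to z_i at (x,0,...,0); only correct for i >= 1. *)
Definition hmap_partial (n d r : nat) (x : R) (i t : nat) : C :=
  if (t <? n * d)%nat
  then (if (t mod n =? i)%nat then RtoC (sqrt (hweight d r (t / n) i) * x ^ (t / n)) else RtoC 0)
  else (if (S (t - n * d) =? i)%nat then (sqrt (/ 2) * Ci)%C else RtoC 0).

(** Powers occur only on z_0, so for i >= 1 every component has degree at most one in z_i and the
    expansion is exact. *)
Lemma hmap_axis_direction (n d r i k : nat) (x t : R) :
  (1 <= n)%nat -> (1 <= i < n)%nat ->
  hmap n d r (vadd (axis x) (vscal t (unit_vec i))) k
    = (hmap n d r (axis x) k + t * hmap_partial n d r x i k)%C.
Proof.
  intros hn hi.
  assert (h0 : vadd (axis x) (vscal t (unit_vec i)) O = RtoC x).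
  { unfold vadd, axis, vscal, unit_vec. destruct i; [lia|].
    apply injective_projections; simpl; ring. }
  assert (hs : forall l, vadd (axis x) (vscal t (unit_vec i)) l
    = (axis x l + t * (if (l =? i)%nat then RtoC 1 else RtoC 0))%C).
  { intros l. unfold vadd, vscal, unit_vec. destruct (l =? i)%nat; apply injective_projections; simpl; ring. }
  unfold hmap, hmap_partial. destruct (k <? n * d)%nat.
  - rewrite h0, hs. change (axis x O) with (RtoC x).
    destruct (Nat.eqb_spec (k mod n) i) as [e|_]; [rewrite e, RtoC_mult, RtoC_pow|]; ring.
  - rewrite hs. destruct (S (k - n * d) =? i)%nat; ring.
Qed.

Lemma hmap_partial_cdot (n d r i : nat) (x : R) (c : nat -> C) :
  (1 <= n)%nat -> (1 <= i < n)%nat -> (r < n)%nat ->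
  cdot (n * d + r) c (hmap_partial n d r x i)
   = (csum d (fun j => c (n * j + i)%nat * RtoC (sqrt (hweight d r j i)) * RtoC (x ^ j))
      + (if (i <=? r)%nat then c (n * d + (i - 1))%nat * (sqrt (/ 2) * Ci) else 0))%C.
Proof.
  intros hn hi hr. unfold cdot. rewrite csum_add, csum_mul. f_equal.
  - apply csum_ext. intros j hj. rewrite (csum_single n i); [|lia|].
    + unfold hmap_partial. destruct (index_div_mod n j i ltac:(lia)) as [-> ->].
      rewrite (proj2 (Nat.ltb_lt _ _)) by nia. rewrite Nat.eqb_refl, RtoC_mult. ring.
    + intros l hl hne. unfold hmap_partial. destruct (index_div_mod n j l hl) as [-> ->].
      rewrite (proj2 (Nat.ltb_lt _ _)) by nia. rewrite (proj2 (Nat.eqb_neq l i)) by trivial. ring.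
  - assert (he : forall e, hmap_partial n d r x i (n * d + e) = if (S e =? i)%nat then (sqrt (/ 2) * Ci)%C else RtoC 0).
    { intros e. unfold hmap_partial. rewrite (proj2 (Nat.ltb_ge _ _)) by lia.
      now replace (n * d + e - n * d)%nat with e by lia. }
    destruct (Nat.leb_spec i r) as [h1|h1].
    + rewrite (csum_single r (i - 1)); [|lia|].
      * rewrite he. now replace (S (i - 1)) with i by lia; rewrite Nat.eqb_refl.
      * intros e _ hne. rewrite he, (proj2 (Nat.eqb_neq (S e) i)) by lia. ring.
    + apply csum_zero. intros e hlt. rewrite he, (proj2 (Nat.eqb_neq (S e) i)) by lia. ring.
Qed.

(** On the axis the squared modulus of the root is 1 - q, where q is the average of x^2, x^4, ...,
    x^(2d), and each 1 - x^k lies between 1 - x and k (1 - x). *)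
Lemma csqrt_axis_bounds (n d r : nat) (x : R) :
  (1 <= n)%nat -> (1 <= d)%nat -> (r < n)%nat -> 0 <= x < 1 ->
  1 - x <= Cnorm2 (csqrt (1 - cdot (n * d + r) (hmap n d r (axis x)) (hmap n d r (axis x))))
    <= INR (2 * d) * (1 - x).
Proof.
  intros hn hd hr hx.
  pose proof (csqrt_sqr _ (hmap_sq_re n d r hn hd hr _ (axis_ball n x hn hx))) as e.
  set (s := csqrt _) in *.
  rewrite hmap_axis_sq in e by trivial.
  set (q := rsum d (fun j => / INR d * x ^ (2 * S j))) in *.
  assert (hINR : 1 <= INR d) by now apply (le_INR 1).
  assert (hq : 1 - q = rsum d (fun j => / INR d * (1 - x ^ (2 * S j)))).
  { unfold q. rewrite (rsum_ext d (fun j => / INR d * (1 - x ^ (2 * S j))) (fun j => / INR d - / INR d * x ^ (2 * S j)))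
      by (intros; ring).
    rewrite rsum_minus, rsum_const. rewrite Rinv_r by lra. reflexivity. }
  assert (hb : forall k, (1 <= k)%nat -> 1 - x <= 1 - x ^ k <= INR k * (1 - x)).
  { intros k hk. split.
    - destruct k; [lia|]. assert (x ^ k <= 1) by (rewrite <- (pow1 k); apply pow_incr; lra). simpl. nra.
    - pose proof (pow_lipschitz k 1 x ltac:(lra) ltac:(lra)) as h. rewrite pow1, (Rabs_right (1 - x)) in h by lra.
      eapply Rle_trans; [apply Rle_abs|exact h]. }
  assert (hi : 0 < / INR d) by (apply Rinv_0_lt_compat; lra).
  assert (hmul : forall k, rsum d (fun _ => / INR d * k) = k) by (intros k; rewrite rsum_const; field; lra).
  assert (h1 : 1 - x <= 1 - q).
  { rewrite hq, <- (hmul (1 - x)). apply rsum_le. intros j hj. apply Rmult_le_compat_l; [lra|]. apply hb; lia. }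
  assert (h2 : 1 - q <= INR (2 * d) * (1 - x)).
  { rewrite hq, <- (hmul (INR (2 * d) * (1 - x))). apply rsum_le. intros j hj. apply Rmult_le_compat_l; [lra|].
    eapply Rle_trans; [apply hb; lia|]. apply Rmult_le_compat_r; [lra|]. apply le_INR. lia. }
  apply (f_equal Cnorm2) in e. rewrite Cnorm2_mult in e.
  replace (Cnorm2 (1 - q)%C) with ((1 - q) * (1 - q)) in e by (unfold Cnorm2; simpl; ring).
  assert (es : Cnorm2 s = 1 - q).
  { apply Rsqr_inj; [apply Cnorm2_ge0|lra|]. exact e. }
  rewrite es. lra.
Qed.

Section Minimality.
Context (n d r : nat) (hn : (1 <= n)%nat) (hd : (1 <= d)%nat) (hr : (r < n)%nat).
Let N := (n * d + r)%nat.
Let F := Fmap n d r.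
Context (c : nat -> C)
  (Hval : forall x, 0 <= x < 1 -> cdot (S N) c (F (axis x)) = 0).

(** On the axis the relation c F = 0 equates c_N times the square root with a polynomial in x, which
    is Lipschitz up to x = 1 while the root is not. *)
Lemma last_coef_zero : c N = 0.
Proof.
  pose (b := fun j => (c (n * j)%nat * RtoC (sqrt (/ INR d)))%C).
  apply (sqrt_singularity (c N) (fun x => csqrt (1 - cdot N (hmap n d r (axis x)) (hmap n d r (axis x))))
    (fun x => c N + csum d (fun j => b j * RtoC (x ^ S j)))%C
    (rsum d (fun j => Cmod (b j) * INR (S j))) (INR (2 * d))).
  - apply rsum_nonneg. intros. apply Rmult_le_pos; [apply Cmod_ge_0|apply pos_INR].
  - apply pos_INR.
  - intros x hx. specialize (Hval x hx). unfold F, N in Hval. rewrite Fmap_cdot, hmap_axis_cdot in Hval by trivial.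
    unfold Flast in Hval. fold N in Hval. set (s := csqrt _) in *.
    rewrite (csum_ext d _ (fun j => b j * RtoC (x ^ S j))%C) in Hval
      by (intros; unfold b; rewrite RtoC_mult; ring).
    set (p := csum d (fun j => b j * RtoC (x ^ S j))%C : C) in *.
    replace (c N + p)%C with (p + c N * (1 - s) + c N * s)%C by ring. rewrite Hval. ring.
  - intros x y hx hy.
    replace (c N + csum d (fun j => b j * RtoC (x ^ S j)) - (c N + csum d (fun j => b j * RtoC (y ^ S j))))%C
      with (csum d (fun j => b j * RtoC (x ^ S j - y ^ S j))%C : C).
    + eapply Rle_trans; [apply Cmod_csum_le|]. rewrite Rmult_comm, <- rsum_scal. apply rsum_le. intros j _.
      rewrite Cmod_mult, Cmod_R. pose proof (pow_lipschitz (S j) x y ltac:(lra) ltac:(lra)) as h.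
      apply (Rmult_le_compat_l _ _ _ (Cmod_ge_0 (b j))) in h. lra.
    + rewrite (csum_ext d _ (fun j => b j * RtoC (x ^ S j) + (- (1)) * (b j * RtoC (y ^ S j)))%C)
        by (intros; rewrite RtoC_minus; ring).
      rewrite csum_plus, csum_scal. ring.
  - intros x hx. now apply csqrt_axis_bounds.
Qed.

Lemma axis_coef_zero j : (j < d)%nat -> c (n * j)%nat = 0.
Proof.
  intros hj.
  assert (hsq : RtoC (sqrt (/ INR d)) <> 0).
  { assert (1 <= INR d) by now apply (le_INR 1).
    intros e. apply RtoC_inj in e. assert (0 < sqrt (/ INR d)) by (apply sqrt_lt_R0, Rinv_0_lt_compat; lra). lra. }
  assert (hb : (c (n * j)%nat * RtoC (sqrt (/ INR d)))%C = 0).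
  { apply (poly_zero d (fun j => (c (n * j)%nat * RtoC (sqrt (/ INR d)))%C)); trivial.
    intros x hx. pose proof (Hval x ltac:(lra)) as h. unfold F, N in h.
    rewrite Fmap_cdot, hmap_axis_cdot in h by trivial. fold N in h. rewrite last_coef_zero in h.
    assert (hxn : RtoC x <> 0) by (intros e; apply RtoC_inj in e; lra).
    set (q := csum d (fun j => c (n * j)%nat * RtoC (sqrt (/ INR d)) * RtoC (x ^ j))%C : C).
    assert (e : (x * q)%C = 0).
    { rewrite <- h. unfold q. rewrite <- csum_scal, Cmult_0_l, Cplus_0_r. apply csum_ext. intros i _.
      simpl pow. rewrite !RtoC_mult. ring. }
    replace q with (/ x * (x * q))%C by (field; trivial). rewrite e. ring. }
  replace (c (n * j)%nat) with (c (n * j)%nat * RtoC (sqrt (/ INR d)) * / RtoC (sqrt (/ INR d)))%C by (field; trivial).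
  rewrite hb. ring.
Qed.

Context (Hder : forall x i, 0 <= x < 1 -> (1 <= i < n)%nat -> cdot N c (hmap_partial n d r x i) = 0)
  (S Q : C) (HS : S <> 0)
  (Hphase : forall j, (j < N)%nat -> (S * Cconj (c j))%C = (Q * c j)%C).

Lemma coef_zero j : (j < N)%nat -> c j = 0.
Proof.
  set (extra := fun i => if (i <=? r)%nat then (c (n * d + (i - 1))%nat * (sqrt (/ 2) * Ci))%C else RtoC 0).
  (* The relation [Hder] is polynomial in x. Its coefficient of degree j involves c_(n j + i) alone,
     except that for i <= r the repeated component adds a term in degree 0. *)
  assert (Hrel : forall i, (1 <= i < n)%nat -> forall j, (j < d)%nat ->
    (c (n * j + i)%nat * RtoC (sqrt (hweight d r j i)) + (if (j =? 0)%nat then extra i else RtoC 0))%C = 0).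
  { intros i hi. apply poly_zero. intros x hx.
    transitivity (cdot N c (hmap_partial n d r x i)); [|apply Hder; trivial; lra].
    unfold N. rewrite hmap_partial_cdot by trivial. fold (extra i).
    rewrite (csum_ext d _ (fun j => c (n * j + i)%nat * RtoC (sqrt (hweight d r j i)) * RtoC (x ^ j)
      + (if (j =? 0)%nat then extra i else RtoC 0) * RtoC (x ^ j))%C) by (intros; ring).
    rewrite csum_plus. f_equal. rewrite (csum_single d 0); [simpl; cring|lia|].
    intros k _ hk. apply Nat.eqb_neq in hk as ->. cring. }
  assert (hw : forall j i, (j < d)%nat -> RtoC (sqrt (hweight d r j i)) <> 0).
  { intros k i hk e. apply RtoC_inj in e. pose proof (sqrt_lt_R0 _ (hweight_pos d r hd k i hk)). lra. }
  assert (hcancel : forall a b : C, b <> 0 -> (a * b)%C = 0 -> a = 0).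
  { intros a b hb e. replace a with (a * b * / b)%C by (field; trivial). rewrite e. ring. }
  (* In degree 0 the relation reads z = - i y for the coefficients z of z_i and y of its repetition.
     Both satisfy S conj = Q, and conj z = i conj y, so i Q y = - i Q y; then Q y = 0 and S conj y =
     0. *)
  assert (Hlin : forall i, (1 <= i <= r)%nat -> c i = 0 /\ c (n * d + (i - 1))%nat = 0).
  { intros i hi. pose proof (Hrel i ltac:(lia) 0%nat hd) as e.
    rewrite Nat.mul_0_r, Nat.add_0_l, Nat.eqb_refl in e. unfold extra in e.
    rewrite (proj2 (Nat.leb_le i r)) in e by lia.
    unfold hweight in e. rewrite (proj2 (Nat.eqb_neq i 0)), (proj2 (Nat.leb_le i r)) in e by lia.
    simpl andb in e. cbv iota in e.
    set (y := c (n * d + (i - 1))%nat) in *. set (z := c i) in *.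
    assert (h2 : RtoC (sqrt (/ 2)) <> 0).
    { intros h. apply RtoC_inj in h. assert (0 < sqrt (/ 2)) by (apply sqrt_lt_R0; lra). lra. }
    assert (e1 : z = (- (Ci * y))%C).
    { assert (e2 : (z + Ci * y)%C = 0) by (apply (hcancel _ _ h2); rewrite <- e; ring).
      replace z with (z + Ci * y - Ci * y)%C by ring. rewrite e2. ring. }
    assert (hz : (S * Cconj z)%C = (Q * z)%C) by (apply Hphase; unfold N; nia).
    assert (hy : (S * Cconj y)%C = (Q * y)%C) by (apply Hphase; unfold N; lia).
    assert (hQ : (Q * y)%C = 0).
    { assert (e3 : (2 * Ci * (Q * y))%C = 0).
      { assert (ez : Cconj z = (Ci * Cconj y)%C).
        { rewrite e1. apply injective_projections; simpl; ring. }
        rewrite ez, e1 in hz.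
        replace (S * (Ci * Cconj y))%C with (Ci * (S * Cconj y))%C in hz by ring. rewrite hy in hz.
        replace (2 * Ci * (Q * y))%C with (Ci * (Q * y) - Q * (- (Ci * y)))%C by ring. rewrite hz. ring. }
      apply (hcancel _ (2 * Ci)%C).
      - intros h. apply (f_equal snd) in h. simpl in h. lra.
      - rewrite <- e3. ring. }
    rewrite hQ in hy.
    assert (hy0 : Cconj y = 0) by (apply (hcancel _ S HS); rewrite <- hy; ring).
    assert (hy1 : y = 0).
    { apply Cmod_eq_0. rewrite <- Cmod_conj, hy0. apply Cmod_0. }
    split; [|exact hy1]. rewrite e1, hy1. ring. }
  intros hj. unfold N in hj. destruct (Compare_dec.lt_dec j (n * d)) as [h1|h1].
  - rewrite (Nat.div_mod_eq j n).
    assert (hjd : (j / n < d)%nat) by (apply Nat.Div0.div_lt_upper_bound; lia).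
    assert (hjn : (j mod n < n)%nat) by (apply Nat.mod_upper_bound; lia).
    destruct (Nat.eq_dec (j mod n) 0) as [e0|e0].
    { rewrite e0, Nat.add_0_r. now apply axis_coef_zero. }
    set (i := (j mod n)%nat) in *. set (k := (j / n)%nat) in *.
    destruct (Nat.eq_dec k 0) as [k0|k0].
    + destruct (Compare_dec.le_dec i r) as [hir|hir].
      * rewrite k0, Nat.mul_0_r. apply Hlin. lia.
      * pose proof (Hrel i ltac:(lia) k hjd) as e. rewrite k0 in *. rewrite Nat.eqb_refl in e. unfold extra in e.
        rewrite (proj2 (Nat.leb_gt i r)) in e by lia. apply (hcancel _ _ (hw 0%nat i hd)). rewrite <- e. ring.
    + pose proof (Hrel i ltac:(lia) k hjd) as e. rewrite (proj2 (Nat.eqb_neq k 0)) in e by trivial.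
      apply (hcancel _ _ (hw k i hjd)). rewrite <- e. ring.
  - replace j with (n * d + ((1 + (j - n * d)) - 1))%nat by lia. apply Hlin. lia.
Qed.
End Minimality.

(** * Minimality *)

Section Conjugate.
Context (N : nat) (phi Phi : Vec -> Vec).
Let m := S N.
Context (phi_holo : holomorphic m m (DIV m) phi) (phi_DIV : forall Z, DIV m Z -> DIV m (phi Z))
  (Phi_holo : holomorphic m m (DIV m) Phi) (Phi_DIV : forall Z, DIV m Z -> DIV m (Phi Z))
  (Phi_phi : forall Z, DIV m Z -> Phi (phi Z) = Z) (phi_Phi : forall Z, DIV m Z -> phi (Phi Z) = Z).

Definition conj_reflect (Z : Vec) : Vec := phi (reflect N (Phi Z)).

Let eps (a : nat) : C := if (a =? N)%nat then (- (1))%C else RtoC 1.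

Let HN : (N < m)%nat.
Proof. unfold m. lia. Qed.

Lemma conj_reflect_DIV Z : DIV m Z -> DIV m (conj_reflect Z).
Proof. intros hZ. apply phi_DIV, reflect_DIV; auto. Qed.

Let near_DIV (G : Vec -> Vec) : (forall W, DIV m W -> DIV m (G W)) -> forall Z, DIV m Z ->
  exists delta, delta > 0 /\ forall h, supported m h -> vnorm m h < delta -> supported m (G (vadd Z h)).
Proof.
  intros HG Z hZ. destruct (DIV_open m Z hZ) as (r & hr & Hr). exists r. split; trivial.
  intros h h1 h2. apply (HG (vadd Z h)). auto.
Qed.

Lemma conj_reflect_sderiv Z (A B : nat -> nat -> C) j :
  DIV m Z -> (j < m)%nat ->
  (forall j, (j < m)%nat -> sderiv m (fun W => phi W j) (reflect N (Phi Z)) (A j)) ->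
  (forall a, (a < m)%nat -> sderiv m (fun W => Phi W a) Z (B a)) ->
  sderiv m (fun W => conj_reflect W j) Z (fun k => csum m (fun a => A j a * (eps a * B a k))%C).
Proof.
  intros hZ hj HA HB.
  apply (sderiv_chain m m (fun W => phi W j) (A j) (fun W => reflect N (Phi W)) Z (fun a k => eps a * B a k)%C).
  - now apply HA.
  - intros a ha. unfold reflect, eps. destruct (a =? N)%nat.
    + pose proof (expands_scal _ _ (vnorm_ge0 m) (- (1))%C _ _ _ (HB a ha)) as hs.
      eapply expands_ext; [exact hs| | |].
      * exists 1. split; [lra|]. intros h _ _. cring.
      * cring.
      * intros h _. cbv beta. rewrite <- csum_scal. apply csum_ext. intros. ring.
    + eapply sderiv_eq_coefs; [exact (HB a ha)|]. intros. simpl. ring.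
  - now apply reflect_DIV; auto.
  - apply (near_DIV (fun W => reflect N (Phi W))); trivial. intros W hW. apply reflect_DIV; auto.
Qed.

Lemma conj_reflect_diff Z j : DIV m Z -> (j < m)%nat -> exists a, sderiv m (fun W => conj_reflect W j) Z a.
Proof.
  intros hZ hj.
  destruct (holomorphic_sderiv m m _ phi (reflect N (Phi Z)) phi_holo (reflect_DIV N m _ HN (Phi_DIV Z hZ))) as [A HA].
  destruct (holomorphic_sderiv m m _ Phi Z Phi_holo hZ) as [B HB].
  eexists. exact (conj_reflect_sderiv Z A B j hZ hj HA HB).
Qed.

(** The reflection is I - 2 e e^t with e the last basis vector, and it fixes q0. With A = d phi at
    q0 and B = d Phi at 0, inverse to each other, the differential is A (I - 2 e e^t) B = I - 2 (A
    e) (e^t B): u is the last column of A, c the last row of B, and c u is a diagonal entry of B A =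
    I. *)
Lemma conj_reflect_deriv_0 (q0 : Vec) :
  DIV m q0 -> q0 N = C0 -> phi q0 = (fun _ => C0) ->
  exists u c : nat -> C, cdot m c u = 1 /\
    forall j, (j < m)%nat -> sderiv m (fun W => conj_reflect W j) (fun _ => C0)
     (fun k => (if (j =? k)%nat then RtoC 1 else RtoC 0) - 2 * (u j * c k))%C.
Proof.
  intros hq hqN hphi.
  assert (h0 : DIV m (fun _ => C0)) by (rewrite <- hphi; auto).
  assert (hPhi : Phi (fun _ => C0) = q0) by (rewrite <- hphi; auto).
  destruct (holomorphic_sderiv m m _ phi q0 phi_holo hq) as [A HA].
  destruct (holomorphic_sderiv m m _ Phi (fun _ => C0) Phi_holo h0) as [B HB].
  exists (fun j => A j N), (fun k => B N k). split.
  - pose proof (sderiv_chain m m (fun W => Phi W N) (B N) phi q0 A) as h. rewrite hphi in h.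
    specialize (h (HB N HN) HA (proj1 h0) (near_DIV phi phi_DIV q0 hq)).
    apply (DIV_partial_identity m _ q0 _ N N hq) in h; trivial.
    + rewrite Nat.eqb_refl in h. exact h.
    + intros W hW. now rewrite Phi_phi.
  - intros j hj.
    assert (hAB : forall k, (k < m)%nat ->
      (csum m (fun a => A j a * B a k)%C : C) = if (j =? k)%nat then RtoC 1 else RtoC 0).
    { intros k hk. pose proof (sderiv_chain m m (fun W => phi W j) (A j) Phi (fun _ => C0) B) as h.
      rewrite hPhi in h. specialize (h (HA j hj) HB (proj1 hq) (near_DIV Phi Phi_DIV _ h0)).
      apply (DIV_partial_identity m _ _ _ j k h0) in h; trivial.
      intros W hW. now rewrite phi_Phi. }
    eapply sderiv_eq_coefs.
    + apply (conj_reflect_sderiv (fun _ => C0) A B j h0 hj); trivial.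
      rewrite hPhi, reflect_fix by trivial. exact HA.
    + intros k hk. cbv beta.
      rewrite (csum_ext m _ (fun a => A j a * B a k + (-2) * (if (a =? N)%nat then A j a * B a k else RtoC 0))%C).
      * rewrite csum_plus, csum_scal, hAB, (csum_single m N); trivial.
        -- rewrite Nat.eqb_refl. ring.
        -- intros a _ ha. now apply Nat.eqb_neq in ha as ->.
      * intros a _. unfold eps. destruct (a =? N)%nat; ring.
Qed.
End Conjugate.

Theorem Fmap_minimum (n d r : nat) : (1 <= n)%nat -> (1 <= d)%nat -> (r < n)%nat ->
  minimum n (S (n * d + r)) (Fmap n d r).
Proof.
  intros hn hd hr. set (N := (n * d + r)%nat). set (F := Fmap n d r).
  intros [G [[_ HG] (psi & phi & [[_ Hpsi] _] & [[phi_holo phi_DIV] (Phi & [Phi_holo Phi_DIV] & Phi_phi & phi_Phi)] & Heq)]].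
  replace (S N - 1)%nat with N in HG by lia.
  set (m := S N) in *.
  set (tau := conj_reflect N phi Phi).
  assert (HGm : forall z, Ball n z -> DIV m (G (psi z))) by (intros; apply DIV_succ; auto).
  assert (HGN : forall z, Ball n z -> G (psi z) N = C0).
  { intros z hz. destruct (HG (psi z) (Hpsi z hz)) as [hs _]. apply hs. lia. }
  (* [Phi] carries F z to G (psi z), whose last coordinate is 0, hence to a fixed point of the
     reflection. *)
  assert (Hfix : forall z, Ball n z -> tau (F z) = F z).
  { intros z hz. unfold tau, conj_reflect. rewrite (Heq z hz), Phi_phi by auto. now rewrite reflect_fix by auto. }
  assert (h0 : Ball n (fun _ => C0)).
  { replace (fun _ : nat => C0) with (axis 0); [apply axis_ball; trivial; lra|].
    apply functional_extensionality. intros i. unfold axis. now destruct (i =? 0)%nat. }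
  assert (tau_0 : tau (fun _ => C0) = fun _ => C0).
  { pose proof (Hfix _ h0) as e. unfold F in e. now rewrite Fmap_0 in e by trivial. }
  destruct (conj_reflect_deriv_0 N phi Phi phi_holo phi_DIV Phi_holo Phi_DIV Phi_phi phi_Phi (G (psi (fun _ => C0))))
    as (u & c & cu & Hd); auto.
  { rewrite <- Heq by trivial. unfold F. now apply Fmap_0. }
  fold tau m in Hd, cu.
  assert (tau_DIV : forall Z, DIV m Z -> DIV m (tau Z)).
  { intros Z hZ. now apply conj_reflect_DIV. }
  assert (tau_diff : forall Z j, DIV m Z -> (j < m)%nat -> exists a, sderiv m (fun W => tau W j) Z a).
  { intros Z j hZ hj. now apply conj_reflect_diff. }
  pose proof (tau_eq_lin_real m tau u c tau_DIV tau_diff tau_0 Hd cu) as Hreal.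
  assert (HFD : forall z, Ball n z -> DIV m (F z)) by (intros; now apply Fmap_DIV).
  (* Because c u = 1, the vector u is nonzero on the support of c, so a multiple w u vanishing there
     has w = 0. Allowing c_j = 0 lets the last index be skipped later. *)
  assert (Hcancel : forall w : C, (forall j, (j < m)%nat -> c j = 0 \/ (u j * w)%C = 0) -> w = 0).
  { intros w Hw. replace w with (w * cdot m c u)%C by (rewrite cu; ring).
    unfold cdot. rewrite <- csum_scal. apply csum_zero. intros j hj.
    destruct (Hw j hj) as [e|e]; [rewrite e; ring|].
    replace (w * (c j * u j))%C with (c j * (u j * w))%C by ring. rewrite e. ring. }
  assert (Hhalf : forall w : C, (2 * w)%C = 0 -> w = 0).
  { intros w e. replace w with (/ 2 * (2 * w))%C by (field; intros h; apply RtoC_inj in h; lra). rewrite e. ring. }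
  (* At a real point of the image F = tau F = F - 2 u (c F), hence u (c F) = 0. *)
  assert (Hval : forall x, 0 <= x < 1 -> cdot m c (F (axis x)) = 0).
  { intros x hx. pose proof (axis_ball n x hn hx) as hb. apply Hcancel. intros j hj. right.
    pose proof (Hreal (F (axis x)) j (HFD _ hb) (Fmap_axis_real n d r hn hd hr x) hj) as e.
    rewrite Hfix in e by trivial. unfold lin in e. apply Hhalf.
    set (s := cdot m c (F (axis x))) in *. set (p := (F (axis x) j : C)) in *.
    replace (2 * (u j * s))%C with (p - (p - 2 * (u j * s)))%C by ring. rewrite <- e. ring. }
  pose proof (last_coef_zero n d r hn hd hr c Hval) as HcN. fold N in HcN.
  assert (Hder : forall x i, 0 <= x < 1 -> (1 <= i < n)%nat -> cdot N c (hmap_partial n d r x i) = 0).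
  { intros x i hx hi. pose proof (axis_ball n x hn hx) as hb. set (p := F (axis x)).
    assert (hp : DIV m p) by now apply HFD.
    (* Moving p by real multiples of a basis vector stays among real points, where [tau] is L; so
       the differential of [tau] at p is L as well. *)
    assert (HT : forall j, (j < m)%nat -> exists T, sderiv m (fun W => tau W j) p T /\
      forall k, (k < m)%nat -> T k = ((if (j =? k)%nat then RtoC 1 else RtoC 0) - 2 * (u j * c k))%C).
    { intros j hj. destruct (tau_diff p j hp hj) as [T hT]. exists T. split; trivial. intros k hk.
      destruct (DIV_open m p hp) as (e & he & He).
      apply (sderiv_partial m k (fun W => tau W j) p T _ e hT hk he). intros t ht.
      assert (hD : DIV m (vadd p (vscal t (unit_vec k)))).
      { apply He; [now apply supported_vscal, supported_unit_vec|]. now rewrite vnorm_vscal_unit. }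
      assert (hre : forall i, Im (p i) = 0) by apply (Fmap_axis_real n d r hn hd hr).
      rewrite (Hreal p j hp hre hj), (Hreal _ j hD); trivial.
      - unfold lin.
        assert (E : cdot m c (vadd p (vscal t (unit_vec k))) = (cdot m c p + t * c k)%C).
        { rewrite <- (cdot_unit_vec m k c hk), <- cdot_vscal. unfold cdot. rewrite <- csum_plus.
          apply csum_ext. intros a _. unfold vadd. change Cadd with Cplus. ring. }
        rewrite E. unfold vadd at 1, vscal, unit_vec. change Cadd with Cplus.
        destruct (j =? k)%nat; [cring|]. change C0 with (RtoC 0). cring.
      - intros a. unfold vadd, vscal, unit_vec. specialize (hre a). unfold Im in *. simpl. rewrite hre.
        destruct (a =? k)%nat; simpl; ring. }
    assert (HAF : exists AF, forall k, (k < m)%nat -> sderiv n (fun z => F z k) (axis x) (AF k)).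
    { apply (holomorphic_sderiv n m (Ball n) F); trivial. now apply Fmap_holomorphic. }
    destruct HAF as [AF HAF].
    destruct (ball_open n (axis x) hb) as (e & he & He).
    assert (hin : (i < n)%nat) by lia.
    assert (hmove : forall t : R, Rabs t < e -> Ball n (vadd (axis x) (vscal t (unit_vec i)))).
    { intros t ht. apply He; [now apply supported_vscal, supported_unit_vec|]. now rewrite vnorm_vscal_unit. }
    assert (Hmoved : forall j, (j < N)%nat -> forall t : R,
      F (vadd (axis x) (vscal t (unit_vec i))) j = (F (axis x) j + t * hmap_partial n d r x i j)%C).
    { intros j hj t. unfold F. rewrite !Fmap_lt by trivial. now apply hmap_axis_direction. }
    assert (HAFv : forall j, (j < N)%nat -> AF j i = hmap_partial n d r x i j).
    { intros j hj. apply (sderiv_partial n i (fun z => F z j) (axis x) (AF j) _ e); trivial.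
      - apply HAF. unfold m. lia.
      - intros t _. now apply Hmoved. }
    (* Differentiating tau F = F in the direction z_i at p gives L D = D for the derivative D of F,
       hence u (c D) = 0. *)
    set (w := cdot m c (fun k => AF k i)).
    assert (Ew : w = cdot N c (hmap_partial n d r x i)).
    { unfold w, cdot, m. rewrite csum_S, HcN.
      rewrite (csum_ext N _ (fun k => c k * hmap_partial n d r x i k)%C) by (intros; now rewrite HAFv). ring. }
    rewrite <- Ew. apply Hcancel. intros j hj.
    (* The last component of F is not computed along this direction; its index is covered by c_N =
       0. *)
    destruct (Nat.eq_dec j N) as [->|hjN]; [now left|right].
    assert (hjN' : (j < N)%nat) by (unfold m in hj; lia).
    destruct (HT j hj) as (T & hT & HTk).
    pose proof (sderiv_chain n m (fun W => tau W j) T F (axis x) AF hT HAF (proj1 hp)) as hch.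
    assert (hsupp : exists delta, delta > 0 /\ forall h, supported n h -> vnorm n h < delta -> supported m (F (vadd (axis x) h))).
    { exists e. split; trivial. intros h h1 h2. apply (HFD (vadd (axis x) h)). auto. }
    specialize (hch hsupp).
    apply (sderiv_partial n i _ (axis x) _ (hmap_partial n d r x i j) e) in hch; trivial.
    2:{ intros t ht. rewrite !Hfix by auto. now apply Hmoved. }
    cbv beta in hch. rewrite (csum_ext m _ (fun k => (if (j =? k)%nat then RtoC 1 else RtoC 0) * AF k i + (-2 * u j) * (c k * AF k i))%C)
      in hch by (intros k hk; rewrite HTk by trivial; ring).
    rewrite csum_plus, csum_scal, (csum_single m j) in hch; trivial.
    2:{ intros k _ hk. rewrite (proj2 (Nat.eqb_neq j k)) by auto. ring. }
    rewrite Nat.eqb_refl, HAFv in hch by trivial. fold (cdot m c (fun k => AF k i)) in hch. fold w in hch.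
    apply Hhalf. set (D := hmap_partial n d r x i j) in *.
    replace (2 * (u j * w))%C with (D - (1 * D + -2 * u j * w))%C by ring. rewrite hch. ring. }
  pose proof (norm_c_pos m u c cu) as hS.
  assert (Hphase : forall j, (j < N)%nat -> (vnorm2 m c * Cconj (c j))%C = (Cconj (cdot m c c) * c j)%C).
  { intros j hj. apply (c_phase_real m tau u c tau_DIV tau_diff tau_0 Hd cu N j); trivial; unfold m; lia. }
  assert (HS : RtoC (vnorm2 m c) <> 0) by (intros e; apply RtoC_inj in e; lra).
  pose proof (coef_zero n d r hn hd hr c Hval Hder _ _ HS Hphase) as Hzero.
  assert (e : cdot m c u = 0).
  { apply csum_zero. intros j hj. destruct (Nat.eq_dec j N) as [->|hne]; [rewrite HcN; ring|].
    rewrite Hzero; [ring|]. fold N. unfold m in hj. lia. }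
  rewrite cu in e. apply RtoC_inj in e. lra.
Qed.

Theorem mainTheorem3 (n m : nat) (hn : (1 <= n)%nat) (hm : (n + 1 <= m)%nat) :
  exists F : Vec -> Vec,
    holo_map n (Ball n) m (DIV m) F /\
    proper n (Ball n) m (DIV m) F /\
    minimum n m F.
Proof.
  (* Euclidean division m - 1 = n d + r; m >= n + 1 is exactly what gives d >= 1. *)
  assert (hd : (1 <= (m - 1) / n)%nat) by (apply Nat.div_le_lower_bound; lia).
  assert (hr : ((m - 1) mod n < n)%nat) by (apply Nat.mod_upper_bound; lia).
  replace m with (S (n * ((m - 1) / n) + (m - 1) mod n)) by (rewrite <- Nat.div_mod_eq; lia).
  exists (Fmap n ((m - 1) / n) ((m - 1) mod n)). split; [|split].
  - now apply Fmap_holo_map.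
  - now apply Fmap_proper.
  - now apply Fmap_minimum.
Qed.
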